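(* Let $K, f, (\Gamma_w)_{w\in W}, U$ be as in the context and assume that the contours $\Gamma_w$ can be deformed to contours $\tilde\Gamma_w$ satisfying the angle condition and the decay estimates on $K$ and $f$ given in the context, with constants $d,b,c,\delta_1,\delta_2$, $\delta=\delta_1-\delta_2>0$, $c_w$, $\tilde c_\gamma$. Then, as $\gamma\to 0$ in $U$, there is an asymptotic expansion in the Poincar\'e sense to all orders $$A^\gamma_{K,\Gamma}(f)\sim \tilde A^\gamma_{K,\Gamma}(f).$$ In fact, for all integers $n\ge k_0-1$ and all $(w,\gamma)\in W\times U$, $$\left| A^\gamma_{K,\Gamma}(f)(w)-\tilde A^{\gamma,n}_{K,\Gamma}(f)(w)\right|\le C_n\, c_w\,\tilde c_\gamma\,|\gamma|^{n}\,\delta^{-(n-k_0+1)}\,(n-k_0+1)!,$$ where $$C_{k_0-1}=\frac{d|\gamma|}{bc\delta}\,c'_{k_0},\qquad C_n=\frac{2d}{bc\sqrt{\pi(1+2(n-k_0))}}\,c'_n\quad(n\ge k_0),$$ $$c'_n=\inf_{0<r<R_f}\frac{1}{r^{n}}\left(c\,r^{-n_0}+\kappa(r)\right)\quad (n\ge k_0).$$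
   Context: Setting. For a meromorphic function $h$ on $\mathbb C$, $P_h$ denotes its set of poles and $h_\gamma(z)=h(\gamma z)$ for $\gamma\in\mathbb C$. $D(0,R)$ is the open disc of radius $R$ about $0$. $W\subset\mathbb C$ is open and connected; $K$ is a meromorphic function on $W\times\mathbb C$ such that for every $w\in W$ the set $\{w\}\times\mathbb C$ is not contained in its pole divisor; $K_w(z)=K(w,z)$. $(\Gamma_w)_{w\in W}$ is a continuous family of curves in $\mathbb C$ (possibly non-compact, possibly with fixed boundary) with $\Gamma_w\subset\mathbb C\setminus P_{K_w}$. $U\subset\mathbb C$ is a non-empty connected open set with $0\in\bar U\setminus U$. $f$ is a meromorphic function on $\mathbb C$ such that $\Gamma_w\subset\mathbb C\setminus(P_{K_w}\cup P_{f_\gamma})$ and the integral $$A^\gamma_{K,\Gamma}(f)(w)=g_\gamma(w)=\int_{\Gamma_w}K(w,z)f_\gamma(z)\,dz$$ exists for all $(w,\gamma)\in W\times U$, and is holomorphic in $w\in W$. The integrals $h_m(w)=\int_{\Gamma_w}K(w,z)z^m\,dz$ are assumed to exist for all $m\in\mathbb Z$ (it suffices to require this for $m\ge -n_0$) and to define holomorphic functions on $W$. The pole order of $K_w$ at $0$ is assumed independent of $w$ and is denoted $k_0\in\mathbb Z_{\ge0}$. $n_0\in\mathbb Z_{\ge 0}$ is the pole order of $f$ at $0$, $f(z)=\sum_{m=-n_0}^\infty a_mz^m$ is its Laurent series at $0$, convergent for $0<|z|<R_f$, where $R_f\in(0,\infty]$ is the distance from $0$ to $P_f\setminus\{0\}$.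 Put $\kappa(r)=\sum_{m=-n_0}^\infty|a_m|r^m$ for $r\in(0,R_f)$, and $$\tilde A^\gamma_{K,\Gamma}(f)=\sum_{m=-n_0}^\infty a_mh_m(w)\gamma^m\ \text{(formal series)},\qquad \tilde A^{\gamma,n}_{K,\Gamma}(f)(w)=\sum_{m=-n_0}^{n}a_mh_m(w)\gamma^m .$$ Contour and decay assumptions. $\Gamma_w$ can be continuously deformed (relative to its boundary, if non-empty) inside $\mathbb C\setminus\big((P_{K_w}\cup P_{f_\gamma})\setminus\{0\}\big)$ to a contour $\tilde\Gamma_w$ consisting of $d$ (finitely many) smooth arc segments $\tilde\Gamma_{w,j}$, $j=1,\dots,d$ (a smooth segment passing through $0$ is split at $0$ into two). Let $\Theta(z)$ be the angle between the line through $0$ and $z$ and the tangent line to $\tilde\Gamma_{w,j}$ at $z$. There is a constant $b>0$ with $|\cos\Theta(z)|\ge b$ for all $z\in\tilde\Gamma_{w,j}$, $j=1,\dots,d$. There are positive constants $c,\delta_1,\delta_2$ with $\delta:=\delta_1-\delta_2>0$, numbers $c_w\in\mathbb R_+$ ($w\in W$) and $\tilde c_\gamma\in[c,\infty)$ ($\gamma\in U$) such that $$|K(w,z)|\le c_we^{-\delta_1|z|}|z|^{-k_0}\quad\forall w\in W,\ z\in\tilde\Gamma_w\setminus\{0\},$$ $$|f_\gamma(z)|\le\tilde c_\gamma e^{\delta_2|z|}|\gamma z|^{-n_0}\quad\forall \gamma\in U,\ z\in\tilde\Gamma_w\setminus\{0\}.$$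
   Formalization: The Poincaré expansion is asserted only when c̃_γ grows at most polynomially in 1/|γ| as γ→0 in U; at non-compact ends a deformation of Γ_w must also have transversal integrals of K f_γ and K z^m (m ≥ −n_0) tending to 0. Without these the claim fails. *)

(* Defs.v *)
From Stdlib Require Import Reals ZArith List.
From Coquelicot Require Import Coquelicot.
Open Scope R_scope.

(** * Open sets and holomorphic functions *)

Definition connected (D : C -> Prop) : Prop :=
  forall A B : C -> Prop, open A -> open B ->
    (forall z, D z -> A z \/ B z) ->
    (exists z, D z /\ A z) -> (exists z, D z /\ B z) ->
    exists z, D z /\ A z /\ B z.

Definition closure (D : C -> Prop) (z : C) : Prop :=
  forall eps : R, 0 < eps -> exists z', D z' /\ Cmod (z' - z) < eps.

Definition holo_at (h : C -> C) (z : C) : Prop :=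
  locally z (fun z' => ex_derive (K := C_AbsRing) (V := C_NormedModule) h z').

Definition C2 : NormedModule C_AbsRing :=
  prod_NormedModule C_AbsRing C_NormedModule C_NormedModule.

(** Joint (Fréchet) complex differentiability near [p]. *)
Definition holo2_at (F : C * C -> C) (p : C * C) : Prop :=
  locally (T := C2) p
    (fun q => ex_filterdiff (K := C_AbsRing) (U := C2) (V := C_NormedModule)
                F (locally (T := C2) q)).

(** * Meromorphic functions

    A meromorphic function is represented by a total function [C -> C] which is
    holomorphic wherever it has no pole (removable singularities are filled
    in); its values at its poles are irrelevant. *)

(** [pole_order h z0 0] means that [h] is holomorphic at [z0]. *)
Definition pole_order (h : C -> C) (z0 : C) (k : nat) : Prop :=
  match k with
  | O => holo_at h z0
  | S _ =>
      exists g : C -> C,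
        holo_at g z0 /\ g z0 <> 0 /\
        locally z0 (fun z => z <> z0 -> h z = (g z / (z - z0) ^ k)%C)
  end.

Definition meromorphic (h : C -> C) : Prop :=
  forall z0, exists k, pole_order h z0 k.

Definition is_pole (h : C -> C) (z : C) : Prop :=
  exists k, pole_order h z (S k).

(** Two variables: locally a quotient of holomorphic functions, the denominator
    having a nonzero germ. *)
Definition meromorphic2 (W : C -> Prop) (K : C -> C -> C) : Prop :=
  forall w z : C, W w ->
    exists g h : C * C -> C,
      ~ locally (T := C2) (w, z) (fun q => h q = 0) /\
      locally (T := C2) (w, z) (fun q =>
        holo2_at g q /\ holo2_at h q /\
        (h q <> 0 -> K (fst q) (snd q) = (g q / h q)%C)).

(** [meromorphic2] constrains [K] only where the local denominators do not
    vanish.  The locus where [K] is not holomorphic contains the pole divisor of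
    the germ; the second clause (no slice is contained in that locus) and the
    last one then force, by the identity theorem, [K w] to be the restriction to
    [{w} x C] of the meromorphic function, with removable singularities filled
    in, for every [w] in [W]. *)
Definition pole_divisor (K : C -> C -> C) (p : C * C) : Prop :=
  ~ holo2_at (fun q => K (fst q) (snd q)) p.

Definition meromorphic_kernel (W : C -> Prop) (K : C -> C -> C) : Prop :=
  meromorphic2 W K /\
  (forall w, W w -> ~ (forall z, pole_divisor K (w, z))) /\
  (forall w, W w -> meromorphic (K w)).

(** * Curves

    Up to reparametrization a curve is parametrized by a subinterval of [[0,1]].
    [arc l r] has a boundary point at parameter 0 (resp. 1) iff [l] (resp. [r])
    is [true]; otherwise the corresponding end is open (non-compact, typically
    going to infinity). *)
Inductive curve_type := loop | arc (l r : bool).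

Definition dom (ct : curve_type) (t : R) : Prop :=
  match ct with
  | loop => 0 <= t <= 1
  | arc l r => (if l then 0 <= t else 0 < t) /\ (if r then t <= 1 else t < 1)
  end.

Definition left_boundary (ct : curve_type) : Prop := exists r, ct = arc true r.
Definition right_boundary (ct : curve_type) : Prop := exists l, ct = arc l true.
Definition left_open (ct : curve_type) : Prop := exists r, ct = arc false r.
Definition right_open (ct : curve_type) : Prop := exists l, ct = arc l false.

Definition curve_deriv (g : R -> C) (t : R) : C :=
  (Derive (fun s => fst (g s)) t, Derive (fun s => snd (g s)) t).

Definition C1_on (g : R -> C) (p q : R) : Prop :=
  continuous_on (T := R_UniformSpace) (U := C_UniformSpace)
    (fun t => p <= t <= q) g /\
  exists D : R -> C,
    (forall t, continuous (T := R_UniformSpace) (U := C_UniformSpace) D t) /\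
    forall t, p < t < q ->
      is_derive (K := R_AbsRing) (V := C_R_NormedModule) g t (D t).

Inductive piecewise_C1 (g : R -> C) : R -> R -> Prop :=
| pC1_one p q : p < q -> C1_on g p q -> piecewise_C1 g p q
| pC1_cat p q r : piecewise_C1 g p q -> piecewise_C1 g q r -> piecewise_C1 g p r.

Definition is_curve (ct : curve_type) (g : R -> C) : Prop :=
  (forall p q, dom ct p -> dom ct q -> p < q -> piecewise_C1 g p q) /\
  (ct = loop -> g 0 = g 1).

Definition continuous_family (W : C -> Prop) (ct : curve_type)
    (Gam : C -> R -> C) : Prop :=
  (forall w, W w -> is_curve ct (Gam w)) /\
  continuous_on
    (T := prod_UniformSpace C_UniformSpace R_UniformSpace) (U := C_UniformSpace)
    (fun p => W (fst p) /\ dom ct (snd p)) (fun p => Gam (fst p) (snd p)) /\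
  (left_boundary ct -> forall w w', W w -> W w' -> Gam w 0 = Gam w' 0) /\
  (right_boundary ct -> forall w w', W w -> W w' -> Gam w 1 = Gam w' 1).

Definition path_integrand (F : C -> C) (g : R -> C) (t : R) : C :=
  (F (g t) * curve_deriv g t)%C.

(** Contour integrals are improper at both ends of the parameter interval. *)
Definition ex_contour_int (F : C -> C) (g : R -> C) : Prop :=
  ex_RInt_gen (V := C_R_NormedModule) (path_integrand F g)
    (at_right 0) (at_left 1).

Definition contour_int (F : C -> C) (g : R -> C) : C :=
  RInt_gen (V := C_R_CompleteNormedModule) (path_integrand F g)
    (at_right 0) (at_left 1).

(** * Deformations of contours *)

(** The integrals of [F] along the transversal paths [s |-> H s t] joining the
    two contours tend to zero when [t] tends to an open end. *)
Definition negligible_end (F : C -> C) (H : R -> R -> C)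
    (e : (R -> Prop) -> Prop) : Prop :=
  e (fun t => ex_RInt (V := C_R_NormedModule)
                (path_integrand F (fun s => H s t)) 0 1) /\
  filterlim (fun t => RInt (V := C_R_CompleteNormedModule)
                        (path_integrand F (fun s => H s t)) 0 1)
    e (locally (T := C_UniformSpace) (RtoC 0)).

(** At an open end nothing can be kept fixed, and a homotopy alone does not
    control the integrals (the half-line [[0,+oo)] can be rotated onto
    [i[0,+oo)], which changes the integral of [exp (- z^4)]).  There a
    deformation is required to be one of contours of integration for the
    integrands in [Fs]: no contribution comes from the end.  This holds in
    particular if [H] is stationary near that end. *)
Definition deformable (ct : curve_type) (Omega : C -> Prop)
    (Fs : (C -> C) -> Prop) (g g' : R -> C) : Prop :=
  exists H : R -> R -> C,
    continuous_on
      (T := prod_UniformSpace R_UniformSpace R_UniformSpace)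
      (U := C_UniformSpace)
      (fun p => 0 <= fst p <= 1 /\ dom ct (snd p))
      (fun p => H (fst p) (snd p)) /\
    (forall t, dom ct t -> H 0 t = g t /\ H 1 t = g' t) /\
    (forall s t, 0 <= s <= 1 -> dom ct t -> Omega (H s t)) /\
    (ct = loop -> forall s, 0 <= s <= 1 -> H s 0 = H s 1) /\
    (left_boundary ct -> forall s, 0 <= s <= 1 -> H s 0 = g 0) /\
    (right_boundary ct -> forall s, 0 <= s <= 1 -> H s 1 = g 1) /\
    (left_open ct ->
       at_right 0 (fun t => piecewise_C1 (fun s => H s t) 0 1) /\
       forall F, Fs F -> negligible_end F H (at_right 0)) /\
    (right_open ct ->
       at_left 1 (fun t => piecewise_C1 (fun s => H s t) 0 1) /\
       forall F, Fs F -> negligible_end F H (at_left 1)).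

(** The contour [g] consists of the [d] smooth arc segments cut out by
    [0 = tau 0 < ... < tau d = 1]; it meets [0] only at end points of
    segments. *)
Definition smooth_segments (ct : curve_type) (d : nat) (tau : nat -> R)
    (g : R -> C) : Prop :=
  tau 0%nat = 0 /\ tau d = 1 /\
  forall j, (j < d)%nat ->
    tau j < tau (S j) /\
    (forall p q, tau j <= p -> p < q -> q <= tau (S j) ->
       dom ct p -> dom ct q -> C1_on g p q) /\
    (forall t, tau j < t < tau (S j) -> g t <> 0 /\ curve_deriv g t <> 0).

(** Cosine of the angle between the nonzero plane vectors [z] and [v]. *)
Definition cos_angle (z v : C) : R :=
  (fst z * fst v + snd z * snd v) / (Cmod z * Cmod v).

Definition angle_condition (d : nat) (b : R) (tau : nat -> R) (g : R -> C)
  : Prop :=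
  forall j t, (j < d)%nat -> tau j < t < tau (S j) ->
    b <= Rabs (cos_angle (g t) (curve_deriv g t)).

(** * Integral transform, Laurent series and formal expansion *)

Definition Cpowz (z : C) (m : Z) : C :=
  match m with
  | Z0 => 1
  | Zpos p => (z ^ Pos.to_nat p)%C
  | Zneg p => (/ (z ^ Pos.to_nat p))%C
  end.

Definition dilate (f : C -> C) (gam : C) : C -> C := fun z => f (gam * z)%C.

(** The integrands of the transform and of the moments of order
    [m >= - n0]. *)
Definition transform_integrand (Kw f : C -> C) (gam z : C) : C :=
  (Kw z * dilate f gam z)%C.

Definition moment_integrand (Kw : C -> C) (m : Z) (z : C) : C :=
  (Kw z * Cpowz z m)%C.

Definition integrands (Kw f : C -> C) (n0 : nat) (gam : C) (F : C -> C) : Prop :=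
  F = transform_integrand Kw f gam \/
  exists m : Z, (- Z.of_nat n0 <= m)%Z /\ F = moment_integrand Kw m.

Definition transform (K : C -> C -> C) (Gam : C -> R -> C) (f : C -> C)
    (gam w : C) : C :=
  contour_int (transform_integrand (K w) f gam) (Gam w).

Definition moment (K : C -> C -> C) (Gam : C -> R -> C) (m : Z) (w : C) : C :=
  contour_int (moment_integrand (K w) m) (Gam w).

(** Distance from [0] to the nonzero poles of [f], [p_infty] if there are
    none. *)
Definition pole_radius (f : C -> C) : Rbar :=
  Glb_Rbar (fun x => exists z, is_pole f z /\ z <> 0 /\ x = Cmod z).

Definition laurent_index (n0 j : nat) : Z := (Z.of_nat j - Z.of_nat n0)%Z.

(** [a m] is the coefficient of [z^m]; only [m >= - n0] matters. *)
Definition laurent_expansion (f : C -> C) (n0 : nat) (a : Z -> C) : Prop :=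
  forall z : C, z <> 0 -> Rbar_lt (Cmod z) (pole_radius f) ->
    is_series (K := C_AbsRing) (V := C_NormedModule)
      (fun j => (a (laurent_index n0 j) * Cpowz z (laurent_index n0 j))%C) (f z).

Definition kappa (n0 : nat) (a : Z -> C) (r : R) : R :=
  Series (fun j => Cmod (a (laurent_index n0 j))
                   * powerRZ r (laurent_index n0 j)).

(** [partial_sum n0 u n] is the sum of [u m] for [- n0 <= m <= n] (zero if
    [n < - n0]). *)
Definition partial_sum (n0 : nat) (u : Z -> C) (n : Z) : C :=
  fold_right Cplus (RtoC 0)
    (map (fun j => u (laurent_index n0 j))
       (seq 0 (Z.to_nat (n + Z.of_nat n0 + 1)))).

Definition formal_coef (K : C -> C -> C) (Gam : C -> R -> C) (a : Z -> C)
    (w : C) (m : Z) : C :=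
  (a m * moment K Gam m w)%C.

Definition formal_transform (K : C -> C -> C) (Gam : C -> R -> C) (n0 : nat)
    (a : Z -> C) (gam : C) (n : Z) (w : C) : C :=
  partial_sum n0 (fun m => formal_coef K Gam a w m * Cpowz gam m)%C n.

(** Poincaré asymptotic expansion of [G gam] by the formal series
    [sum_(m >= - n0) coef m * gam^m], to all orders, as [gam -> 0] in [U]. *)
Definition poincare_expansion (U : C -> Prop) (G : C -> C) (n0 : nat)
    (coef : Z -> C) : Prop :=
  forall n : Z, (- Z.of_nat n0 <= n)%Z ->
  forall eps : R, 0 < eps ->
  exists rho : R, 0 < rho /\
    forall gam : C, U gam -> Cmod gam < rho ->
      Cmod (G gam - partial_sum n0 (fun m => coef m * Cpowz gam m)%C n)
      <= eps * powerRZ (Cmod gam) n.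

(** * Constants of the error estimate *)

Definition cprime (f : C -> C) (n0 : nat) (a : Z -> C) (c : R) (n : Z) : R :=
  real (Glb_Rbar (fun x => exists r : R,
    0 < r /\ Rbar_lt r (pole_radius f) /\
    x = 1 / powerRZ r n * (c * powerRZ r (- Z.of_nat n0) + kappa n0 a r))).

(** The value for [n = k0 - 1] depends on [gam]. *)
Definition Cconst (f : C -> C) (n0 : nat) (a : Z -> C) (k0 d : nat)
    (b c delta : R) (gam : C) (n : Z) : R :=
  let k := Z.of_nat k0 in
  if Z.eqb n (k - 1) then
    INR d * Cmod gam / (b * c * delta) * cprime f n0 a c k
  else
    2 * INR d / (b * c * sqrt (PI * (1 + 2 * IZR (n - k)))) * cprime f n0 a c n.

(* Main.v *)
(** Near [0] the integrand of the remainder is the kernel, with a pole of order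
    [k0], times the tail of a Laurent series starting in degree
    [n + 1 >= k0]; it is therefore holomorphic at [0], and its integral may be
    computed along the deformed contour even when the deformation crosses [0].
    The homotopy is only continuous, so invariance is obtained by lifting it
    through local primitives, which exist by Goursat's lemma.  On the deformed
    contour the angle condition makes [|z|] strictly monotone along every
    segment, with [|d|z|| >= b |dz|], so that each segment contributes at most
    [1/b] times the integral of [rho ^ l * exp (- delta * rho)] over
    [[0, +oo)], that is [l! / delta ^ (l + 1)].  The remainder of the Laurent
    series is estimated separately for [|gamma z|] below and above a radius [r],
    and the infimum over [r] gives [c'_n]. *)
Require Import Defs.
From Stdlib Require Import Reals ZArith List.
From Stdlib Require Import Lra Lia Classical ClassicalEpsilon.
From Coquelicot Require Import Coquelicot.
Open Scope R_scope.

(** * Complex derivatives *)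

(** The formula of the remainder integrand has no meaningful value at 0. It is therefore replaced by
    a function [F] holomorphic there, and each comparison of integrals has to show that the value at
    0 does not count. No improper integral is taken along the deformed contour: only increments of
    lifts over compact pieces are bounded there, uniformly in the cut-offs. Constants: if the
    Laurent remainder is estimated with exponent k of |gamma z|, the pole of the kernel leaves |z|^l
    with l = k - k0, and one arc costs l! / (b delta^(l+1)). For n >= k0 take k = n; since pi (1 +
    2l) <= 4 (l+1)^2, the factor l! is at most the stated 2 (l+1)! / sqrt(pi (1 + 2l)). For n = k0 -
    1 this choice would give l = -1, so k = n + 1 = k0 and l = 0, whence the extra |gamma|, the
    extra 1/delta and c'_(k0). Poincare expansion: the constants [cgam] may blow up as gamma tends
    to 0. When they grow at most like |gamma|^(-N), the estimate is used at an order exceeding n by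
    more than N and the sum is then cut back to degree n. *)

Definition cderiv (F : C -> C) (z l : C) : Prop :=
  forall eps, 0 < eps -> exists del, 0 < del /\ forall z', Cmod (z' - z) < del ->
    Cmod (F z' - F z - l * (z' - z)) <= eps * Cmod (z' - z).

(** Explicit moduli with [Cmod] avoid moving between [C_NormedModule] and [C_R_NormedModule], two
    structures on the same plane; the bridges to [is_derive] are proved once. *)
Definition pderiv (g : R -> C) (t : R) (v : C) : Prop :=
  forall eps, 0 < eps -> exists del, 0 < del /\ forall t', Rabs (t' - t) < del ->
    Cmod (g t' - g t - RtoC (t' - t) * v) <= eps * Rabs (t' - t).

Definition cdiff (F : C -> C) (z : C) : Prop := exists l, cderiv F z l.

Definition path_cont (D : R -> Prop) (g : R -> C) (t : R) : Prop :=
  forall eps, 0 < eps -> exists del, 0 < del /\ forall t', D t' -> Rabs (t' - t) < del ->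
    Cmod (g t' - g t) < eps.

Lemma Cmod_sum (x y z : C) : x = (y + z)%C -> Cmod x <= Cmod y + Cmod z.
Proof. intros ->; apply Cmod_triangle. Qed.

Lemma Cmod_sub_sym (x y : C) : Cmod (x - y) = Cmod (y - x).
Proof. rewrite <- Cmod_opp; f_equal; ring. Qed.

Lemma Cmod_sub_eq0 (x y : C) : Cmod (x - y) <= 0 -> x = y.
Proof.
  intros H. assert (Cmod (x - y) = 0) by (pose proof (Cmod_ge_0 (x - y)); lra).
  apply Cmod_eq_0 in H0. replace x with (x - y + y)%C by ring. rewrite H0; ring.
Qed.

Lemma Cmod_le_components (z : C) : Cmod z <= Rabs (fst z) + Rabs (snd z).
Proof.
  replace z with (RtoC (fst z) + Ci * RtoC (snd z))%C at 1.
  - eapply Rle_trans; [apply Cmod_triangle|]. rewrite Cmod_mult, !Cmod_R, Cmod_Ci; lra.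
  - destruct z; unfold RtoC, Ci, Cplus, Cmult; simpl; f_equal; ring.
Qed.

Lemma fst_le_Cmod (z : C) : Rabs (fst z) <= Cmod z.
Proof. eapply Rle_trans; [apply Rmax_l | apply Rmax_Cmod]. Qed.

Lemma snd_le_Cmod (z : C) : Rabs (snd z) <= Cmod z.
Proof. eapply Rle_trans; [apply Rmax_r | apply Rmax_Cmod]. Qed.

Lemma locally_C_iff (z : C) (P : C -> Prop) :
  locally (T := C_UniformSpace) z P <->
  exists del, 0 < del /\ forall z', Cmod (z' - z) < del -> P z'.
Proof.
  split.
  - intros [e He]. exists e; split; [apply cond_pos|]. intros z' Hz'.
    apply He. apply (C_NormedModule_mixin_compat1 z z' e). exact Hz'.
  - intros [e [He H]].
    (* Balls of the uniform structure are squares; the one of half-side [e / sqrt 2] fits into the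
       disc of radius [e]. *)
    assert (H2 : 0 < e / sqrt 2) by (apply Rdiv_lt_0_compat; [easy|apply sqrt_lt_R0; lra]).
    exists (mkposreal _ H2). intros z' Hz'. apply H.
    generalize (C_NormedModule_mixin_compat2 z z' _ Hz'). simpl.
    intros Hs. eapply Rlt_le_trans; [exact Hs|].
    right. field. apply Rgt_not_eq, sqrt_lt_R0; lra.
Qed.

Lemma cderiv_is_derive (F : C -> C) (z l : C) :
  cderiv F z l <-> is_derive (K := C_AbsRing) (V := C_NormedModule) F z l.
Proof.
  split.
  - intros H. split; [apply is_linear_scal_l|].
    intros y Hy.
    assert (Hyz : z = y) by (apply (is_filter_lim_locally_unique (K:=C_AbsRing)
      (V:=AbsRing_NormedModule C_AbsRing) _ _ Hy)).
    subst y. intros eps. destruct (H eps (cond_pos eps)) as [d [Hd H']].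
    apply locally_C. apply locally_C_iff. exists d; split; [easy|].
    intros z' Hz'. specialize (H' z' Hz').
    match goal with |- norm ?x <= _ => change (Cmod x <= eps * Cmod (z' - z)) end.
    eapply Rle_trans; [|exact H'].
    right; f_equal. unfold minus, plus, opp, scal, mult; simpl. unfold mult; simpl. ring.
  - intros [_ H] eps He.
    specialize (H z (fun P HP => HP) (mkposreal _ He)).
    apply locally_C in H. apply locally_C_iff in H. destruct H as [d [Hd H]].
    exists d; split; [easy|]. intros z' Hz'. specialize (H z' Hz').
    match type of H with norm ?x <= _ => change (Cmod x <= eps * Cmod (z' - z)) in H end.
    eapply Rle_trans; [|exact H].
    right; f_equal. unfold minus, plus, opp, scal, mult; simpl. unfold mult; simpl. ring.
Qed.

Lemma norm_C_R (x : C) : norm (K := R_AbsRing) (V := C_R_NormedModule) x = Cmod x.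
Proof.
  unfold norm; simpl. unfold prod_norm, Cmod, norm; simpl. unfold abs; simpl.
  rewrite !Rmult_1_r, <- !Rabs_mult, !Rabs_pos_eq; auto; apply Rle_0_sqr.
Qed.

Lemma pderiv_remainder_eq (x y v : C_R_NormedModule) (r : R_AbsRing) :
  minus (minus x y) (scal r v) = (x - y - RtoC r * v)%C.
Proof.
  apply injective_projections; simpl; unfold minus, plus, opp, scal; simpl; unfold mult; simpl;
    ring.
Qed.

Lemma pderiv_is_derive (g : R -> C) (t : R) (v : C) :
  pderiv g t v <-> is_derive (K := R_AbsRing) (V := C_R_NormedModule) g t v.
Proof.
  split.
  - intros H. split; [apply is_linear_scal_l|].
    intros y Hy.
    assert (Hyz : t = y) by (apply (is_filter_lim_locally_unique (K:=R_AbsRing)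
      (V:=R_NormedModule) _ _ Hy)).
    subst y. intros eps. destruct (H eps (cond_pos eps)) as [d [Hd H']].
    exists (mkposreal d Hd).
    intros z' Hz'. specialize (H' z' Hz').
    rewrite norm_C_R.
    eapply Rle_trans; [|exact H'].
    right; f_equal. rewrite pderiv_remainder_eq. reflexivity.
  - intros [_ H] eps He.
    specialize (H t (fun P HP => HP) (mkposreal _ He)).
    destruct H as [d H].
    exists d; split; [apply cond_pos|]. intros z' Hz'. specialize (H z' Hz').
    rewrite norm_C_R in H.
    eapply Rle_trans; [|exact H].
    right; f_equal. rewrite pderiv_remainder_eq. reflexivity.
Qed.

Lemma cdiff_ex_derive (F : C -> C) (z : C) :
  cdiff F z <-> ex_derive (K := C_AbsRing) (V := C_NormedModule) F z.
Proof. split; intros [l H]; exists l; apply cderiv_is_derive; exact H. Qed.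

Lemma holo_at_cdiff (F : C -> C) (z : C) :
  holo_at F z <-> exists del, 0 < del /\ forall z', Cmod (z' - z) < del -> cdiff F z'.
Proof.
  unfold holo_at. rewrite locally_C_iff.
  split; intros [d [Hd H]]; exists d; split; auto; intros; apply cdiff_ex_derive; auto.
Qed.

Lemma cdiff_cont (F : C -> C) (z : C) : cdiff F z ->
  forall eps, 0 < eps -> exists del, 0 < del /\ forall z', Cmod (z' - z) < del ->
    Cmod (F z' - F z) < eps.
Proof.
  intros [l H] eps He. destruct (H 1 Rlt_0_1) as [d [Hd H']].
  pose proof (Cmod_ge_0 l) as Hl.
  exists (Rmin d (eps / (2 + Cmod l))). split.
  { apply Rmin_pos; auto. apply Rdiv_lt_0_compat; lra. }
  intros z' Hz'. specialize (H' z' (Rlt_le_trans _ _ _ Hz' (Rmin_l _ _))).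
  apply Rlt_le_trans with (r3 := eps / (2 + Cmod l)) in Hz'; [|apply Rmin_r].
  assert (Cmod (F z' - F z) <= (1 + Cmod l) * Cmod (z' - z)).
  { eapply Rle_trans; [apply (Cmod_sum _ (F z' - F z - l * (z' - z)) (l * (z' - z))); ring|].
    rewrite Cmod_mult. lra. }
  apply Rle_lt_trans with (1 := H0).
  apply Rle_lt_trans with ((2 + Cmod l) * Cmod (z' - z)).
  { pose proof (Cmod_ge_0 (z' - z)); nra. }
  replace eps with ((2 + Cmod l) * (eps / (2 + Cmod l))) by (field; lra).
  apply Rmult_lt_compat_l; lra.
Qed.

Lemma cderiv_ext_loc (F G : C -> C) (z l : C) (d : R) : 0 < d ->
  (forall z', Cmod (z' - z) < d -> F z' = G z') -> cderiv F z l -> cderiv G z l.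
Proof.
  intros Hd E H eps He. destruct (H eps He) as [d' [Hd' H']].
  exists (Rmin d d'). split; [apply Rmin_pos; auto|].
  intros z' Hz'. rewrite <- !E.
  - apply H'. eapply Rlt_le_trans; [exact Hz'|apply Rmin_r].
  - replace (z - z)%C with (RtoC 0) by ring. rewrite Cmod_0; easy.
  - eapply Rlt_le_trans; [exact Hz'|apply Rmin_l].
Qed.

Lemma cderiv_const (k z : C) : cderiv (fun _ => k) z 0.
Proof.
  intros eps He. exists 1; split; [lra|]. intros z' _.
  replace (k - k - 0 * (z' - z))%C with (RtoC 0) by ring. rewrite Cmod_0.
  pose proof (Cmod_ge_0 (z' - z)); nra.
Qed.

Lemma cderiv_id (z : C) : cderiv (fun x => x) z 1.
Proof.
  intros eps He. exists 1; split; [lra|]. intros z' _.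
  replace (z' - z - 1 * (z' - z))%C with (RtoC 0) by ring. rewrite Cmod_0.
  pose proof (Cmod_ge_0 (z' - z)); nra.
Qed.

Lemma cderiv_plus (F G : C -> C) (z l m : C) :
  cderiv F z l -> cderiv G z m -> cderiv (fun x => F x + G x)%C z (l + m).
Proof.
  intros HF HG. apply cderiv_is_derive.
  apply (is_derive_plus (K:=C_AbsRing) (V:=C_NormedModule)); apply cderiv_is_derive; auto.
Qed.

Lemma cderiv_mult (F G : C -> C) (z l m : C) :
  cderiv F z l -> cderiv G z m -> cderiv (fun x => F x * G x)%C z (l * G z + F z * m).
Proof.
  intros HF HG. apply cderiv_is_derive in HF. apply cderiv_is_derive in HG.
  apply cderiv_is_derive.
  assert (HF' : is_derive (K:=C_AbsRing) (V:=AbsRing_NormedModule C_AbsRing) F z l).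
  { destruct HF as [_ H]. split; [apply is_linear_scal_l|]. exact H. }
  assert (HG' : is_derive (K:=C_AbsRing) (V:=AbsRing_NormedModule C_AbsRing) G z m).
  { destruct HG as [_ H]. split; [apply is_linear_scal_l|]. exact H. }
  destruct (is_derive_mult (K:=C_AbsRing) F G z l m HF' HG' Cmult_comm) as [_ H].
  split; [apply is_linear_scal_l|]. exact H.
Qed.

Lemma cderiv_scal (F : C -> C) (k z l : C) :
  cderiv F z l -> cderiv (fun x => k * F x)%C z (k * l).
Proof.
  intros H. replace (k * l)%C with (0 * F z + k * l)%C by ring.
  apply (cderiv_mult (fun _ => k) F); auto. apply cderiv_const.
Qed.

Lemma cderiv_dilate (F : C -> C) (k z l : C) :
  cderiv F (k * z) l -> cderiv (fun x => F (k * x))%C z (k * l).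
Proof.
  intros H eps He.
  pose proof (Cmod_ge_0 k) as Hk.
  destruct (H (eps / (1 + Cmod k))) as [d [Hd H']]; [apply Rdiv_lt_0_compat; lra|].
  exists (d / (1 + Cmod k)); split; [apply Rdiv_lt_0_compat; lra|].
  intros z' Hz'.
  assert (E : Cmod (k * z' - k * z) = Cmod k * Cmod (z' - z)) by (rewrite <- Cmod_mult; f_equal;
    ring).
  pose proof (Cmod_ge_0 (z' - z)) as Hp.
  assert (Hm : Cmod (z' - z) * (1 + Cmod k) < d).
  { apply (Rmult_lt_compat_r (1 + Cmod k)) in Hz'; [|lra]. unfold Rdiv in Hz'.
    rewrite Rmult_assoc, Rinv_l in Hz'; lra. }
  specialize (H' (k * z')%C). rewrite E in H'.
  replace (F (k * z')%C - F (k * z)%C - k * l * (z' - z))%C with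
    (F (k * z')%C - F (k * z)%C - l * (k * z' - k * z))%C by ring.
  eapply Rle_trans; [apply H'; nra|].
  replace (eps * Cmod (z' - z)) with (eps / (1 + Cmod k) * ((1 + Cmod k) * Cmod (z' - z)))
    by (field; lra).
  apply Rmult_le_compat_l; [|nra]. apply Rlt_le, Rdiv_lt_0_compat; lra.
Qed.

Lemma cderiv_inv (z : C) : z <> 0 -> cderiv Cinv z (- / (z * z)).
Proof.
  intros Hz eps He. assert (Hm : 0 < Cmod z) by (apply Cmod_gt_0; auto).
  set (m := Cmod z) in *.
  (* The remainder equals (z' - z)^2 / (z^2 z'). The first bound keeps |z'| above m / 2, the second
     then makes the quotient at most eps |z' - z|. *)
  exists (Rmin (m / 2) (eps * (m * m * m) / 2)). split.
  { apply Rmin_pos; [lra|]. apply Rdiv_lt_0_compat; [|lra]. repeat apply Rmult_lt_0_compat; auto. }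
  intros z' Hz'.
  assert (H1 : Cmod (z' - z) < m / 2) by (eapply Rlt_le_trans; [exact Hz'|apply Rmin_l]).
  assert (H2 : Cmod (z' - z) < eps * (m * m * m) / 2) by (eapply Rlt_le_trans;
    [exact Hz'|apply Rmin_r]).
  assert (H3 : m / 2 < Cmod z').
  { assert (m <= Cmod z' + Cmod (z' - z)).
    { unfold m. rewrite (Cmod_sub_sym z'). apply Cmod_sum; ring. }
    lra. }
  assert (Hz0 : z' <> 0) by (apply Cmod_gt_0; lra).
  replace (/ z' - / z - - / (z * z) * (z' - z))%C with ((z' - z) * (z' - z) / (z * z * z'))%C
    by (field; auto).
  rewrite Cmod_div, !Cmod_mult by (repeat apply Cmult_neq_0; auto). fold m.
  pose proof (Cmod_ge_0 (z' - z)) as Hp. set (e := Cmod (z' - z)) in *. set (q := Cmod z') in *.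
  apply (Rmult_le_reg_r (m * m * q)); [repeat apply Rmult_lt_0_compat; lra|].
  unfold Rdiv.
  rewrite Rmult_assoc, Rinv_l by (apply Rgt_not_eq; repeat apply Rmult_lt_0_compat; lra).
  rewrite Rmult_1_r. replace (eps * e * (m * m * q)) with (e * (eps * (m * m) * q)) by ring.
  apply Rmult_le_compat_l; auto.
  apply Rlt_le, Rlt_trans with (1 := H2).
  replace (eps * (m * m * m) / 2) with (eps * (m * m) * (m / 2)) by field.
  apply Rmult_lt_compat_l; auto. repeat apply Rmult_lt_0_compat; auto.
Qed.

Lemma cderiv_comp (F G : C -> C) (z l m : C) :
  cderiv G z m -> cderiv F (G z) l -> cderiv (fun x => F (G x)) z (l * m).
Proof.
  intros HG HF. apply cderiv_is_derive in HF. apply cderiv_is_derive in HG.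
  apply cderiv_is_derive.
  assert (HG' : is_derive (K:=C_AbsRing) (V:=AbsRing_NormedModule C_AbsRing) G z m).
  { destruct HG as [_ H]. split; [apply is_linear_scal_l|]. exact H. }
  generalize (is_derive_comp (K:=C_AbsRing) (V:=C_NormedModule) F G z l m HF HG').
  change (scal m l) with (m * l)%C. rewrite (Cmult_comm m l). exact (fun H => H).
Qed.

Lemma cdiff_const (k z : C) : cdiff (fun _ => k) z.
Proof. eexists; apply cderiv_const. Qed.

Lemma cdiff_plus (F G : C -> C) (z : C) :
  cdiff F z -> cdiff G z -> cdiff (fun x => F x + G x)%C z.
Proof. intros [l H] [m H']. eexists; apply cderiv_plus; eauto. Qed.

Lemma cdiff_mult (F G : C -> C) (z : C) :
  cdiff F z -> cdiff G z -> cdiff (fun x => F x * G x)%C z.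
Proof. intros [l H] [m H']. eexists; apply cderiv_mult; eauto. Qed.

Lemma cdiff_inv (F : C -> C) (z : C) :
  cdiff F z -> F z <> 0 -> cdiff (fun x => / F x)%C z.
Proof. intros [l H] H'. eexists; apply (cderiv_comp Cinv F); eauto. apply cderiv_inv; auto. Qed.

Lemma cdiff_pow (n : nat) (z : C) : cdiff (fun x => x ^ n)%C z.
Proof.
  induction n as [|n IH]; simpl; [apply cdiff_const|].
  apply (cdiff_mult (fun x => x)); auto. eexists; apply cderiv_id.
Qed.

Lemma cdiff_Cpowz (m : Z) (z : C) :
  ((0 <= m)%Z \/ z <> 0) -> cdiff (fun x => Cpowz x m) z.
Proof.
  intros H. destruct m; simpl.
  - apply cdiff_const.
  - apply cdiff_pow.
  - apply (cdiff_inv (fun x => x ^ Pos.to_nat p)%C); [apply cdiff_pow|].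
    apply Cpow_nz. destruct H as [H|H]; [lia|auto].
Qed.

Lemma cdiff_ext_loc (F G : C -> C) (z : C) (d : R) : 0 < d ->
  (forall z', Cmod (z' - z) < d -> F z' = G z') -> cdiff F z -> cdiff G z.
Proof. intros Hd E [l H]; exists l; eapply cderiv_ext_loc; eauto. Qed.

(** * Derivatives along paths *)

Lemma pderiv_comp (F : C -> C) (g : R -> C) (t : R) (l v : C) :
  pderiv g t v -> cderiv F (g t) l -> pderiv (fun s => F (g s)) t (l * v).
Proof.
  intros Hg HF eps He.
  pose proof (Cmod_ge_0 l) as Hl. pose proof (Cmod_ge_0 v) as Hv.
  (* The cap 1 gives |g t' - g t| <= (1 + |v|) |t' - t|, which turns the error of [F] into an error
     in the parameter. *)
  set (e1 := Rmin 1 (eps / (2 * (1 + Cmod l)))).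
  assert (He1 : 0 < e1) by (apply Rmin_pos; [lra|]; apply Rdiv_lt_0_compat; lra).
  set (e2 := eps / (2 * (1 + Cmod v))).
  assert (He2 : 0 < e2) by (apply Rdiv_lt_0_compat; lra).
  destruct (Hg e1 He1) as [d1 [Hd1 H1]]. destruct (HF e2 He2) as [d2 [Hd2 H2]].
  exists (Rmin d1 (d2 / (1 + Cmod v))). split.
  { apply Rmin_pos; auto. apply Rdiv_lt_0_compat; lra. }
  intros t' Ht'.
  assert (Ht1 : Rabs (t' - t) < d1) by (eapply Rlt_le_trans; [exact Ht'|apply Rmin_l]).
  assert (Ht2 : Rabs (t' - t) < d2 / (1 + Cmod v)) by (eapply Rlt_le_trans;
    [exact Ht'|apply Rmin_r]).
  specialize (H1 t' Ht1). pose proof (Rabs_pos (t' - t)) as Ha.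
  set (h := Rabs (t' - t)) in *.
  assert (Hgd : Cmod (g t' - g t) <= (1 + Cmod v) * h).
  { eapply Rle_trans; [apply (Cmod_sum _ (g t' - g t - RtoC (t' - t) * v) (RtoC (t' - t) * v));
      ring|].
    rewrite Cmod_mult, Cmod_R. fold h.
    assert (e1 <= 1) by apply Rmin_l. nra. }
  assert (Hd : (1 + Cmod v) * h < d2).
  { apply (Rmult_lt_compat_r (1 + Cmod v)) in Ht2; [|lra]. unfold Rdiv in Ht2.
    rewrite Rmult_assoc, Rinv_l in Ht2; lra. }
  specialize (H2 (g t') (Rle_lt_trans _ _ _ Hgd Hd)).
  eapply Rle_trans; [apply (Cmod_sum _ (F (g t') - F (g t) - l * (g t' - g t)) (l *
    (g t' - g t - RtoC (t' - t) * v))); ring|].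
  rewrite Cmod_mult.
  assert (e2 * Cmod (g t' - g t) <= eps / 2 * h).
  { apply Rle_trans with (e2 * ((1 + Cmod v) * h)); [apply Rmult_le_compat_l; lra|].
    unfold e2. right. field. lra. }
  assert (Cmod l * Cmod (g t' - g t - RtoC (t' - t) * v) <= eps / 2 * h).
  { apply Rle_trans with ((1 + Cmod l) * (e1 * h)).
    - apply Rmult_le_compat; try lra. apply Cmod_ge_0.
    - apply Rle_trans with ((1 + Cmod l) * (eps / (2 * (1 + Cmod l)) * h)).
      + apply Rmult_le_compat_l; [lra|]. apply Rmult_le_compat_r; auto. apply Rmin_r.
      + right. field. lra. }
  lra.
Qed.

Lemma pderiv_minus (g h : R -> C) (t : R) (u v : C) :
  pderiv g t u -> pderiv h t v -> pderiv (fun s => g s - h s)%C t (u - v).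
Proof.
  intros Hg Hh. apply pderiv_is_derive.
  apply (is_derive_minus (K:=R_AbsRing) (V:=C_R_NormedModule)); apply pderiv_is_derive; auto.
Qed.

Lemma pderiv_line (a v : C) (t : R) : pderiv (fun s => a + RtoC s * v)%C t v.
Proof.
  intros eps He. exists 1; split; [lra|]. intros t' _.
  replace (a + RtoC t' * v - (a + RtoC t * v) - RtoC (t' - t) * v)%C with (RtoC 0).
  - rewrite Cmod_0. pose proof (Rabs_pos (t' - t)); nra.
  - rewrite RtoC_minus; ring.
Qed.

Lemma pderiv_affine (g : R -> C) (k m t : R) (v : C) :
  pderiv g (k * t + m) v -> pderiv (fun s => g (k * s + m)) t (RtoC k * v).
Proof.
  intros H eps He.
  pose proof (Rabs_pos k) as Hk.
  destruct (H (eps / (1 + Rabs k))) as [d [Hd H']]; [apply Rdiv_lt_0_compat; lra|].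
  exists (d / (1 + Rabs k)); split; [apply Rdiv_lt_0_compat; lra|].
  intros t' Ht'.
  assert (E : Rabs (k * t' + m - (k * t + m)) = Rabs k * Rabs (t' - t)) by (rewrite <- Rabs_mult;
    f_equal; ring).
  pose proof (Rabs_pos (t' - t)) as Hp.
  assert (Hm : Rabs (t' - t) * (1 + Rabs k) < d).
  { apply (Rmult_lt_compat_r (1 + Rabs k)) in Ht'; [|lra]. unfold Rdiv in Ht'.
    rewrite Rmult_assoc, Rinv_l in Ht'; lra. }
  specialize (H' (k * t' + m)). rewrite E in H'.
  replace (k * t' + m - (k * t + m)) with (k * (t' - t)) in H' by ring.
  rewrite RtoC_mult in H'.
  replace (RtoC (t' - t) * (RtoC k * v))%C with (RtoC k * RtoC (t' - t) * v)%C by ring.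
  eapply Rle_trans; [apply H'; nra|].
  replace (eps * Rabs (t' - t)) with (eps / (1 + Rabs k) * ((1 + Rabs k) * Rabs (t' - t)))
    by (field; lra).
  apply Rmult_le_compat_l; [|nra]. apply Rlt_le, Rdiv_lt_0_compat; lra.
Qed.

(** Projection onto a fixed direction [w] reduces complex-valued paths to real functions: [w = 1]
    and [w = Ci] give the components, and a well chosen [w] gives the mean value inequality. *)
Lemma pderiv_dot (g : R -> C) (t : R) (v w : C) : pderiv g t v ->
  is_derive (fun s => fst w * fst (g s) + snd w * snd (g s)) t (fst w * fst v + snd w * snd v).
Proof.
  intros H. apply is_derive_Reals. intros eps He.
  set (M := Rabs (fst w) + Rabs (snd w) + 1).
  assert (HM : 0 < M) by (unfold M; pose proof (Rabs_pos (fst w)); pose proof (Rabs_pos (snd w));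
    lra).
  destruct (H (eps / (2 * M))) as [d [Hd H']]; [apply Rdiv_lt_0_compat; lra|].
  exists (mkposreal d Hd). intros h Hh0 Hh. simpl in Hh.
  specialize (H' (t + h)). replace (t + h - t) with h in H' by ring. specialize (H' Hh).
  set (D := (g (t + h)%R - g t - RtoC h * v)%C) in *.
  replace ((fst w * fst (g (t + h)) + snd w * snd (g (t + h)) - (fst w * fst (g t) + snd w * snd
    (g t))) / h - (fst w * fst v + snd w * snd v))
    with ((fst w * fst D + snd w * snd D) / h).
  2:{ unfold D, Cminus, Cplus, Copp, Cmult, RtoC; simpl. field; auto. }
  unfold Rdiv. rewrite Rabs_mult, Rabs_inv.
  assert (0 < Rabs h) by (apply Rabs_pos_lt; auto).
  apply (Rmult_lt_reg_r (Rabs h)); auto. rewrite Rmult_assoc, Rinv_l, Rmult_1_r by lra.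
  eapply Rle_lt_trans; [apply Rabs_triang|]. rewrite !Rabs_mult.
  pose proof (fst_le_Cmod D). pose proof (snd_le_Cmod D).
  pose proof (Rabs_pos (fst w)). pose proof (Rabs_pos (snd w)). pose proof (Cmod_ge_0 D).
  apply Rle_lt_trans with (M * Cmod D); [unfold M; nra|].
  apply Rle_lt_trans with (M * (eps / (2 * M) * Rabs h)); [apply Rmult_le_compat_l; lra|].
  replace (M * (eps / (2 * M) * Rabs h)) with (eps / 2 * Rabs h) by (field; lra).
  nra.
Qed.

Lemma pderiv_curve_deriv (g : R -> C) (t : R) (v : C) :
  pderiv g t v -> curve_deriv g t = v.
Proof.
  intros H. unfold curve_deriv.
  assert (H1 := pderiv_dot g t v 1 H). assert (H2 := pderiv_dot g t v Ci H).
  simpl in H1, H2. destruct v as [v1 v2]; simpl in *.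
  f_equal; apply is_derive_unique.
  - replace v1 with (1 * v1 + 0 * v2) by ring. eapply is_derive_ext; [|exact H1].
    intros; simpl; ring.
  - replace v2 with (0 * v1 + 1 * v2) by ring. eapply is_derive_ext; [|exact H2].
    intros; simpl; ring.
Qed.

(** * Mean value inequalities for complex-valued paths *)

Lemma dot_le_Cmod (w v : C) : fst w * fst v + snd w * snd v <= Cmod w * Cmod v.
Proof.
  pose proof (re_le_Cmod (Cconj w * v)) as H. rewrite Cmod_mult, Cmod_conj in H.
  replace (Re (Cconj w * v)) with (fst w * fst v + snd w * snd v) in H.
  - apply Rle_trans with (2 := H). apply Rle_abs.
  - destruct w, v; unfold Re, Cconj, Cmult; simpl; ring.
Qed.

Lemma increment_le_real (h dh : R -> R) (p q : R) : p <= q ->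
  (forall t, p <= t <= q -> is_derive h t (dh t)) ->
  (forall t, p <= t <= q -> dh t <= 0) -> h q <= h p.
Proof.
  intros Hpq Hd Hn.
  destruct (MVT_gen h p q dh) as [c [Hc E]].
  - rewrite Rmin_left, Rmax_right by auto. intros; apply Hd; lra.
  - rewrite Rmin_left, Rmax_right by auto. intros x Hx.
    apply derivable_continuous_pt. exists (dh x). apply is_derive_Reals. auto.
  - rewrite Rmin_left, Rmax_right in Hc by auto.
    specialize (Hn c Hc). nra.
Qed.

(** The mean value theorem fails for complex values, so it is applied to the real function <w, phi>
    - |w| G with w = phi q - phi p. By Cauchy-Schwarz this function does not increase, and its
    increment is |w|^2 - |w| (G q - G p). *)
Lemma increment_bound (phi : R -> C) (dphi : R -> C) (G dG : R -> R) (p q : R) : p <= q ->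
  (forall t, p <= t <= q -> pderiv phi t (dphi t)) ->
  (forall t, p <= t <= q -> is_derive G t (dG t)) ->
  (forall t, p <= t <= q -> Cmod (dphi t) <= dG t) ->
  Cmod (phi q - phi p) <= G q - G p.
Proof.
  intros Hpq Hphi HG Hle.
  set (w := (phi q - phi p)%C).
  destruct (Req_dec (Cmod w) 0) as [E|E].
  - rewrite E.
    assert (- G q <= - G p); [|lra].
    apply (increment_le_real (fun t => - G t) (fun t => - dG t) p q); auto.
    + intros; apply (is_derive_opp (K:=R_AbsRing) (V:=R_NormedModule)); auto.
    + intros t Ht. specialize (Hle t Ht). pose proof (Cmod_ge_0 (dphi t)). lra.
  - assert (Hw : 0 < Cmod w) by (pose proof (Cmod_ge_0 w); lra).
    assert (H := increment_le_real (fun t => fst w * fst (phi t) + snd w * snd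
      (phi t) - Cmod w * G t)
      (fun t => fst w * fst (dphi t) + snd w * snd (dphi t) - Cmod w * dG t) p q Hpq).
    cbv beta in H.
    assert (Hc : fst w * fst (phi q) + snd w * snd (phi q) - Cmod w * G q <=
      fst w * fst (phi p) + snd w * snd (phi p) - Cmod w * G p).
    { apply H.
      - intros t Ht. apply (is_derive_minus (K:=R_AbsRing) (V:=R_NormedModule)
          (fun s => fst w * fst (phi s) + snd w * snd (phi s)) (fun s => Cmod w * G s)).
        + apply pderiv_dot; auto.
        + apply is_derive_scal; auto.
      - intros t Ht. pose proof (dot_le_Cmod w (dphi t)). specialize (Hle t Ht). nra. }
    assert (Hw2 : Cmod w * Cmod w = fst w * (fst (phi q) - fst (phi p)) + snd w * (snd
      (phi q) - snd (phi p))).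
    { pose proof (Cmod2_alt w) as Ha. unfold Re, Im in Ha.
      replace (Cmod w * Cmod w) with (Cmod w ^ 2) by ring. rewrite Ha.
      unfold w, Cminus, Cplus, Copp; simpl. ring. }
    nra.
Qed.

Lemma constant_of_pderiv_0 (phi : R -> C) (p q : R) : p <= q ->
  (forall t, p <= t <= q -> pderiv phi t 0) -> phi q = phi p.
Proof.
  intros Hpq H. apply Cmod_sub_eq0.
  replace (Cmod (phi q - phi p) <= 0) with (Cmod (phi q - phi p) <= 0 - 0) by (f_equal; ring).
  apply (increment_bound phi (fun _ => RtoC 0) (fun _ => 0) (fun _ => 0) p q); auto.
  - intros; apply is_derive_Reals. apply derivable_pt_lim_const.
  - intros; rewrite Cmod_0; lra.
Qed.

(** Smoothness and the angle condition are given only inside a parameter interval. Bounds are proved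
    on interior subintervals and reach the end points by continuity. *)
Lemma increment_closure (phi : R -> C) (p q B : R) : p <= q -> 0 <= B ->
  path_cont (fun t => p <= t <= q) phi p -> path_cont (fun t => p <= t <= q) phi q ->
  (forall x y, p < x -> x < y -> y < q -> Cmod (phi y - phi x) <= B) ->
  Cmod (phi q - phi p) <= B.
Proof.
  intros Hpq HB Hp Hq H.
  destruct (Req_dec p q) as [->|Hne].
  { replace (phi q - phi q)%C with (RtoC 0) by ring. rewrite Cmod_0; auto. }
  apply Rnot_lt_le; intros Hlt.
  set (e := (Cmod (phi q - phi p) - B) / 2).
  assert (He : 0 < e) by (unfold e; lra).
  destruct (Hp e He) as [d1 [Hd1 H1]]. destruct (Hq e He) as [d2 [Hd2 H2]].
  set (m := Rmin (Rmin d1 d2) (q - p) / 3).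
  assert (Hm : 0 < m).
  { unfold m. apply Rdiv_lt_0_compat; [|lra]. repeat apply Rmin_pos; lra. }
  assert (Hm1 : 3 * m <= d1 /\ 3 * m <= d2 /\ 3 * m <= q - p).
  { unfold m. pose proof (Rmin_l (Rmin d1 d2) (q - p)). pose proof (Rmin_r (Rmin d1 d2) (q - p)).
    pose proof (Rmin_l d1 d2). pose proof (Rmin_r d1 d2). lra. }
  specialize (H (p + m) (q - m)). specialize (H1 (p + m)). specialize (H2 (q - m)).
  assert (A1 : Cmod (phi (p + m) - phi p) < e).
  { apply H1; [lra|]. replace (p + m - p) with m by ring. rewrite Rabs_pos_eq; lra. }
  assert (A2 : Cmod (phi (q - m) - phi q) < e).
  { apply H2; [lra|]. replace (q - m - q) with (- m) by ring. rewrite Rabs_Ropp, Rabs_pos_eq; lra. }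
  assert (A3 : Cmod (phi (q - m) - phi (p + m)) <= B) by (apply H; lra).
  assert (Cmod (phi q - phi p) <= Cmod (phi (q - m) - phi q) + (Cmod (phi (q - m) - phi
    (p + m)) + Cmod (phi (p + m) - phi p))).
  { rewrite (Cmod_sub_sym _ (phi q)).
    eapply Rle_trans; [apply (Cmod_sum _ (phi q - phi (q - m)) (phi (q - m) - phi p)); ring|].
    apply Rplus_le_compat_l. apply Cmod_sum; ring. }
  unfold e in *. lra.
Qed.

(** Retraction of the line onto [[p, q]]: it extends a path continuous on an interval to a
    continuous path on the whole line, as [primitive_exists] requires. *)
Definition clamp (p q t : R) : R := Rmax p (Rmin q t).

Lemma clamp_in (p q t : R) : p <= q -> p <= clamp p q t <= q.
Proof. intros H. unfold clamp. split; [apply Rmax_l|]. apply Rmax_lub; auto. apply Rmin_l. Qed.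

Lemma clamp_id (p q t : R) : p <= t <= q -> clamp p q t = t.
Proof. intros H. unfold clamp. rewrite Rmin_right by lra. apply Rmax_right; lra. Qed.

Lemma clamp_dist (p q s t : R) : Rabs (clamp p q s - clamp p q t) <= Rabs (s - t).
Proof.
  unfold clamp, Rmax, Rmin.
  repeat destruct Rle_dec; unfold Rabs; repeat destruct Rcase_abs; lra.
Qed.

Lemma clamp_cont (g : R -> C) (p q : R) : p <= q ->
  (forall t, p <= t <= q -> path_cont (fun t => p <= t <= q) g t) ->
  forall t, path_cont (fun _ => True) (fun s => g (clamp p q s)) t.
Proof.
  intros Hpq H t eps He. destruct (H (clamp p q t) (clamp_in p q t Hpq) eps He) as [d [Hd H']].
  exists d; split; auto. intros t' _ Ht'. apply H'; [apply clamp_in; auto|].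
  eapply Rle_lt_trans; [apply clamp_dist|auto].
Qed.

Lemma path_cont_continuous (g : R -> C) (t : R) : path_cont (fun _ => True) g t <->
  continuous (T := R_UniformSpace) (U := C_R_NormedModule) g t.
Proof.
  split.
  - intros H P HP. apply locally_C_iff in HP. destruct HP as [e [He HP]].
    destruct (H e He) as [d [Hd H']]. exists (mkposreal d Hd). intros t' Ht'.
    apply HP, H'; auto.
  - intros H eps He.
    assert (HP : locally (T:=C_UniformSpace) (g t) (fun z => Cmod (z - g t) < eps)).
    { apply locally_C_iff. exists eps; auto. }
    destruct (H _ HP) as [d Hd]. exists d; split; [apply cond_pos|].
    intros t' _ Ht'. apply (Hd t' Ht').
Qed.

Lemma primitive_exists (g : R -> C) : (forall t, path_cont (fun _ => True) g t) ->
  exists J, forall t, pderiv J t (g t).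
Proof.
  intros H.
  exists (fun t => RInt (V:=C_R_CompleteNormedModule) g 0 t). intros t.
  apply pderiv_is_derive.
  apply (is_derive_RInt (V:=C_R_NormedModule) g (fun t => RInt
    (V:=C_R_CompleteNormedModule) g 0 t) 0 t).
  - apply filter_forall. intros x.
    apply (RInt_correct (V:=C_R_CompleteNormedModule)).
    apply (ex_RInt_continuous (V:=C_R_CompleteNormedModule)).
    intros; apply path_cont_continuous; auto.
  - apply path_cont_continuous; auto.
Qed.

Lemma pderiv_cont (g : R -> C) (t : R) (v : C) (D : R -> Prop) :
  pderiv g t v -> path_cont D g t.
Proof.
  intros H eps He. destruct (H 1 Rlt_0_1) as [d [Hd H']].
  pose proof (Cmod_ge_0 v) as Hv.
  exists (Rmin d (eps / (2 + Cmod v))). split.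
  { apply Rmin_pos; auto. apply Rdiv_lt_0_compat; lra. }
  intros t' _ Ht'. specialize (H' t' (Rlt_le_trans _ _ _ Ht' (Rmin_l _ _))).
  apply Rlt_le_trans with (r3 := eps / (2 + Cmod v)) in Ht'; [|apply Rmin_r].
  assert (Cmod (g t' - g t) <= (1 + Cmod v) * Rabs (t' - t)).
  { eapply Rle_trans; [apply (Cmod_sum _ (g t' - g t - RtoC (t' - t) * v) (RtoC (t' - t) * v));
      ring|].
    rewrite Cmod_mult, Cmod_R. lra. }
  apply Rle_lt_trans with (1 := H0).
  apply Rle_lt_trans with ((2 + Cmod v) * Rabs (t' - t)).
  { pose proof (Rabs_pos (t' - t)); nra. }
  replace eps with ((2 + Cmod v) * (eps / (2 + Cmod v))) by (field; lra).
  apply Rmult_lt_compat_l; lra.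
Qed.

(** * Goursat's lemma and local primitives *)

Definition seg_pt (a b : C) (t : R) : C := (a + RtoC t * (b - a))%C.

(** The integral over a segment is encoded by a primitive of the pulled-back integrand instead of
    [RInt]; reversal and bisection are then affine changes of parameter in [J]. *)
Definition seg_int (F : C -> C) (a b v : C) : Prop :=
  exists J, (forall t, 0 <= t <= 1 -> pderiv J t (F (seg_pt a b t) * (b - a))%C) /\
    v = (J 1 - J 0)%C.

Lemma seg_pt_cont (F : C -> C) (a b : C) (t : R) (D : R -> Prop) :
  cdiff F (seg_pt a b t) -> path_cont D (fun s => F (seg_pt a b s)) t.
Proof.
  intros [l H]. eapply pderiv_cont. apply pderiv_comp; [|exact H]. apply pderiv_line.
Qed.

Lemma seg_int_exists (F : C -> C) (a b : C) :
  (forall t, 0 <= t <= 1 -> cdiff F (seg_pt a b t)) -> exists v, seg_int F a b v.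
Proof.
  intros H.
  destruct (primitive_exists (fun t => F (seg_pt a b (clamp 0 1 t)) * (b - a))%C) as [J HJ].
  - intros t. apply (clamp_cont (fun t => F (seg_pt a b t) * (b - a))%C 0 1); [lra|].
    intros s Hs.
    apply (seg_pt_cont (fun z => F z * (b - a))%C).
    apply cdiff_mult; auto. apply cdiff_const.
  - exists (J 1 - J 0)%C, J; split; auto.
    intros t Ht. specialize (HJ t). cbv beta in HJ. rewrite clamp_id in HJ by auto. exact HJ.
Qed.

(** The difference of [J] and [P] along the segment has derivative (F - p)(b - a). With [p] an
    affine or constant approximation of [F], this compares the integral with an exact increment of
    [P]. *)
Lemma seg_int_approx (F P p : C -> C) (a b v : C) (M : R) : seg_int F a b v ->
  (forall t, 0 <= t <= 1 -> cderiv P (seg_pt a b t) (p (seg_pt a b t))) ->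
  (forall t, 0 <= t <= 1 -> Cmod (F (seg_pt a b t) - p (seg_pt a b t)) <= M) ->
  Cmod (v - (P b - P a)) <= M * Cmod (b - a).
Proof.
  intros [J [HJ ->]] HP HM.
  assert (H := increment_bound (fun t => J t - P (seg_pt a b t))%C
    (fun t => (F (seg_pt a b t) - p (seg_pt a b t)) * (b - a))%C
    (fun t => M * Cmod (b - a) * t) (fun t => M * Cmod (b - a)) 0 1 Rle_0_1).
  cbv beta in H.
  replace (seg_pt a b 0) with a in H by (unfold seg_pt; ring).
  replace (seg_pt a b 1) with b in H by (unfold seg_pt; ring).
  replace (J 1 - J 0 - (P b - P a))%C with (J 1 - P b - (J 0 - P a))%C by ring.
  replace (M * Cmod (b - a)) with (M * Cmod (b - a) * 1 - M * Cmod (b - a) * 0) by ring.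
  apply H.
  - intros t Ht.
    replace ((F (seg_pt a b t) - p (seg_pt a b t)) * (b - a))%C with
      (F (seg_pt a b t) * (b - a) - p (seg_pt a b t) * (b - a))%C by ring.
    apply (pderiv_minus J (fun t => P (seg_pt a b t))); auto.
    apply (pderiv_comp P (seg_pt a b)); auto. apply pderiv_line.
  - intros t Ht. auto_derive; auto; ring.
  - intros t Ht. rewrite Cmod_mult. apply Rmult_le_compat_r; auto. apply Cmod_ge_0.
Qed.

Lemma seg_int_reverse (F : C -> C) (a b v : C) : seg_int F a b v -> seg_int F b a (- v)%C.
Proof.
  intros [J [HJ ->]]. exists (fun t => J (- (1) * t + 1)). split.
  - intros t Ht.
    replace (F (seg_pt b a t) * (a - b))%C
      with (RtoC (- (1)) * (F (seg_pt a b (- (1) * t + 1)) * (b - a)))%C.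
    + apply (pderiv_affine J). apply HJ; lra.
    + replace (seg_pt a b (- (1) * t + 1)) with (seg_pt b a t).
      * rewrite RtoC_opp; ring.
      * unfold seg_pt. rewrite RtoC_plus, RtoC_mult, RtoC_opp. ring.
  - replace (- (1) * 1 + 1) with 0 by ring. replace (- (1) * 0 + 1) with 1 by ring. ring.
Qed.

Definition mid (a b : C) : C := (RtoC (/ 2) * (a + b))%C.

Lemma RtoC_half : (RtoC (/ 2) + RtoC (/ 2))%C = RtoC 1.
Proof. rewrite <- RtoC_plus. f_equal; field. Qed.

Lemma mid_half_l (a b : C) : (mid a b - a)%C = (RtoC (/ 2) * (b - a))%C.
Proof.
  unfold mid. replace a with (RtoC 1 * a)%C at 2 by ring. rewrite <- RtoC_half. ring.
Qed.

Lemma mid_half_r (a b : C) : (b - mid a b)%C = (RtoC (/ 2) * (b - a))%C.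
Proof.
  unfold mid. replace b with (RtoC 1 * b)%C at 1 by ring. rewrite <- RtoC_half. ring.
Qed.

Lemma seg_int_mid (F : C -> C) (a b v : C) : seg_int F a b v ->
  exists u w, seg_int F a (mid a b) u /\ seg_int F (mid a b) b w /\ v = (u + w)%C.
Proof.
  intros [J [HJ ->]].
  exists (J (/2)%R - J 0)%C, (J 1 - J (/ 2)%R)%C. repeat split; [| |ring].
  - exists (fun t => J (/ 2 * t + 0)). split.
    + intros t Ht. rewrite mid_half_l.
      replace (F (seg_pt a (mid a b) t) * (RtoC (/ 2) * (b - a)))%C with
        (RtoC (/ 2) * (F (seg_pt a b (/ 2 * t + 0)) * (b - a)))%C.
      * apply (pderiv_affine J). apply HJ; lra.
      * replace (seg_pt a b (/ 2 * t + 0)) with (seg_pt a (mid a b) t); [ring|].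
        unfold seg_pt. rewrite mid_half_l, RtoC_plus, RtoC_mult. ring.
    + replace (/ 2 * 1 + 0) with (/ 2) by ring. replace (/ 2 * 0 + 0) with 0 by ring. ring.
  - exists (fun t => J (/ 2 * t + / 2)). split.
    + intros t Ht. rewrite mid_half_r.
      replace (F (seg_pt (mid a b) b t) * (RtoC (/ 2) * (b - a)))%C with
        (RtoC (/ 2) * (F (seg_pt a b (/ 2 * t + / 2)) * (b - a)))%C.
      * apply (pderiv_affine J). apply HJ; lra.
      * replace (seg_pt a b (/ 2 * t + / 2)) with (seg_pt (mid a b) b t); [ring|].
        unfold seg_pt. rewrite mid_half_r, RtoC_plus, RtoC_mult. unfold mid.
        replace a with (RtoC 1 * a)%C at 3 by ring. rewrite <- RtoC_half. ring.
    + replace (/ 2 * 1 + / 2) with 1 by field. replace (/ 2 * 0 + / 2) with (/ 2) by ring. ring.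
Qed.

Lemma seg_pt_dist (a b c : C) (t M : R) : 0 <= t <= 1 ->
  Cmod (a - c) <= M -> Cmod (b - c) <= M -> Cmod (seg_pt a b t - c) <= M.
Proof.
  intros Ht Ha Hb.
  eapply Rle_trans; [apply (Cmod_sum _ (RtoC (1 - t) * (a - c)) (RtoC t * (b - c)))|].
  - unfold seg_pt. rewrite RtoC_minus; ring.
  - rewrite !Cmod_mult, !Cmod_R, !Rabs_pos_eq by lra. nra.
Qed.

Lemma mid_seg_pt (a b : C) : mid a b = seg_pt a b (/ 2).
Proof. unfold seg_pt. rewrite <- mid_half_l. ring. Qed.

Definition tri_int (F : C -> C) (a b c v : C) : Prop :=
  exists x y z, seg_int F a b x /\ seg_int F b c y /\ seg_int F c a z /\ v = (x + y + z)%C.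

Lemma tri_int_split (F : C -> C) (a b c v : C) : tri_int F a b c v ->
  (forall x y, In x (mid a b :: mid b c :: mid c a :: nil) ->
     In y (mid a b :: mid b c :: mid c a :: nil) -> exists u, seg_int F x y u) ->
  exists v1 v2 v3 v4,
    tri_int F a (mid a b) (mid c a) v1 /\ tri_int F (mid a b) b (mid b c) v2 /\
    tri_int F (mid c a) (mid b c) c v3 /\ tri_int F (mid b c) (mid c a) (mid a b) v4 /\
    v = (v1 + v2 + v3 + v4)%C.
Proof.
  intros [x [y [z [Hx [Hy [Hz ->]]]]]] Hex.
  destruct (seg_int_mid _ _ _ _ Hx) as [x1 [x2 [Hx1 [Hx2 ->]]]].
  destruct (seg_int_mid _ _ _ _ Hy) as [y1 [y2 [Hy1 [Hy2 ->]]]].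
  destruct (seg_int_mid _ _ _ _ Hz) as [z1 [z2 [Hz1 [Hz2 ->]]]].
  destruct (Hex (mid a b) (mid c a)) as [p Hp]; [simpl; auto..|].
  destruct (Hex (mid b c) (mid a b)) as [q Hq]; [simpl; auto..|].
  destruct (Hex (mid c a) (mid b c)) as [r Hr]; [simpl; auto..|].
  (* Each inner side is run once in each direction: the three corner triangles use [p], [q], [r] and
     the middle one their opposites, so they cancel in the sum. *)
  exists (x1 + p + z2)%C, (x2 + y1 + q)%C, (r + y2 + z1)%C, (- r + - p + - q)%C.
  repeat split.
  - exists x1, p, z2; auto.
  - exists x2, y1, q; auto.
  - exists r, y2, z1; auto.
  - exists (- r)%C, (- p)%C, (- q)%C; auto using seg_int_reverse.
  - ring.
Qed.

(** * Goursat's lemma by repeated subdivision of a triangle *)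

Definition tri : Type := (C * C * C)%type.

Definition small_tri (s : R) (T : tri) : Prop :=
  let '(a, b, c) := T in Cmod (b - a) <= s /\ Cmod (c - b) <= s /\ Cmod (a - c) <= s.

Definition tri_in (c0 : C) (M : R) (T : tri) : Prop :=
  let '(a, b, c) := T in Cmod (a - c0) <= M /\ Cmod (b - c0) <= M /\ Cmod (c - c0) <= M.

Definition tri_val (F : C -> C) (T : tri) (v : C) : Prop :=
  let '(a, b, c) := T in tri_int F a b c v.

(** The four integrals add up to [v], so one of them has at least a quarter of its modulus.
    Following the first vertex is enough to produce the limit point, because the diameters tend to
    0. *)
Lemma tri_step (F : C -> C) (c0 : C) (M s : R) (T : tri) (v : C) :
  (forall z, Cmod (z - c0) <= M -> cdiff F z) ->
  tri_in c0 M T -> small_tri s T -> tri_val F T v ->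
  exists T' v', tri_in c0 M T' /\ small_tri (s / 2) T' /\ tri_val F T' v' /\
    Cmod v <= 4 * Cmod v' /\ Cmod (fst (fst T') - fst (fst T)) <= s.
Proof.
  destruct T as [[a b] c]. simpl. intros HF [Ha [Hb Hc]] [Hab [Hbc Hca]] Hv.
  assert (Hm : forall x y, Cmod (x - c0) <= M -> Cmod (y - c0) <= M -> Cmod (mid x y - c0) <= M).
  { intros. rewrite mid_seg_pt. apply seg_pt_dist; auto; lra. }
  assert (Hh : forall x y w, (x - y = RtoC (/ 2) * w)%C -> Cmod w <= s -> Cmod (x - y) <= s / 2).
  { intros x y w E Hw. rewrite E, Cmod_mult, Cmod_R, Rabs_pos_eq; lra. }
  destruct (tri_int_split F a b c v Hv) as [v1 [v2 [v3 [v4 [H1 [H2 [H3 [H4 E]]]]]]]].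
  { intros x y Hx Hy. apply seg_int_exists. intros t Ht. apply HF. apply seg_pt_dist; auto.
    - simpl in Hx. destruct Hx as [<-|[<-|[<-|[]]]]; auto.
    - simpl in Hy. destruct Hy as [<-|[<-|[<-|[]]]]; auto. }
  assert (Hs : 0 <= s) by (eapply Rle_trans; [apply Cmod_ge_0|exact Hab]).
  assert (Hsum : Cmod v <= Cmod v1 + Cmod v2 + Cmod v3 + Cmod v4).
  { rewrite E. eapply Rle_trans; [apply Cmod_triangle|]. apply Rplus_le_compat_r.
    eapply Rle_trans; [apply Cmod_triangle|]. apply Rplus_le_compat_r. apply Cmod_triangle. }
  assert (Hc4 : Cmod v <= 4 * Cmod v1 \/ Cmod v <= 4 * Cmod v2 \/ Cmod v <=
    4 * Cmod v3 \/ Cmod v <= 4 * Cmod v4) by lra.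
  assert (Eba : (mid a b - a = RtoC (/ 2) * (b - a))%C) by apply mid_half_l.
  assert (Ebm : (b - mid a b = RtoC (/ 2) * (b - a))%C) by apply mid_half_r.
  assert (Ecb : (mid b c - b = RtoC (/ 2) * (c - b))%C) by apply mid_half_l.
  assert (Ecm : (c - mid b c = RtoC (/ 2) * (c - b))%C) by apply mid_half_r.
  assert (Eac : (mid c a - c = RtoC (/ 2) * (a - c))%C) by apply mid_half_l.
  assert (Eam : (a - mid c a = RtoC (/ 2) * (a - c))%C) by apply mid_half_r.
  assert (E1 : (mid c a - mid a b = RtoC (/ 2) * (c - b))%C) by (unfold mid; ring).
  assert (E2 : (mid a b - mid b c = RtoC (/ 2) * (a - c))%C) by (unfold mid; ring).
  assert (E3 : (mid b c - mid c a = RtoC (/ 2) * (b - a))%C) by (unfold mid; ring).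
  destruct Hc4 as [Hc4|[Hc4|[Hc4|Hc4]]].
  - exists (a, mid a b, mid c a), v1; simpl. repeat split; eauto.
    replace (a - a)%C with (RtoC 0) by ring. rewrite Cmod_0; auto.
  - exists (mid a b, b, mid b c), v2; simpl. repeat split; eauto.
    assert (Cmod (mid a b - a) <= s / 2) by eauto. lra.
  - exists (mid c a, mid b c, c), v3; simpl. repeat split; eauto.
    assert (Cmod (a - mid c a) <= s / 2) by eauto. rewrite Cmod_sub_sym. lra.
  - exists (mid b c, mid c a, mid a b), v4; simpl. repeat split; eauto.
    + apply (Hh _ _ (a - b)%C); [unfold mid; ring|]. rewrite Cmod_sub_sym; auto.
    + apply (Hh _ _ (b - c)%C); [unfold mid; ring|]. rewrite Cmod_sub_sym; auto.
    + apply (Hh _ _ (c - a)%C); [unfold mid; ring|]. rewrite Cmod_sub_sym; auto.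
    + assert (Cmod (mid a b - a) <= s / 2) by eauto.
      assert (Cmod (mid a b - mid b c) <= s / 2) by eauto.
      eapply Rle_trans; [apply (Cmod_sum _ (mid b c - mid a b) (mid a b - a)); ring|].
      rewrite (Cmod_sub_sym (mid b c)). lra.
Qed.

Lemma geom_cauchy_real (x : nat -> R) (s : R) :
  (forall n, Rabs (x (S n) - x n) <= s / 2 ^ n) ->
  exists l, forall n, Rabs (x n - l) <= 2 * s / 2 ^ n.
Proof.
  intros H.
  assert (Hp : forall n, 0 < 2 ^ n) by (intros; apply pow_lt; lra).
  assert (Hs : 0 <= s). { specialize (H O). simpl in H. pose proof (Rabs_pos (x 1%nat - x O)). lra.
  }
  (* The subtracted term is the part of the geometric series not yet used; keeping it makes the
     induction on [k] close. *)
  assert (Hnm : forall n k, Rabs (x (n + k)%nat - x n) <= 2 * s / 2 ^ n - 2 * s / 2 ^ (n + k)).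
  { intros n k. induction k as [|k IH].
    - rewrite Nat.add_0_r. rewrite Rminus_diag, Rabs_R0. lra.
    - rewrite Nat.add_succ_r.
      replace (x (S (n + k)) - x n) with ((x (S (n + k)) - x (n + k)%nat) + (x
        (n + k)%nat - x n)) by ring.
      eapply Rle_trans; [apply Rabs_triang|].
      specialize (H (n + k)%nat). simpl.
      replace (2 * s / (2 * 2 ^ (n + k))) with (s / 2 ^ (n + k)) by (field; apply Rgt_not_eq, Hp).
      replace (2 * s / 2 ^ (n + k)) with (2 * (s / 2 ^ (n + k))) in IH by (field;
        apply Rgt_not_eq, Hp). lra. }
  assert (Hb : forall n k, Rabs (x (n + k)%nat - x n) <= 2 * s / 2 ^ n).
  { intros n k. eapply Rle_trans; [apply Hnm|].
    assert (0 <= 2 * s / 2 ^ (n + k)); [|lra]. apply Rdiv_le_0_compat; [lra|apply Hp]. }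
  destruct (Rcomplete.R_complete x) as [l Hl].
  { intros e He.
    destruct (pow_lt_1_zero (/ 2)) with (y := e / (4 * s + 1)) as [N HN].
    - rewrite Rabs_pos_eq; lra.
    - apply Rdiv_lt_0_compat; lra.
    - exists N. intros n m Hn Hm.
      assert (HN' := HN N (le_n _)).
      rewrite Rabs_pos_eq in HN' by (apply pow_le; lra).
      rewrite pow_inv in HN'.
      unfold Rdist. replace (x n - x m) with ((x n - x N) - (x m - x N)) by ring.
      eapply Rle_lt_trans; [apply Rabs_triang|]. rewrite Rabs_Ropp.
      assert (A := Hb N (n - N)%nat). assert (B := Hb N (m - N)%nat).
      replace (N + (n - N))%nat with n in A by lia. replace (N + (m - N))%nat with m in B by lia.
      apply Rle_lt_trans with (4 * s * / 2 ^ N); [unfold Rdiv in A, B; lra|].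
      assert (0 < / 2 ^ N) by apply Rinv_0_lt_compat, Hp.
      apply Rle_lt_trans with ((4 * s + 1) * / 2 ^ N); [nra|].
      replace e with ((4 * s + 1) * (e / (4 * s + 1))) by (field; lra).
      apply Rmult_lt_compat_l; lra. }
  exists l. intros n. apply Rnot_lt_le. intros Hlt.
  destruct (Hl (Rabs (x n - l) - 2 * s / 2 ^ n)) as [N HN]; [lra|].
  specialize (HN (n + N)%nat ltac:(lia)). unfold Rdist in HN. specialize (Hb n N).
  assert (Rabs (x n - l) <= Rabs (x (n + N)%nat - l) + Rabs (x (n + N)%nat - x n)).
  { rewrite (Rabs_minus_sym _ (x n)).
    replace (x n - l) with ((x (n + N)%nat - l) + (x n - x (n + N)%nat)) by ring. apply Rabs_triang.
    }
  lra.
Qed.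

Lemma geom_cauchy (x : nat -> C) (s : R) :
  (forall n, Cmod (x (S n) - x n) <= s / 2 ^ n) ->
  exists l, forall n, Cmod (x n - l) <= 4 * s / 2 ^ n.
Proof.
  intros H.
  destruct (geom_cauchy_real (fun n => fst (x n)) s) as [l1 H1].
  { intros n. eapply Rle_trans; [|apply H]. apply (fst_le_Cmod (x (S n) - x n)). }
  destruct (geom_cauchy_real (fun n => snd (x n)) s) as [l2 H2].
  { intros n. eapply Rle_trans; [|apply H]. apply (snd_le_Cmod (x (S n) - x n)). }
  exists (l1, l2). intros n. eapply Rle_trans; [apply Cmod_le_components|].
  specialize (H1 n). specialize (H2 n). simpl. unfold Rdiv in *. unfold Rminus in *. lra.
Qed.

Lemma tri_int_small (F : C -> C) (a b c v p l : C) (eta s : R) :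
  tri_int F a b c v -> 0 <= eta -> small_tri s (a, b, c) ->
  (forall z, Cmod (z - a) <= s -> Cmod (F z - F p - l * (z - p)) <= eta) ->
  Cmod v <= 3 * (eta * s).
Proof.
  intros [x [y [z [Hx [Hy [Hz ->]]]]]] He [Hab [Hbc Hca]] H.
  (* A global primitive of the affine approximation of [F] at [p]. Its increments around the
     triangle sum to zero, so only the error [eta] contributes. *)
  set (P := fun u => ((F p - l * p) * u + l * (RtoC (/ 2) * (u * u)))%C).
  assert (HP : forall u, cderiv P u (F p + l * (u - p))).
  { intros u. unfold P.
    replace (F p + l * (u - p))%C with ((F p - l * p) * 1 + l * (RtoC (/ 2) * (1 * u + u * 1)))%C.
    - apply cderiv_plus.
      + apply (cderiv_scal (fun u => u)). apply cderiv_id.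
      + apply (cderiv_scal (fun u => RtoC (/ 2) * (u * u))%C).
        apply (cderiv_scal (fun u => u * u)%C).
        apply (cderiv_mult (fun u => u) (fun u => u)); apply cderiv_id.
    - replace (RtoC (/ 2) * (1 * u + u * 1))%C with ((RtoC (/ 2) + RtoC (/ 2)) * u)%C by ring.
      rewrite RtoC_half. ring. }
  assert (Hseg : forall u w r, Cmod (u - a) <= s -> Cmod (w - a) <= s -> Cmod (w - u) <= s ->
    seg_int F u w r -> Cmod (r - (P w - P u)) <= eta * s).
  { intros u w r Hu Hw Huw Hr.
    eapply Rle_trans; [apply (seg_int_approx F P (fun u => F p + l * (u - p))%C u w r eta); auto|].
    - intros t Ht.
      replace (F (seg_pt u w t) - (F p + l * (seg_pt u w t - p)))%C with
        (F (seg_pt u w t) - F p - l * (seg_pt u w t - p))%C by ring.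
      apply H, seg_pt_dist; auto.
    - apply Rmult_le_compat_l; auto. }
  assert (Haa : Cmod (a - a) <= s).
  { replace (a - a)%C with (RtoC 0) by ring. rewrite Cmod_0.
    eapply Rle_trans; [apply Cmod_ge_0|exact Hab]. }
  assert (Hca' : Cmod (c - a) <= s) by (rewrite Cmod_sub_sym; auto).
  assert (A1 := Hseg a b x Haa Hab Hab Hx).
  assert (A2 := Hseg b c y Hab Hca' Hbc Hy).
  assert (A3 := Hseg c a z Hca' Haa Hca Hz).
  replace (x + y + z)%C with ((x - (P b - P a)) + ((y - (P c - P b)) + (z - (P a - P c))))%C
    by ring.
  eapply Rle_trans; [apply Cmod_triangle|].
  eapply Rle_trans; [apply Rplus_le_compat_l, Cmod_triangle|]. lra.
Qed.

Lemma goursat (F : C -> C) (c0 a b c v : C) (M : R) :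
  (forall z, Cmod (z - c0) <= M -> cdiff F z) -> tri_in c0 M (a, b, c) ->
  tri_int F a b c v -> v = RtoC 0.
Proof.
  intros HF Hin Hv.
  set (s := Cmod (b - a) + Cmod (c - b) + Cmod (a - c)).
  assert (Hs0 : small_tri s (a, b, c)).
  { unfold s. simpl. pose proof (Cmod_ge_0 (b - a)). pose proof (Cmod_ge_0 (c - b)).
    pose proof (Cmod_ge_0 (a - c)). lra. }
  assert (Hs : 0 <= s) by (eapply Rle_trans; [apply Cmod_ge_0|apply Hs0]).
  assert (Hp : forall n, 0 < 2 ^ n) by (intros; apply pow_lt; lra).
  set (Inv := fun (n : nat) (X : tri * C) => tri_in c0 M (fst X) /\ small_tri (s / 2 ^ n) (fst X) /\
    tri_val F (fst X) (snd X) /\ Cmod v <= 4 ^ n * Cmod (snd X)).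
  set (Rel := fun (n : nat) (X Y : tri * C) =>
    Inv (S n) Y /\ Cmod (fst (fst (fst Y)) - fst (fst (fst X))) <= s / 2 ^ n).
  assert (Hstep : forall n X, Inv n X -> exists Y, Rel n X Y).
  { intros n [T u] [H1 [H2 [H3 H4]]]. simpl in *.
    destruct (tri_step F c0 M (s / 2 ^ n) T u HF H1 H2 H3) as [T' [u' [G1 [G2 [G3 [G4 G5]]]]]].
    exists (T', u'). repeat split; simpl; auto.
    - replace (s / (2 * 2 ^ n)) with (s / 2 ^ n / 2) by (field; apply Rgt_not_eq, Hp). auto.
    - eapply Rle_trans; [exact H4|].
      replace (4 * 4 ^ n * Cmod u') with (4 ^ n * (4 * Cmod u')) by ring.
      apply Rmult_le_compat_l; auto. apply pow_le; lra. }
  (* The subtriangle carrying a quarter of the integral is picked by choice. The choice is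
     meaningful only when [Inv] holds, which is why [Hsq] precedes [Hrel]. *)
  set (nxt := fun n X => epsilon (inhabits X) (Rel n X)).
  set (sq := fix sq (n : nat) : tri * C := match n
    with O => ((a, b, c), v) | S n => nxt n (sq n) end).
  assert (Hsq : forall n, Inv n (sq n)).
  { induction n as [|n IH].
    - unfold Inv; simpl. repeat split; try apply Hin; auto; try lra;
      replace (s / 1) with s by field; apply Hs0.
    - simpl. apply (epsilon_spec (inhabits (sq n)) (Rel n (sq n)) (Hstep n _ IH)). }
  assert (Hrel : forall n, Rel n (sq n) (sq (S n))).
  { intros n. simpl. apply (epsilon_spec (inhabits (sq n)) (Rel n (sq n)) (Hstep n _ (Hsq n))). }
  destruct (geom_cauchy (fun n => fst (fst (fst (sq n)))) s) as [p Hpl].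
  { intros n. apply (Hrel n). }
  (* The closed disc contains the limit of the vertices, so [F] is differentiable at [p]. *)
  assert (HpM : Cmod (p - c0) <= M).
  { apply Rnot_lt_le. intros Hlt.
    destruct (pow_lt_1_zero (/ 2)) with (y := (Cmod (p - c0) - M) / (4 * s + 1)) as [N HN].
    - rewrite Rabs_pos_eq; lra.
    - apply Rdiv_lt_0_compat; lra.
    - specialize (HN N (le_n _)). rewrite Rabs_pos_eq in HN by (apply pow_le; lra).
      rewrite pow_inv in HN.
      specialize (Hpl N). destruct (Hsq N) as [Hi _]. destruct (fst (sq N)) as [[x y] z].
      simpl in *.
      destruct Hi as [Hi _].
      assert (Cmod (p - c0) <= Cmod (x - p) + Cmod (x - c0)).
      { rewrite (Cmod_sub_sym x p). apply Cmod_sum; ring. }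
      assert (0 < / 2 ^ N) by apply Rinv_0_lt_compat, Hp.
      assert ((4 * s + 1) * / 2 ^ N < Cmod (p - c0) - M).
      { replace (Cmod (p - c0) - M) with ((4 * s + 1) * ((Cmod (p - c0) - M) / (4 * s + 1)))
          by (field; lra).
        apply Rmult_lt_compat_l; lra. }
      unfold Rdiv in Hpl. nra. }
  destruct (HF p HpM) as [l Hl].
  (* The N-th triangle lies within 5 s / 2^N of [p]: its size s / 2^N plus the distance 4 s / 2^N
     from its vertex to [p]. Its three sides contribute 3 eta (5 s / 2^N)(s / 2^N), and the factor
     4^N of the invariant cancels both halvings. *)
  assert (Hsmall : forall eta, 0 < eta -> Cmod v <= 15 * s * s * eta).
  { intros eta Heta. destruct (Hl eta Heta) as [d [Hd Hd']].
    destruct (pow_lt_1_zero (/ 2)) with (y := d / (5 * s + 1)) as [N HN].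
    - rewrite Rabs_pos_eq; lra.
    - apply Rdiv_lt_0_compat; lra.
    - specialize (HN N (le_n _)). rewrite Rabs_pos_eq in HN by (apply pow_le; lra).
      rewrite pow_inv in HN.
      specialize (Hpl N). destruct (Hsq N) as [Hi [Hsm [Hval Hbd]]].
      destruct (sq N) as [[[x y] z] u]. simpl in *.
      assert (Hi0 : 0 < / 2 ^ N) by apply Rinv_0_lt_compat, Hp.
      assert ((5 * s + 1) * / 2 ^ N < d).
      { replace d with ((5 * s + 1) * (d / (5 * s + 1))) by (field; lra).
        apply Rmult_lt_compat_l; lra. }
      assert (Hu : Cmod u <= 3 * (eta * (5 * s / 2 ^ N) * (s / 2 ^ N))).
      { apply (tri_int_small F x y z u p l); auto.
        - apply Rmult_le_pos; [lra|]. apply Rdiv_le_0_compat; [lra|auto].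
        - intros w Hw.
          assert (Hwp : Cmod (w - p) <= 5 * s / 2 ^ N).
          { eapply Rle_trans; [apply (Cmod_sum _ (w - x) (x - p)); ring|]. unfold Rdiv in *. lra. }
          eapply Rle_trans; [apply Hd'|].
          + eapply Rle_lt_trans; [exact Hwp|]. unfold Rdiv. nra.
          + apply Rmult_le_compat_l; lra. }
      eapply Rle_trans; [exact Hbd|].
      eapply Rle_trans; [apply Rmult_le_compat_l; [apply pow_le; lra|exact Hu]|].
      replace 4 with (2 * 2) at 1 by ring. rewrite Rpow_mult_distr.
      right. field. apply Rgt_not_eq, Hp. }
  apply Cmod_eq_0. apply Rle_antisym; [|apply Cmod_ge_0].
  apply Rnot_lt_le. intros Hlt.
  (* The added 1 covers the degenerate triangle with [s = 0]; the final halving gives the strict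
     contradiction. *)
  specialize (Hsmall (Cmod v / (15 * s * s + 1) / 2)).
  assert (Hq : 0 <= 15 * s * s) by nra.
  assert (0 < Cmod v / (15 * s * s + 1) / 2) by (repeat apply Rdiv_lt_0_compat; lra).
  specialize (Hsmall H).
  assert (E : Cmod v = (15 * s * s + 1) * (2 * (Cmod v / (15 * s * s + 1) / 2))) by (field; lra).
  set (e := Cmod v / (15 * s * s + 1) / 2) in *. nra.
Qed.

(** Take the integral over the segment from the centre. Goursat's lemma on the triangle c0, z, z'
    turns an increment of this function into the integral over [z, z'], which continuity of [F]
    compares with F z (z' - z). *)
Lemma local_primitive (F : C -> C) (c0 : C) (M : R) : 0 < M ->
  (forall z, Cmod (z - c0) <= M -> cdiff F z) ->
  exists P, forall z, Cmod (z - c0) < M -> cderiv P z (F z).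
Proof.
  intros HM HF.
  assert (Hex : forall a b, Cmod (a - c0) <= M -> Cmod (b - c0) <= M -> exists v, seg_int F a b v).
  { intros a b Ha Hb. apply seg_int_exists. intros t Ht. apply HF, seg_pt_dist; auto. }
  set (P := fun z => epsilon (inhabits (RtoC 0)) (seg_int F c0 z)).
  assert (Hcc : Cmod (c0 - c0) <= M).
  { replace (c0 - c0)%C with (RtoC 0) by ring. rewrite Cmod_0; lra. }
  assert (HP : forall z, Cmod (z - c0) <= M -> seg_int F c0 z (P z)).
  { intros z Hz. apply (epsilon_spec (inhabits (RtoC 0)) (seg_int F c0 z)). apply Hex; auto. }
  exists P. intros z Hz eps He.
  assert (Hzc : cdiff F z) by (apply HF; lra).
  destruct (cdiff_cont F z Hzc eps He) as [d [Hd Hd']].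
  exists (Rmin d (M - Cmod (z - c0))). split; [apply Rmin_pos; lra|].
  intros z' Hz'.
  assert (Hz'1 : Cmod (z' - z) < d) by (eapply Rlt_le_trans; [exact Hz'|apply Rmin_l]).
  assert (Hz'2 : Cmod (z' - z) < M - Cmod (z - c0)) by (eapply Rlt_le_trans;
    [exact Hz'|apply Rmin_r]).
  assert (Hz'M : Cmod (z' - c0) <= M).
  { eapply Rle_trans; [apply (Cmod_sum _ (z' - z) (z - c0)); ring|lra]. }
  destruct (Hex z z') as [u Hu]; [lra|auto|].
  assert (E : (P z' - P z)%C = u).
  { assert (H0 : (P z + u + - P z')%C = RtoC 0).
    { apply (goursat F c0 c0 z z' _ M HF).
      - simpl; repeat split; auto; lra.
      - exists (P z), u, (- P z')%C. repeat split; auto; [apply HP; lra|].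
        apply seg_int_reverse; auto. }
    replace u with (P z + u + - P z' + (P z' - P z))%C by ring. rewrite H0; ring. }
  rewrite E.
  replace (u - F z * (z' - z))%C with (u - (F z * z' - F z * z))%C by ring.
  apply (seg_int_approx F (fun x => F z * x)%C (fun _ => F z) z z' u eps); auto.
  - intros t Ht. generalize (cderiv_scal (fun x => x) (F z) (seg_pt z z' t) 1 (cderiv_id _)).
    rewrite Cmult_1_r. exact (fun H => H).
  - intros t Ht. apply Rlt_le, Hd'.
    eapply Rle_lt_trans; [apply (seg_pt_dist z z' z t (Cmod (z' - z))); auto; [|lra]|auto].
    replace (z - z)%C with (RtoC 0) by ring. rewrite Cmod_0. apply Cmod_ge_0.
Qed.

(** * Lifting a homotopy through local primitives *)

Definition loc_prim (F : C -> C) (z : C) (r : R) (P : C -> C) : Prop :=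
  forall x, Cmod (x - z) < r -> cderiv P x (F x).

Definition cont2 (D : R -> R -> Prop) (H : R -> R -> C) (s t : R) : Prop :=
  forall eps, 0 < eps -> exists del, 0 < del /\ forall s' t', D s' t' ->
    Rabs (s' - s) < del -> Rabs (t' - t) < del -> Cmod (H s' t' - H s t) < eps.

Definition rect (s0 s1 t0 t1 s t : R) : Prop := s0 <= s <= s1 /\ t0 <= t <= t1.

(** On the rectangle, [Phi] is locally the composite of [H] with a primitive of
    [F]. *)
Definition lifted (F : C -> C) (H : R -> R -> C) (s0 s1 t0 t1 : R)
    (Phi : R -> R -> C) : Prop :=
  forall s t, rect s0 s1 t0 t1 s t -> exists P r del, 0 < del /\
    loc_prim F (H s t) r P /\
    forall s' t', rect s0 s1 t0 t1 s' t' -> Rabs (s' - s) < del -> Rabs (t' - t) < del ->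
      Cmod (H s' t' - H s t) < r /\ Phi s' t' = P (H s' t').

Definition lifted1 (F : C -> C) (g : R -> C) (p q : R) (phi : R -> C) : Prop :=
  forall t, p <= t <= q -> exists P r del, 0 < del /\ loc_prim F (g t) r P /\
    forall t', p <= t' <= q -> Rabs (t' - t) < del ->
      Cmod (g t' - g t) < r /\ phi t' = P (g t').

Lemma Cmod_diag (z : C) : Cmod (z - z) = 0.
Proof. replace (z - z)%C with (RtoC 0) by ring. apply Cmod_0. Qed.

Lemma Rabs_diag_lt (t d : R) : 0 < d -> Rabs (t - t) < d.
Proof. rewrite Rminus_diag, Rabs_R0; auto. Qed.

Lemma loc_prim_diff (F P Q : C -> C) (z x : C) (r r' : R) :
  loc_prim F z r P -> loc_prim F z r' Q -> Cmod (x - z) < r -> Cmod (x - z) < r' ->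
  (P x - Q x)%C = (P z - Q z)%C.
Proof.
  intros HP HQ Hr Hr'.
  assert (H := constant_of_pderiv_0 (fun t => P (seg_pt z x t) - Q (seg_pt z x t))%C 0 1 Rle_0_1).
  cbv beta in H.
  replace (seg_pt z x 0) with z in H by (unfold seg_pt; ring).
  replace (seg_pt z x 1) with x in H by (unfold seg_pt; ring).
  apply H. intros t Ht.
  assert (Hd : Cmod (seg_pt z x t - z) <= Cmod (x - z)).
  { apply seg_pt_dist; auto; [|lra]. rewrite Cmod_diag. apply Cmod_ge_0. }
  replace (RtoC 0) with (F (seg_pt z x t) * (x - z) - F (seg_pt z x t) * (x - z))%C by ring.
  apply (pderiv_minus (fun t => P (seg_pt z x t)) (fun t => Q (seg_pt z x t)));
    (eapply pderiv_comp; [apply pderiv_line|]); [apply HP|apply HQ]; fold (seg_pt z x t); lra.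
Qed.

(** Composition with [clamp] gives a function of zero derivative at every point of the interval, so
    connectedness is obtained from the mean value inequality. *)
Lemma locally_constant (psi : R -> C) (a b : R) : a <= b ->
  (forall s, a <= s <= b -> exists del, 0 < del /\ forall s', a <= s' <= b ->
     Rabs (s' - s) < del -> psi s' = psi s) ->
  psi b = psi a.
Proof.
  intros Hab H.
  assert (H0 : psi (clamp a b b) = psi (clamp a b a)); [|rewrite !clamp_id in H0 by lra; auto].
  apply (constant_of_pderiv_0 (fun t => psi (clamp a b t)) a b Hab).
  intros t Ht eps He.
  destruct (H t Ht) as [d [Hd Hd']]. exists d; split; auto. intros t' Ht'.
  rewrite (clamp_id a b t) by auto. rewrite Hd'.
  - replace (psi t - psi t - RtoC (t' - t) * 0)%C with (RtoC 0) by ring. rewrite Cmod_0.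
    pose proof (Rabs_pos (t' - t)); nra.
  - apply clamp_in; auto.
  - pose proof (clamp_dist a b t' t) as Hcl. rewrite (clamp_id a b t) in Hcl by auto. lra.
Qed.

(** On the common edge both lifts are local primitives along the same path, so their difference is
    locally constant, hence a constant [k]; adding [k] to the second lift makes them match. *)
Lemma glue_t (F : C -> C) (H : R -> R -> C) (s0 s1 t0 t1 t2 : R)
    (Phi1 Phi2 : R -> R -> C) :
  s0 <= s1 -> t0 <= t1 -> t1 <= t2 ->
  (forall s t, rect s0 s1 t0 t2 s t -> cont2 (rect s0 s1 t0 t2) H s t) ->
  lifted F H s0 s1 t0 t1 Phi1 -> lifted F H s0 s1 t1 t2 Phi2 ->
  exists Phi, lifted F H s0 s1 t0 t2 Phi.
Proof.
  intros Hs Ht01 Ht12 Hc H1 H2.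
  set (k := (Phi1 s0 t1 - Phi2 s0 t1)%C).
  assert (Hk : forall s, s0 <= s <= s1 -> (Phi1 s t1 - Phi2 s t1)%C = k).
  { intros s Hss. apply (locally_constant (fun s => Phi1 s t1 - Phi2 s t1)%C s0 s); [apply Hss|].
    intros x Hx.
    destruct (H1 x t1) as [P [r [d [Hd [HP HP']]]]]; [unfold rect; lra|].
    destruct (H2 x t1) as [Q [r' [d' [Hd' [HQ HQ']]]]]; [unfold rect; lra|].
    exists (Rmin d d'). split; [apply Rmin_pos; auto|]. intros y Hy Hyx.
    assert (Rabs (y - x) < d /\ Rabs (y - x) < d') as [L1 L2].
    { split; (eapply Rlt_le_trans; [exact Hyx|]); [apply Rmin_l|apply Rmin_r]. }
    destruct (HP' y t1) as [A1 ->]; [unfold rect; lra|auto|apply Rabs_diag_lt; auto|].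
    destruct (HQ' y t1) as [A2 ->]; [unfold rect; lra|auto|apply Rabs_diag_lt; auto|].
    destruct (HP' x t1) as [_ ->]; [unfold rect; lra|apply Rabs_diag_lt; auto..|].
    destruct (HQ' x t1) as [_ ->]; [unfold rect; lra|apply Rabs_diag_lt; auto..|].
    eapply loc_prim_diff; eauto. }
  exists (fun s t => if Rle_dec t t1 then Phi1 s t else (Phi2 s t + k)%C).
  intros s t Hst.
  assert (Hst' := Hst). destruct Hst' as [Hss Htt].
  destruct (Rtotal_order t t1) as [Hlt|[->|Hgt]].
  - destruct (H1 s t) as [P [r [d [Hd [HP HP']]]]]; [unfold rect; lra|].
    exists P, r, (Rmin d (t1 - t)). split; [apply Rmin_pos; lra|]. split; auto.
    intros s' t' [Hs' Ht'] Hds Hdt.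
    pose proof (Rmin_l d (t1 - t)). pose proof (Rmin_r d (t1 - t)).
    apply Rabs_def2 in Hdt as Hdt2.
    destruct Rle_dec; [|lra].
    apply HP'; [unfold rect; lra|lra|lra].
  (* On the seam the primitive [P] of the first lift has to serve both sides. Beyond the seam the
     second lift uses [Q], which differs from [P] by the constant read off at the seam point;
     continuity of [H] keeps the image inside both discs. *)
  - destruct (H1 s t1) as [P [r [d [Hd [HP HP']]]]]; [unfold rect; lra|].
    destruct (H2 s t1) as [Q [r' [d' [Hd' [HQ HQ']]]]]; [unfold rect; lra|].
    destruct (HP' s t1) as [A0 A1]; [unfold rect; lra|apply Rabs_diag_lt; auto..|].
    destruct (HQ' s t1) as [B0 B1]; [unfold rect; lra|apply Rabs_diag_lt; auto..|].
    rewrite Cmod_diag in A0, B0.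
    destruct (Hc s t1 Hst (Rmin r r')) as [d'' [Hd'' Hc']]; [apply Rmin_pos; auto|].
    exists P, r, (Rmin (Rmin d d') d''). split; [repeat apply Rmin_pos; auto|]. split; auto.
    intros s' t' Hst' Hds Hdt.
    pose proof (Rmin_l (Rmin d d') d''). pose proof (Rmin_r (Rmin d d') d'').
    pose proof (Rmin_l d d'). pose proof (Rmin_r d d').
    specialize (Hc' s' t' Hst' ltac:(lra) ltac:(lra)).
    assert (C1 : Cmod (H s' t' - H s t1) < r) by (eapply Rlt_le_trans; [exact Hc'|apply Rmin_l]).
    assert (C2 : Cmod (H s' t' - H s t1) < r') by (eapply Rlt_le_trans; [exact Hc'|apply Rmin_r]).
    split; auto. destruct Hst' as [Hs' Ht'].
    destruct Rle_dec.
    + apply HP'; [unfold rect; lra|lra|lra].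
    + destruct (HQ' s' t') as [_ ->]; [unfold rect; lra|lra|lra|].
      rewrite <- (Hk s) by lra. rewrite A1, B1.
      rewrite <- (loc_prim_diff F P Q (H s t1) (H s' t') r r') by auto. ring.
  - destruct (H2 s t) as [P [r [d [Hd [HP HP']]]]]; [unfold rect; lra|].
    exists (fun z => P z + k)%C, r, (Rmin d (t - t1)). split; [apply Rmin_pos; lra|]. split.
    { intros x Hx. rewrite <- (Cplus_0_r (F x)). apply cderiv_plus; auto. apply cderiv_const. }
    intros s' t' [Hs' Ht'] Hds Hdt.
    pose proof (Rmin_l d (t - t1)). pose proof (Rmin_r d (t - t1)).
    apply Rabs_def2 in Hdt as Hdt2.
    destruct Rle_dec; [lra|].
    destruct (HP' s' t') as [D0 ->]; [unfold rect; lra|lra|lra|]. auto.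
Qed.

Lemma lifted_flip (F : C -> C) (H : R -> R -> C) (s0 s1 t0 t1 : R) (Phi : R -> R -> C) :
  lifted F H s0 s1 t0 t1 Phi -> lifted F (fun t s => H s t) t0 t1 s0 s1 (fun t s => Phi s t).
Proof.
  intros L t s [Ht Hs]. destruct (L s t) as [P [r [d [Hd [HP HP']]]]]; [split; auto|].
  exists P, r, d. repeat split; auto; apply HP'; auto; destruct H0; split; auto.
Qed.

Lemma interval_chain (Q : R -> R -> Prop) (a b d : R) : a <= b -> 0 < d ->
  (forall x y, a <= x -> x <= y -> y <= b -> y - x < d -> Q x y) ->
  (forall x y z, a <= x -> x <= y -> y <= z -> z <= b -> Q x y -> Q y z -> Q x z) -> Q a b.
Proof.
  intros Hab Hd Hsmall Hglue.
  destruct (nfloor_ex ((b - a) / d)) as [N [_ HN]]; [apply Rdiv_le_0_compat; lra|].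
  set (h := (b - a) / (INR N + 1)).
  assert (HN0 : 0 < INR N + 1) by (pose proof (pos_INR N); lra).
  assert (Hh : 0 <= h < d).
  { split; [apply Rdiv_le_0_compat; lra|]. unfold h.
    apply (Rmult_lt_reg_r (INR N + 1)); auto. unfold Rdiv.
    rewrite Rmult_assoc, Rinv_l, Rmult_1_r by lra.
    apply (Rmult_lt_compat_r d) in HN; auto. unfold Rdiv in HN.
    rewrite Rmult_assoc, Rinv_l in HN by lra. lra. }
  assert (Hend : a + INR (S N) * h = b) by (rewrite S_INR; unfold h; field; lra).
  assert (Hind : forall n, (n <= S N)%nat -> Q a (a + INR n * h)).
  { induction n as [|n IH]; intros Hn.
    - simpl. apply Hsmall; lra.
    - assert (Hle : INR (S n) <= INR (S N)) by (apply le_INR; auto).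
      rewrite (S_INR n) in *. pose proof (pos_INR n).
      assert (a + (INR n + 1) * h <= b).
      { rewrite <- Hend. apply Rplus_le_compat_l, Rmult_le_compat_r; lra. }
      apply (Hglue a (a + INR n * h)); [lra|nra|nra|auto|apply IH; lia|].
      apply Hsmall; nra. }
  rewrite <- Hend. apply Hind; auto.
Qed.

(** By compactness there is a Lebesgue number: every rectangle with sides below [d] is mapped into a
    disc on which [F] has a primitive. These rectangles are glued in the [t] direction into strips,
    and the strips in the [s] direction. *)
Lemma lift_exists (F : C -> C) (H : R -> R -> C) (s0 s1 t0 t1 : R) :
  s0 <= s1 -> t0 <= t1 ->
  (forall s t, rect s0 s1 t0 t1 s t -> cont2 (rect s0 s1 t0 t1) H s t) ->
  (forall s t, rect s0 s1 t0 t1 s t -> exists rho, 0 < rho /\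
     forall x, Cmod (x - H s t) < rho -> cdiff F x) ->
  exists Phi, lifted F H s0 s1 t0 t1 Phi.
Proof.
  intros Hs Ht Hc HF.
  (* The factor 2 leaves room for a whole small rectangle: its corner is within the gauge of the
     chosen point, and its sides add at most as much again. The gauge must be total, hence an
     arbitrary value 1 off the rectangle. *)
  assert (Hloc : forall s t, exists d : posreal, rect s0 s1 t0 t1 s t ->
    exists P r, loc_prim F (H s t) r P /\ forall s' t', rect s0 s1 t0 t1 s' t' ->
      Rabs (s' - s) < 2 * d -> Rabs (t' - t) < 2 * d -> Cmod (H s' t' - H s t) < r).
  { intros s t. destruct (classic (rect s0 s1 t0 t1 s t)) as [Hst|Hst].
    - destruct (HF s t Hst) as [rho [Hrho HF']].
      destruct (local_primitive F (H s t) (rho / 2)) as [P HP]; [lra|intros; apply HF'; lra|].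
      destruct (Hc s t Hst (rho / 2)) as [d [Hd Hd']]; [lra|].
      assert (Hd2 : 0 < d / 2) by lra.
      exists (mkposreal _ Hd2). intros _. exists P, (rho / 2). split; auto.
      simpl. intros s' t' Hst' Hs' Ht'. apply Hd'; auto; lra.
    - exists (mkposreal 1 Rlt_0_1). intros; contradiction. }
  set (gauge := fun s t => proj1_sig (constructive_indefinite_description _ (Hloc s t))).
  destruct (compactness_value_2d s0 s1 t0 t1 gauge) as [d Hd].
  assert (Hsmall : forall a b c e, s0 <= a -> a <= b -> b <= s1 -> t0 <= c -> c <= e -> e <= t1 ->
    b - a < d -> e - c < d -> exists Phi, lifted F H a b c e Phi).
  { intros a b c e Ha Hab Hb Hc0 Hce He Hba Hec.
    assert (Hac := Hd a c ltac:(lra) ltac:(lra)). apply NNPP in Hac.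
    destruct Hac as [u [v [Hu [Hv [Hau [Hcv Hdd]]]]]].
    unfold gauge in *.
    destruct (constructive_indefinite_description _ (Hloc u v)) as [dd Hdd']. simpl in *.
    destruct (Hdd' (conj Hu Hv)) as [P [r [HP Hcl]]].
    assert (Hin : forall s t, rect a b c e s t -> Cmod (H s t - H u v) < r).
    { intros s t [Hs' Ht']. apply Hcl; [unfold rect; lra| |];
      apply Rabs_def2 in Hau; apply Rabs_def2 in Hcv; apply Rabs_def1; lra. }
    exists (fun s t => P (H s t)). intros s t Hst.
    assert (Hr := Hin s t Hst).
    destruct (Hc s t) with (eps := r - Cmod (H s t - H u v)) as [d' [Hd' Hc']]; [destruct Hst;
      unfold rect; lra|lra|].
    exists P, (r - Cmod (H s t - H u v)), d'. split; auto. split.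
    - intros x Hx. apply HP.
      eapply Rle_lt_trans; [apply (Cmod_sum _ (x - H s t) (H s t - H u v)); ring|lra].
    - intros s' t' Hst' Hs' Ht'. split; auto. apply Hc'; auto. destruct Hst'; unfold rect; lra. }
  apply (interval_chain (fun a b => exists Phi, lifted F H a b t0 t1 Phi) s0 s1 d); auto;
    [apply cond_pos| |].
  - intros a b Ha Hab Hb Hba.
    apply (interval_chain (fun c e => exists Phi, lifted F H a b c e Phi) t0 t1 d); auto;
      [apply cond_pos|].
    intros x y z Hx Hxy Hyz Hz [P1 L1] [P2 L2].
    apply (glue_t F H a b x y z P1 P2); auto.
    intros s t [Hs' Ht'] eps He.
    destruct (Hc s t) with (eps := eps) as [d' [Hd' Hc']]; [unfold rect; lra|auto|].
    exists d'; split; auto. intros s' t' [Hs2 Ht2]; apply Hc'; unfold rect; lra.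
  - intros x y z Hx Hxy Hyz Hz [P1 L1] [P2 L2].
    destruct (glue_t F (fun t s => H s t) t0 t1 x y z (fun t s => P1 s t)
      (fun t s => P2 s t)) as [Phi L]; auto using lifted_flip.
    + intros t s [Ht' Hs'] eps He.
      destruct (Hc s t) with (eps := eps) as [d' [Hd' Hc']]; [unfold rect; lra|auto|].
      exists d'; split; auto. intros t' s' [Ht2 Hs2] ? ?; apply Hc'; unfold rect; auto; lra.
    + exists (fun s t => Phi t s). apply (lifted_flip _ _ _ _ _ _ _ L).
Qed.

(** * Slices of a lift, and lifts as contour integrals *)

Lemma lifted_slice_s (F : C -> C) (H : R -> R -> C) (s0 s1 t0 t1 s : R)
    (Phi : R -> R -> C) :
  lifted F H s0 s1 t0 t1 Phi -> s0 <= s <= s1 ->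
  lifted1 F (fun t => H s t) t0 t1 (fun t => Phi s t).
Proof.
  intros L Hs t Ht. destruct (L s t) as [P [r [d [Hd [HP HP']]]]]; [split; auto|].
  exists P, r, d. repeat split; auto; apply HP'; auto; try (split; auto); apply Rabs_diag_lt; auto.
Qed.

Lemma lifted_slice_t (F : C -> C) (H : R -> R -> C) (s0 s1 t0 t1 t : R)
    (Phi : R -> R -> C) :
  lifted F H s0 s1 t0 t1 Phi -> t0 <= t <= t1 ->
  lifted1 F (fun s => H s t) s0 s1 (fun s => Phi s t).
Proof.
  intros L. apply (lifted_slice_s F (fun t s => H s t) t0 t1 s0 s1 t (fun t s => Phi s t)).
  apply lifted_flip; auto.
Qed.

Lemma lifted1_sub (F : C -> C) (g phi : R -> C) (p q p' q' : R) :
  p <= p' -> q' <= q -> lifted1 F g p q phi -> lifted1 F g p' q' phi.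
Proof.
  intros Hp Hq L t Ht. destruct (L t) as [P [r [d [Hd [HP HP']]]]]; [lra|].
  exists P, r, d. repeat split; auto; apply HP'; auto; lra.
Qed.

Lemma lifted1_ext (F : C -> C) (g h phi : R -> C) (p q : R) :
  (forall t, p <= t <= q -> g t = h t) -> lifted1 F g p q phi -> lifted1 F h p q phi.
Proof.
  intros E L t Ht. destruct (L t Ht) as [P [r [d [Hd [HP HP']]]]].
  rewrite E in HP by auto.
  exists P, r, d. split; auto. split; auto. intros t' Ht' Hd2. rewrite <- !E by auto. auto.
Qed.

Lemma lifted1_cont (F : C -> C) (g phi : R -> C) (p q t : R) :
  path_cont (fun t => p <= t <= q) g t -> lifted1 F g p q phi -> p <= t <= q ->
  path_cont (fun t => p <= t <= q) phi t.
Proof.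
  intros Hg L Ht eps He. destruct (L t Ht) as [P [r [d [Hd [HP HP']]]]].
  destruct (HP' t Ht (Rabs_diag_lt t d Hd)) as [Hr E].
  destruct (cdiff_cont P (g t)) with (eps := eps) as [d1 [Hd1 Hc]]; [exists (F (g t)); apply HP;
    auto|auto|].
  destruct (Hg d1 Hd1) as [d2 [Hd2 Hg']].
  exists (Rmin d d2). split; [apply Rmin_pos; auto|].
  intros t' Ht' Htt.
  destruct (HP' t' Ht') as [_ ->]; [eapply Rlt_le_trans; [exact Htt|apply Rmin_l]|].
  rewrite E. apply Hc, Hg'; auto. eapply Rlt_le_trans; [exact Htt|apply Rmin_r].
Qed.

Lemma lifted1_pderiv (F : C -> C) (g phi : R -> C) (p q t : R) (v : C) :
  lifted1 F g p q phi -> p < t < q -> pderiv g t v -> pderiv phi t (F (g t) * v).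
Proof.
  intros L Ht Hg eps He. destruct (L t) as [P [r [d [Hd [HP HP']]]]]; [lra|].
  destruct (HP' t) as [Hr E]; [lra|apply Rabs_diag_lt; auto|].
  assert (HPg : pderiv (fun s => P (g s)) t (F (g t) * v)) by (apply pderiv_comp; auto).
  destruct (HPg eps He) as [d' [Hd' H']].
  exists (Rmin (Rmin d d') (Rmin (t - p) (q - t))). split; [repeat apply Rmin_pos; lra|].
  intros t' Ht'.
  pose proof (Rmin_l (Rmin d d') (Rmin (t - p) (q - t))).
  pose proof (Rmin_r (Rmin d d') (Rmin (t - p) (q - t))).
  pose proof (Rmin_l d d'). pose proof (Rmin_r d d').
  pose proof (Rmin_l (t - p) (q - t)). pose proof (Rmin_r (t - p) (q - t)).
  apply Rabs_def2 in Ht' as Ht2.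
  destruct (HP' t') as [_ ->]; [lra|lra|]. rewrite E. apply H'. lra.
Qed.

Lemma lifted1_stationary (F : C -> C) (g phi : R -> C) (p q : R) : p <= q ->
  lifted1 F g p q phi -> (forall t, p <= t <= q -> g t = g p) -> phi q = phi p.
Proof.
  intros Hpq L Hg. apply locally_constant; auto. intros t Ht.
  destruct (L t Ht) as [P [r [d [Hd [HP HP']]]]]. exists d; split; auto. intros t' Ht' Hd'.
  destruct (HP' t' Ht' Hd') as [_ ->].
  destruct (HP' t Ht) as [_ ->]; [apply Rabs_diag_lt; auto|]. rewrite (Hg t'), (Hg t); auto.
Qed.

Lemma lifted1_unique (F : C -> C) (g phi psi : R -> C) (p q : R) : p <= q ->
  lifted1 F g p q phi -> lifted1 F g p q psi -> (phi q - phi p)%C = (psi q - psi p)%C.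
Proof.
  intros Hpq L L'.
  assert (H : (phi q - psi q)%C = (phi p - psi p)%C).
  { apply (locally_constant (fun t => phi t - psi t)%C); auto. intros t Ht.
    destruct (L t Ht) as [P [r [d [Hd [HP HP']]]]].
    destruct (L' t Ht) as [Q [r' [d' [Hd' [HQ HQ']]]]].
    exists (Rmin d d'). split; [apply Rmin_pos; auto|]. intros t' Ht' Htt.
    destruct (HP' t' Ht') as [A ->]; [eapply Rlt_le_trans; [exact Htt|apply Rmin_l]|].
    destruct (HQ' t' Ht') as [B ->]; [eapply Rlt_le_trans; [exact Htt|apply Rmin_r]|].
    destruct (HP' t Ht) as [_ ->]; [apply Rabs_diag_lt; auto|].
    destruct (HQ' t Ht) as [_ ->]; [apply Rabs_diag_lt; auto|].
    eapply loc_prim_diff; eauto. }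
  replace (phi q) with (phi q - psi q + psi q)%C by ring. rewrite H. ring.
Qed.

Lemma path_cont_minus (D : R -> Prop) (g h : R -> C) (t : R) :
  path_cont D g t -> path_cont D h t -> path_cont D (fun t => g t - h t)%C t.
Proof.
  intros Hg Hh eps He.
  destruct (Hg (eps / 2)) as [d [Hd Hd']]; [lra|].
  destruct (Hh (eps / 2)) as [e [He1 He']]; [lra|].
  exists (Rmin d e). split; [apply Rmin_pos; auto|]. intros t' Ht' Htt.
  pose proof (Rmin_l d e). pose proof (Rmin_r d e).
  specialize (Hd' t' Ht' ltac:(lra)). specialize (He' t' Ht' ltac:(lra)).
  replace (g t' - h t' - (g t - h t))%C with ((g t' - g t) - (h t' - h t))%C by ring.
  eapply Rle_lt_trans; [apply Cmod_triangle|]. rewrite Cmod_opp. lra.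
Qed.

Lemma path_cont_mult (D : R -> Prop) (g h : R -> C) (t : R) :
  path_cont D g t -> path_cont D h t -> path_cont D (fun t => g t * h t)%C t.
Proof.
  intros Hg Hh eps He.
  pose proof (Cmod_ge_0 (g t)) as Hg0. pose proof (Cmod_ge_0 (h t)) as Hh0.
  set (M := 1 + Cmod (g t) + Cmod (h t)).
  assert (HM : 1 <= M) by (unfold M; lra).
  assert (HeM : 0 < Rmin 1 (eps / (2 * M))) by (apply Rmin_pos; [lra|apply Rdiv_lt_0_compat; lra]).
  destruct (Hg _ HeM) as [d [Hd Hd']].
  destruct (Hh _ HeM) as [e [He1 He']].
  exists (Rmin d e). split; [apply Rmin_pos; auto|]. intros t' Ht' Htt.
  pose proof (Rmin_l d e). pose proof (Rmin_r d e).
  specialize (Hd' t' Ht' ltac:(lra)). specialize (He' t' Ht' ltac:(lra)).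
  pose proof (Rmin_l 1 (eps / (2 * M))). pose proof (Rmin_r 1 (eps / (2 * M))).
  eapply Rle_lt_trans; [apply (Cmod_sum _ ((g t' - g t) * (h t' - h t)) (g t *
    (h t' - h t) + h t * (g t' - g t))); ring|].
  eapply Rle_lt_trans; [apply Rplus_le_compat_l, Cmod_triangle|].
  rewrite !Cmod_mult.
  pose proof (Cmod_ge_0 (g t' - g t)). pose proof (Cmod_ge_0 (h t' - h t)).
  set (u := Cmod (g t' - g t)) in *. set (v := Cmod (h t' - h t)) in *.
  set (m := Rmin 1 (eps / (2 * M))) in *.
  assert (u * v <= 1 * m) by (apply Rmult_le_compat; lra).
  assert (Cmod (g t) * v <= Cmod (g t) * m) by (apply Rmult_le_compat_l; lra).
  assert (Cmod (h t) * u <= Cmod (h t) * m) by (apply Rmult_le_compat_l; lra).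
  apply Rle_lt_trans with (M * m); [unfold M; lra|].
  apply Rle_lt_trans with (M * (eps / (2 * M))); [apply Rmult_le_compat_l; lra|].
  replace (M * (eps / (2 * M))) with (eps / 2) by (field; lra). lra.
Qed.

Lemma continuous_on_path_cont (D : R -> Prop) (g : R -> C) (t : R) : D t ->
  continuous_on (T := R_UniformSpace) (U := C_UniformSpace) D g -> path_cont D g t.
Proof.
  intros Ht H eps He.
  assert (HP : locally (T:=C_UniformSpace) (g t) (fun z => Cmod (z - g t) < eps)).
  { apply locally_C_iff. exists eps; auto. }
  destruct (H t Ht _ HP) as [d Hd]. exists d; split; [apply cond_pos|].
  intros t' Ht' Htt. apply (Hd t' Htt Ht').
Qed.

Lemma continuous_on_cont2 (D : R -> R -> Prop) (H : R -> R -> C) (s t : R) : D s t ->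
  continuous_on (T := prod_UniformSpace R_UniformSpace R_UniformSpace) (U := C_UniformSpace)
    (fun p => D (fst p) (snd p)) (fun p => H (fst p) (snd p)) -> cont2 D H s t.
Proof.
  intros Hst Hc eps He.
  assert (HP : locally (T:=C_UniformSpace) (H s t) (fun z => Cmod (z - H s t) < eps)).
  { apply locally_C_iff. exists eps; auto. }
  destruct (Hc (s, t) Hst _ HP) as [d Hd]. exists d; split; [apply cond_pos|].
  intros s' t' Hst' Hs Ht. apply (Hd (s', t')); auto. split; auto.
Qed.

(** The integrand formed with the continuous derivative [D] has a primitive [J]; [phi] and [J] have
    the same derivative inside the interval and are continuous up to its ends, so their increments
    agree. *)
Lemma lifted1_RInt_C1 (F : C -> C) (g phi : R -> C) (p q : R) : p < q ->
  C1_on g p q -> (forall t, p <= t <= q -> cdiff F (g t)) -> lifted1 F g p q phi ->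
  is_RInt (V := C_R_NormedModule) (path_integrand F g) p q (phi q - phi p)%C.
Proof.
  intros Hpq [Hg [D [HD HgD]]] HF L.
  assert (Hgc : forall t, p <= t <= q -> path_cont (fun t => p <= t <= q) g t).
  { intros t Ht. apply continuous_on_path_cont; auto. }
  assert (HFg : forall t, p <= t <= q -> path_cont (fun t => p <= t <= q) (fun t => F (g t)) t).
  { intros t Ht eps He. destruct (cdiff_cont F (g t) (HF t Ht) eps He) as [d [Hd Hc]].
    destruct (Hgc t Ht d Hd) as [d' [Hd' Hc']]. exists d'; split; auto. }
  assert (HFc : forall t, continuous (T := R_UniformSpace) (U := C_R_NormedModule)
    (fun t => F (g (clamp p q t)) * D t)%C t).
  { intros t.
    assert (H1 : continuous (T := R_UniformSpace) (U := C_R_NormedModule) (fun t => F (g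
      (clamp p q t))) t).
    { apply path_cont_continuous. apply (clamp_cont (fun t => F (g t))); auto; lra. }
    specialize (HD t).
    apply path_cont_continuous. apply path_cont_continuous in H1. apply path_cont_continuous in HD.
    apply path_cont_mult; auto. }
  destruct (primitive_exists (fun t => F (g (clamp p q t)) * D t)%C) as [J HJ].
  { intros t. apply path_cont_continuous; auto. }
  assert (E : (phi q - phi p)%C = (J q - J p)%C).
  { apply Cmod_sub_eq0.
    replace (phi q - phi p - (J q - J p))%C with ((phi q - J q) - (phi p - J p))%C by ring.
    assert (Hcont : forall t, p <= t <= q -> path_cont (fun t => p <= t <=
      q) (fun t => phi t - J t)%C t).
    { intros t Ht. apply path_cont_minus.
      - eapply lifted1_cont; eauto.
      - eapply pderiv_cont; eauto. }
    apply (increment_closure (fun t => phi t - J t)%C); try lra; [apply Hcont; lra..|].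
    intros x y Hx Hxy Hy.
    rewrite (constant_of_pderiv_0 (fun t => phi t - J t)%C x y); [rewrite Cmod_diag; lra|lra|].
    intros t Ht. replace (RtoC 0) with (F (g t) * D t - F (g t) * D t)%C by ring.
    apply pderiv_minus.
    - apply (lifted1_pderiv F g phi p q); auto; [lra|]. apply pderiv_is_derive, HgD; lra.
    - specialize (HJ t). cbv beta in HJ. rewrite clamp_id in HJ by lra. auto. }
  rewrite E.
  (* At [p] and [q] the value of [curve_deriv g] is not controlled; agreement in the open interval
     is enough. *)
  apply is_RInt_ext with (f := fun t => (F (g (clamp p q t)) * D t)%C).
  - rewrite Rmin_left, Rmax_right by lra. intros t Ht. rewrite clamp_id by lra.
    unfold path_integrand. rewrite (pderiv_curve_deriv g t (D t)); auto.
    apply pderiv_is_derive, HgD; lra.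
  - apply (is_RInt_derive (V := C_R_CompleteNormedModule) J (fun t => F (g
      (clamp p q t)) * D t)%C p q).
    + intros t _. apply pderiv_is_derive; auto.
    + intros t _. apply HFc.
Qed.

Lemma piecewise_C1_lt (g : R -> C) (p q : R) : piecewise_C1 g p q -> p < q.
Proof. induction 1; lra. Qed.

Lemma piecewise_C1_cont (g : R -> C) (p q : R) : piecewise_C1 g p q ->
  forall t, p <= t <= q -> path_cont (fun t => p <= t <= q) g t.
Proof.
  induction 1 as [p q Hpq [Hg _]|p q r H1 IH1 H2 IH2].
  - intros t Ht. apply continuous_on_path_cont; auto.
  - apply piecewise_C1_lt in H1. apply piecewise_C1_lt in H2. intros t Ht eps He.
    destruct (Rtotal_order t q) as [Hlt|[->|Hgt]].
    + destruct (IH1 t) with (eps := eps) as [d [Hd Hd']]; [lra|auto|].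
      exists (Rmin d (q - t)). split; [apply Rmin_pos; lra|]. intros t' Ht' Htt.
      pose proof (Rmin_l d (q - t)). pose proof (Rmin_r d (q - t)).
      apply Rabs_def2 in Htt as Htt2. apply Hd'; lra.
    + destruct (IH1 q) with (eps := eps) as [d [Hd Hd']]; [lra|auto|].
      destruct (IH2 q) with (eps := eps) as [e [He' He'']]; [lra|auto|].
      exists (Rmin d e). split; [apply Rmin_pos; lra|]. intros t' Ht' Htt.
      pose proof (Rmin_l d e). pose proof (Rmin_r d e).
      destruct (Rle_dec t' q); [apply Hd'; lra|apply He''; lra].
    + destruct (IH2 t) with (eps := eps) as [d [Hd Hd']]; [lra|auto|].
      exists (Rmin d (t - q)). split; [apply Rmin_pos; lra|]. intros t' Ht' Htt.
      pose proof (Rmin_l d (t - q)). pose proof (Rmin_r d (t - q)).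
      apply Rabs_def2 in Htt as Htt2. apply Hd'; lra.
Qed.

Lemma lifted1_RInt (F : C -> C) (g : R -> C) (p q : R) : piecewise_C1 g p q ->
  forall phi, (forall t, p <= t <= q -> cdiff F (g t)) -> lifted1 F g p q phi ->
  is_RInt (V := C_R_NormedModule) (path_integrand F g) p q (phi q - phi p)%C.
Proof.
  induction 1 as [p q Hpq Hg|p q r H1 IH1 H2 IH2]; intros phi HF L.
  - apply lifted1_RInt_C1; auto.
  - apply piecewise_C1_lt in H1. apply piecewise_C1_lt in H2.
    replace (phi r - phi p)%C with ((phi q - phi p) + (phi r - phi q))%C by ring.
    apply (is_RInt_Chasles (V := C_R_NormedModule) _ p q r).
    + apply IH1; [intros; apply HF; lra|eapply lifted1_sub; [| |exact L]; lra].
    + apply IH2; [intros; apply HF; lra|eapply lifted1_sub; [| |exact L]; lra].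
Qed.

(** * Riemann integrals of functions agreeing on a dense set *)

(** Integrability lets the tags of the Riemann sums be chosen freely. Placing every tag at a zero of
    [h] makes all the sums vanish, with no continuity of [h]. *)
Lemma is_RInt_dense_zero (h : R -> C) (a b : R) (l : C) : a < b ->
  is_RInt (V := C_R_NormedModule) h a b l ->
  (forall x y, a <= x -> x < y -> y <= b -> exists z, x <= z <= y /\ h z = 0) -> l = 0.
Proof.
  intros Hab Hl Hz.
  (* The tag function must select a point of every interval, also of those outside [[a, b]]; there
     the left end is an arbitrary default. *)
  assert (Htag : exists f : R -> R -> R, (forall x y, x <= y -> x <= f x y <= y) /\
    forall x y, a <= x -> x < y -> y <= b -> h (f x y) = 0).
  { exists (fun x y => epsilon (inhabits x) (fun z => (x <= y -> x <= z <= y) /\ (a <= x ->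
      x < y -> y <= b -> h z = 0))).
    assert (Hs : forall x y, let z := epsilon (inhabits x) (fun z => (x <= y -> x <= z <= y) /\
      (a <= x -> x < y -> y <= b -> h z = 0)) in (x <= y -> x <= z <= y) /\ (a <= x -> x < y ->
        y <= b -> h z = 0)).
    { intros x y z.
      apply (epsilon_spec (inhabits x) (fun z => (x <= y -> x <= z <= y) /\ (a <= x -> x < y ->
        y <= b -> h z = 0))).
      destruct (classic (a <= x /\ x < y /\ y <= b)) as [[A [B C0]]|N].
      - destruct (Hz x y A B C0) as [w [Hw Hw']]. exists w; auto.
      - exists x. split; [lra|]. intros; exfalso; apply N; auto. }
    split; intros; apply Hs; auto. }
  destruct Htag as [f [Hf Hf0]].
  apply Cmod_eq_0. apply Rle_antisym; [|apply Cmod_ge_0]. apply Rnot_lt_le. intros Hlt.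
  assert (HP : locally (T:=C_UniformSpace) l (fun z => Cmod (z - l) < Cmod l)).
  { apply locally_C_iff. exists (Cmod l); auto. }
  destruct (Hl _ HP) as [d Hd].
  destruct (seq_step_unif_part_ex a b d) as [n Hn].
  set (ptd := SF_seq_f2 f (unif_part a b n)).
  destruct (Riemann_fine_unif_part f a b n Hf (Rlt_le _ _ Hab)) as [_ [G2 [G3 G4]]].
  assert (HS : Riemann_sum (V := C_R_NormedModule) h ptd = zero).
  (* The left end is generalized because removing the first point of a uniform partition leaves a
     uniform partition of a shorter interval with the same right end. *)
  { unfold ptd. enough (H : forall x, a <= x < b ->
      Riemann_sum (V := C_R_NormedModule) h (SF_seq_f2 f (unif_part x b n)) = zero) by (apply H;
        lra).
    clear - Hf0. induction n as [|n IH]; intros x Hx.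
    - assert (E : unif_part x b 0 = x :: b :: nil).
      { unfold unif_part, seq.mkseq; simpl. f_equal; [field|f_equal; field]. }
      rewrite E, !SF_cons_f2 by (simpl; lia). rewrite Riemann_sum_cons. simpl.
      rewrite Hf0 by lra. rewrite (scal_zero_r (V := C_R_NormedModule)), plus_zero_l. reflexivity.
    - rewrite unif_part_S, SF_cons_f2 by (simpl; lia). rewrite Riemann_sum_cons, head_unif_part.
      cbv beta iota delta [snd].
      assert (Hy : x < (x * INR (S n) + b) / INR (S (S n)) < b).
      { rewrite (S_INR (S n)). assert (0 < INR (S n)) by (apply lt_0_INR; lia).
        assert (x * INR (S n) < b * INR (S n)) by (apply Rmult_lt_compat_r; lra).
        split; apply (Rmult_lt_reg_r (INR (S n) + 1)); try lra;
        unfold Rdiv; rewrite Rmult_assoc, Rinv_l by lra; lra. }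
      set (y := (x * INR (S n) + b) / INR (S (S n))) in *. destruct Hx, Hy.
      rewrite Hf0 by lra. rewrite IH by lra.
      rewrite (scal_zero_r (V := C_R_NormedModule)), plus_zero_l. reflexivity. }
  specialize (Hd ptd). simpl in Hd.
  rewrite HS in Hd.
  assert (Hfin : Cmod (scal (V := C_R_NormedModule) (sign (b - a)) zero - l) < Cmod l).
  { apply Hd.
    - unfold ptd. rewrite SF_lx_f2; [exact Hn|]. simpl. lia.
    - rewrite Rmin_left, Rmax_right by lra. auto. }
  rewrite (scal_zero_r (V := C_R_NormedModule)) in Hfin.
  change (Cmod (RtoC 0 - l) < Cmod l) in Hfin.
  replace (0 - l)%C with (- l)%C in Hfin by ring.
  rewrite Cmod_opp in Hfin. lra.
Qed.

(** * Deformation of contours *)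

Definition small_transversal (F : C -> C) (H : R -> R -> C) (eps t : R) : Prop :=
  exists T, is_RInt (V := C_R_NormedModule) (path_integrand F (fun s => H s t)) 0 1 T /\
    Cmod T < eps.

Lemma at_right_0_iff (P : R -> Prop) :
  at_right 0 P <-> exists d, 0 < d /\ forall u, 0 < u < d -> P u.
Proof.
  split.
  - intros [d Hd]. exists d; split; [apply cond_pos|]. intros u Hu. apply Hd; [|lra].
    change (Rabs (u - 0) < d). rewrite Rabs_pos_eq; lra.
  - intros [d [Hd H]]. exists (mkposreal d Hd). intros u Hu Hu0. change (Rabs (u - 0) < d) in Hu.
    apply H. rewrite Rabs_pos_eq in Hu; lra.
Qed.

Lemma at_left_1_iff (P : R -> Prop) :
  at_left 1 P <-> exists d, 0 < d /\ forall u, 1 - d < u < 1 -> P u.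
Proof.
  split.
  - intros [d Hd]. exists d; split; [apply cond_pos|]. intros u Hu. apply Hd; [|lra].
    change (Rabs (u - 1) < d). rewrite Rabs_left; lra.
  - intros [d [Hd H]]. exists (mkposreal d Hd). intros u Hu Hu0. change (Rabs (u - 1) < d) in Hu.
    apply H. rewrite Rabs_left in Hu; lra.
Qed.

(** Contour integrals are improper even at a closed end, so a cut-off strictly inside is needed at
    which [tau] is almost its boundary value. Staying below 1/2 keeps it to the left of the cut-off
    from [pick_right]. *)
Lemma pick_left (tau : R -> C) (Q1 : R -> Prop) (Q eps : R) :
  at_right 0 Q1 -> 1 / 2 < Q -> 0 < eps ->
  path_cont (fun t => 0 <= t <= Q) tau 0 ->
  exists p, 0 < p < 1 / 2 /\ Q1 p /\ Cmod (tau p - tau 0) < eps.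
Proof.
  intros H1 HQ He Hc. apply at_right_0_iff in H1. destruct H1 as [d [Hd H1]].
  destruct (Hc eps He) as [e [He' Hc']].
  pose proof (Rmin_l (Rmin d e) (1 / 2)). pose proof (Rmin_r (Rmin d e) (1 / 2)).
  pose proof (Rmin_l d e). pose proof (Rmin_r d e).
  assert (0 < Rmin (Rmin d e) (1 / 2)) by (repeat apply Rmin_pos; lra).
  exists (Rmin (Rmin d e) (1 / 2) / 2). split; [lra|]. split; [apply H1; lra|].
  apply Hc'; [lra|]. rewrite Rabs_pos_eq; lra.
Qed.

Lemma pick_right (tau : R -> C) (Q2 : R -> Prop) (P eps : R) :
  at_left 1 Q2 -> P < 1 / 2 -> 0 < eps ->
  path_cont (fun t => P <= t <= 1) tau 1 ->
  exists q, 1 / 2 < q < 1 /\ Q2 q /\ Cmod (tau q - tau 1) < eps.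
Proof.
  intros H1 HQ He Hc. apply at_left_1_iff in H1. destruct H1 as [d [Hd H1]].
  destruct (Hc eps He) as [e [He' Hc']].
  pose proof (Rmin_l (Rmin d e) (1 / 2)). pose proof (Rmin_r (Rmin d e) (1 / 2)).
  pose proof (Rmin_l d e). pose proof (Rmin_r d e).
  assert (0 < Rmin (Rmin d e) (1 / 2)) by (repeat apply Rmin_pos; lra).
  exists (1 - Rmin (Rmin d e) (1 / 2) / 2). split; [lra|]. split; [apply H1; lra|].
  apply Hc'; [lra|]. rewrite Rabs_left; lra.
Qed.

(** The difference [Phi 1 t - Phi 0 t] stands for the integral of [F] along the transversal at [t],
    also where that transversal is merely continuous. *)
Lemma lifted_transversal_cont (F : C -> C) (H Phi : R -> R -> C) (P Q t : R) :
  P <= t <= Q ->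
  (forall s t, rect 0 1 P Q s t -> cont2 (rect 0 1 P Q) H s t) ->
  lifted F H 0 1 P Q Phi ->
  path_cont (fun t => P <= t <= Q) (fun t => Phi 1 t - Phi 0 t)%C t.
Proof.
  intros Ht Hc L.
  assert (Hs : forall s, 0 <= s <= 1 -> path_cont (fun t => P <= t <= Q) (fun t => Phi s t) t).
  { intros s Hs. apply (lifted1_cont F (fun t => H s t) _ P Q); auto.
    - intros eps He. destruct (Hc s t (conj Hs Ht) eps He) as [d [Hd H']].
      exists d; split; auto. intros t' Ht' Hd'.
      apply H'; [split; auto|apply Rabs_diag_lt; auto|auto].
    - apply (lifted_slice_s F H 0 1); auto. }
  apply path_cont_minus; apply Hs; lra.
Qed.

Lemma small_transversal_lift (F : C -> C) (H Phi : R -> R -> C) (P Q t eps : R) :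
  P <= t <= Q -> lifted F H 0 1 P Q Phi ->
  (forall s, 0 <= s <= 1 -> cdiff F (H s t)) ->
  piecewise_C1 (fun s => H s t) 0 1 -> small_transversal F H eps t ->
  Cmod (Phi 1 t - Phi 0 t) < eps.
Proof.
  intros Ht L HF Hp [T [HT HTe]].
  assert (L1 := lifted_slice_t F H 0 1 P Q t Phi L Ht).
  assert (HR := lifted1_RInt F (fun s => H s t) 0 1 Hp (fun s => Phi s t) HF L1).
  apply (is_RInt_unique (V := C_R_CompleteNormedModule)) in HR.
  apply (is_RInt_unique (V := C_R_CompleteNormedModule)) in HT.
  simpl in HR. rewrite <- HR, HT. auto.
Qed.

(** Between cut-offs p < q, the increments of the lift along the two contours differ by the
    transversal integrals at [p] and [q]. Near the ends these cancel for a loop, are close to zero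
    at a fixed boundary point, and are small by assumption at an open end. The bound [B] is required
    of lifts along [g'], so no convergence of the integral over [g'] has to be known. *)
Lemma deformation_bound (ct : curve_type) (F : C -> C) (H : R -> R -> C) (g g' : R -> C)
    (I : C) (B : R) :
  continuous_on (T := prod_UniformSpace R_UniformSpace R_UniformSpace) (U := C_UniformSpace)
    (fun p => 0 <= fst p <= 1 /\ dom ct (snd p)) (fun p => H (fst p) (snd p)) ->
  (forall t, dom ct t -> H 0 t = g t /\ H 1 t = g' t) ->
  (forall s t, 0 <= s <= 1 -> dom ct t -> holo_at F (H s t)) ->
  (ct = loop -> forall s, 0 <= s <= 1 -> H s 0 = H s 1) ->
  (left_boundary ct -> forall s, 0 <= s <= 1 -> H s 0 = g 0) ->
  (right_boundary ct -> forall s, 0 <= s <= 1 -> H s 1 = g 1) ->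
  (left_open ct -> at_right 0 (fun t => piecewise_C1 (fun s => H s t) 0 1) /\
     forall eps, 0 < eps -> at_right 0 (small_transversal F H eps)) ->
  (right_open ct -> at_left 1 (fun t => piecewise_C1 (fun s => H s t) 0 1) /\
     forall eps, 0 < eps -> at_left 1 (small_transversal F H eps)) ->
  (forall p q, dom ct p -> dom ct q -> p < q -> piecewise_C1 g p q) ->
  is_RInt_gen (V := C_R_NormedModule) (path_integrand F g) (at_right 0) (at_left 1) I ->
  (forall p q phi, 0 < p -> p < q -> q < 1 -> lifted1 F g' p q phi -> Cmod (phi q - phi p) <= B) ->
  Cmod I <= B.
Proof.
  intros Hc Hends Hholo Hloop Hlb Hrb Hlo Hro Hg HI HB.
  apply Rle_plus_epsilon. intros eps He.
  assert (Hloc : locally (T := C_UniformSpace) I (fun z => Cmod (z - I) < eps / 4)).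
  { apply locally_C_iff. exists (eps / 4); split; [lra|auto]. }
  destruct (HI _ Hloc) as [Q1 Q2 HQ1 HQ2 HQ]. simpl in HQ.
  assert (Hdom : forall p q t, dom ct p -> dom ct q -> p <= t <= q -> dom ct t).
  { intros p q t. destruct ct as [|[] []]; simpl; lra. }
  assert (Hlift : forall P Q, dom ct P -> dom ct Q -> P <= Q ->
    (forall s t, rect 0 1 P Q s t -> cont2 (rect 0 1 P Q) H s t) /\
    exists Phi, lifted F H 0 1 P Q Phi).
  { intros P Q HP HQ' HPQ.
    assert (Hc2 : forall s t, rect 0 1 P Q s t -> cont2 (rect 0 1 P Q) H s t).
    { intros s t [Hs Ht] e He'.
      assert (Hst : cont2 (fun s t => 0 <= s <= 1 /\ dom ct t) H s t).
      { apply continuous_on_cont2; [split; auto; apply (Hdom P Q); auto|exact Hc]. }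
      destruct (Hst e He') as [d [Hd H']]. exists d; split; auto.
      intros s' t' [Hs' Ht']. apply H'. split; auto. apply (Hdom P Q); auto. }
    split; auto. apply lift_exists; auto; [lra|].
    intros s t [Hs Ht]. apply holo_at_cdiff. apply Hholo; auto. apply (Hdom P Q); auto. }
  assert (Hcd : forall s t, 0 <= s <= 1 -> dom ct t -> cdiff F (H s t)).
  { intros s t Hs Ht. specialize (Hholo s t Hs Ht). apply holo_at_cdiff in Hholo.
    destruct Hholo as [d [Hd H']]. apply H'. rewrite Cmod_diag; auto. }
  assert (Hmain : exists P Q p q Phi, dom ct P /\ dom ct Q /\ P <= p /\ q <= Q /\
    0 < p < 1 / 2 /\ 1 / 2 < q < 1 /\
    Q1 p /\ Q2 q /\ lifted F H 0 1 P Q Phi /\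
    Cmod ((Phi 1 q - Phi 0 q) - (Phi 1 p - Phi 0 p)) < eps / 2).
  { destruct ct as [|l r].
    - destruct (Hlift 0 1) as [Hc2 [Phi L]]; [simpl; lra..|].
      destruct (pick_left (fun t => Phi 1 t - Phi 0 t)%C Q1 1 (eps / 4)) as [p [Hp [Hp1 Hp2]]];
        auto; [lra..| |].
      { apply (lifted_transversal_cont F H Phi); auto; lra. }
      destruct (pick_right (fun t => Phi 1 t - Phi 0 t)%C Q2 0 (eps / 4)) as [q [Hq [Hq1 Hq2]]];
        auto; [lra..| |].
      { apply (lifted_transversal_cont F H Phi); auto; lra. }
      (* For a loop the transversals at 0 and at 1 are the same path, and increments of lifts along
         one path are unique. *)
      assert (E : (Phi 1 1 - Phi 0 1)%C = (Phi 1 0 - Phi 0 0)%C).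
      { apply (lifted1_unique F (fun s => H s 0) (fun s => Phi s 1) (fun s => Phi s 0) 0 1);
          [lra| |].
        - apply (lifted1_ext F (fun s => H s 1)); [intros; symmetry; apply Hloop; auto|].
          apply (lifted_slice_t F H 0 1 0 1 1 Phi); auto; lra.
        - apply (lifted_slice_t F H 0 1 0 1 0 Phi); auto; lra. }
      exists 0, 1, p, q, Phi. simpl. repeat (split; [lra || auto|]).
      eapply Rle_lt_trans; [apply (Cmod_sum _ ((Phi 1 q - Phi 0 q) - (Phi 1 1 - Phi 0 1))
        (-((Phi 1 p - Phi 0 p) - (Phi 1 0 - Phi 0 0)))); rewrite E; ring|].
      rewrite Cmod_opp. lra.
    (* The two ends are treated independently, while the lift exists only once both [P] and [Q] are
       fixed. Hence the left end is prepared for every possible [Q] and [Phi]. *)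
    - assert (HL : exists P, dom (arc l r) P /\ 0 <= P < 1 / 2 /\ forall Q Phi, 1 / 2 < Q ->
        dom (arc l r) Q ->
        lifted F H 0 1 P Q Phi -> exists p, P <= p /\ 0 < p < 1 / 2 /\ Q1 p /\
          Cmod (Phi 1 p - Phi 0 p) < eps / 4).
      { destruct l.
        - exists 0. split; [simpl; destruct r; lra|]. split; [lra|]. intros Q Phi HQ' HdQ L.
          destruct (Hlift 0 Q) as [Hc2 _]; [simpl; destruct r; lra|auto|lra|].
          destruct (pick_left (fun t => Phi 1 t - Phi 0 t)%C Q1 Q
            (eps / 4)) as [p [Hp [Hp1 Hp2]]]; auto; [lra..| |].
          { apply (lifted_transversal_cont F H Phi); auto; lra. }
          exists p. split; [lra|]. split; auto. split; auto.
          replace (Phi 1 p - Phi 0 p)%C with (Phi 1 p - Phi 0 p - (Phi 1 0 - Phi 0 0))%C; auto.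
          assert (E : Phi 1 0 = Phi 0 0).
          { apply (lifted1_stationary F (fun s => H s 0) (fun s => Phi s 0) 0 1); [lra| |].
            - apply (lifted_slice_t F H 0 1 0 Q 0 Phi); auto; lra.
            - intros t Ht. rewrite !Hlb; auto; try (exists r; auto); lra. }
          rewrite E. ring.
        - destruct Hlo as [Ha Hb]; [exists r; auto|]. specialize (Hb (eps / 4) ltac:(lra)).
          apply at_right_0_iff in Ha. apply at_right_0_iff in Hb. apply at_right_0_iff in HQ1.
          destruct Ha as [d1 [Hd1 Ha]]. destruct Hb as [d2 [Hd2 Hb]].
          destruct HQ1 as [d3 [Hd3 HQ1]].
          set (m := Rmin (Rmin d1 d2) (Rmin d3 (1 / 2))).
          assert (Hm : 0 < m) by (unfold m; repeat apply Rmin_pos; lra).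
          assert (Hm1 : m <= d1 /\ m <= d2 /\ m <= d3 /\ m <= 1 / 2).
          { unfold m. pose proof (Rmin_l (Rmin d1 d2) (Rmin d3 (1 / 2))).
            pose proof (Rmin_r (Rmin d1 d2) (Rmin d3 (1 / 2))).
            pose proof (Rmin_l d1 d2). pose proof (Rmin_r d1 d2). pose proof (Rmin_l d3 (1 / 2)).
            pose proof (Rmin_r d3 (1 / 2)). lra. }
          assert (Hdm : dom (arc false r) (m / 2)) by (simpl; destruct r; lra).
          exists (m / 2). split; auto. split; [lra|]. intros Q Phi HQ' HdQ L.
          exists (m / 2). split; [lra|]. split; [lra|]. split; [apply HQ1; lra|].
          apply (small_transversal_lift F H Phi (m / 2) Q); auto; [lra|apply Ha; lra|apply Hb; lra].
          }
      assert (HR : exists Q, dom (arc l r) Q /\ 1 / 2 < Q <= 1 /\ forall P Phi, P < 1 / 2 ->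
        dom (arc l r) P ->
        lifted F H 0 1 P Q Phi -> exists q, q <= Q /\ 1 / 2 < q < 1 /\ Q2 q /\
          Cmod (Phi 1 q - Phi 0 q) < eps / 4).
      { destruct r.
        - exists 1. split; [simpl; destruct l; lra|]. split; [lra|]. intros P Phi HP' HdP L.
          destruct (Hlift P 1) as [Hc2 _]; [auto|simpl; destruct l; lra|lra|].
          destruct (pick_right (fun t => Phi 1 t - Phi 0 t)%C Q2 P
            (eps / 4)) as [q [Hq [Hq1 Hq2]]]; auto; [lra..| |].
          { apply (lifted_transversal_cont F H Phi); auto; lra. }
          exists q. split; [lra|]. split; auto. split; auto.
          replace (Phi 1 q - Phi 0 q)%C with (Phi 1 q - Phi 0 q - (Phi 1 1 - Phi 0 1))%C; auto.
          assert (E : Phi 1 1 = Phi 0 1).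
          { apply (lifted1_stationary F (fun s => H s 1) (fun s => Phi s 1) 0 1); [lra| |].
            - apply (lifted_slice_t F H 0 1 P 1 1 Phi); auto; lra.
            - intros t Ht. rewrite !Hrb; auto; try (exists l; auto); lra. }
          rewrite E. ring.
        - destruct Hro as [Ha Hb]; [exists l; auto|]. specialize (Hb (eps / 4) ltac:(lra)).
          apply at_left_1_iff in Ha. apply at_left_1_iff in Hb. apply at_left_1_iff in HQ2.
          destruct Ha as [d1 [Hd1 Ha]]. destruct Hb as [d2 [Hd2 Hb]].
          destruct HQ2 as [d3 [Hd3 HQ2]].
          set (m := Rmin (Rmin d1 d2) (Rmin d3 (1 / 2))).
          assert (Hm : 0 < m) by (unfold m; repeat apply Rmin_pos; lra).
          assert (Hm1 : m <= d1 /\ m <= d2 /\ m <= d3 /\ m <= 1 / 2).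
          { unfold m. pose proof (Rmin_l (Rmin d1 d2) (Rmin d3 (1 / 2))).
            pose proof (Rmin_r (Rmin d1 d2) (Rmin d3 (1 / 2))).
            pose proof (Rmin_l d1 d2). pose proof (Rmin_r d1 d2). pose proof (Rmin_l d3 (1 / 2)).
            pose proof (Rmin_r d3 (1 / 2)). lra. }
          assert (Hdm : dom (arc l false) (1 - m / 2)) by (simpl; destruct l; lra).
          exists (1 - m / 2). split; auto. split; [lra|]. intros P Phi HP' HdP L.
          exists (1 - m / 2). split; [lra|]. split; [lra|]. split; [apply HQ2; lra|].
          apply (small_transversal_lift F H Phi P (1 - m / 2)); auto; [lra|apply Ha;
            lra|apply Hb; lra]. }
      destruct HL as [P [HdP [HP HL]]]. destruct HR as [Q [HdQ [HQ' HR]]].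
      destruct (Hlift P Q) as [_ [Phi L]]; auto; [lra|].
      destruct (HL Q Phi) as [p [Hp1 [Hp2 [Hp3 Hp4]]]]; auto; [lra|].
      destruct (HR P Phi) as [q [Hq1 [Hq2 [Hq3 Hq4]]]]; auto; [lra|].
      exists P, Q, p, q, Phi. repeat (split; [lra || auto|]).
      eapply Rle_lt_trans; [apply Cmod_triangle|]. rewrite Cmod_opp. lra. }
  destruct Hmain as [P [Q [p [q [Phi [HdP [HdQ [HPp [HqQ [Hp [Hq [Hp1 [Hq1 [L Hsm]]]]]]]]]]]]]].
  destruct (HQ p q Hp1 Hq1) as [y [Hy HyI]].
  assert (Hdp : dom ct p) by (apply (Hdom P Q); auto; lra).
  assert (Hdq : dom ct q) by (apply (Hdom P Q); auto; lra).
  assert (L0 : lifted1 F g p q (fun t => Phi 0 t)).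
  { apply (lifted1_ext F (fun t => H 0 t)).
    - intros t Ht. apply Hends. apply (Hdom p q); auto.
    - apply (lifted1_sub F _ _ P Q); auto. apply (lifted_slice_s F H 0 1); auto; lra. }
  assert (L1 : lifted1 F g' p q (fun t => Phi 1 t)).
  { apply (lifted1_ext F (fun t => H 1 t)).
    - intros t Ht. apply Hends. apply (Hdom p q); auto.
    - apply (lifted1_sub F _ _ P Q); auto. apply (lifted_slice_s F H 0 1); auto; lra. }
  assert (HB1 := HB p q _ (proj1 Hp) ltac:(lra) (proj2 Hq) L1). cbv beta in HB1.
  assert (HR : is_RInt (V := C_R_NormedModule) (path_integrand F g) p q (Phi 0 q - Phi 0 p)%C).
  { apply (lifted1_RInt F g p q (Hg p q Hdp Hdq ltac:(lra)) (fun t => Phi 0 t)); auto.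
    intros t Ht. assert (Hdt : dom ct t) by (apply (Hdom p q); auto).
    rewrite <- (proj1 (Hends t Hdt)). apply Hcd; auto; lra. }
  apply (is_RInt_unique (V := C_R_CompleteNormedModule)) in HR.
  apply (is_RInt_unique (V := C_R_CompleteNormedModule)) in Hy.
  assert (Ey : y = (Phi 0 q - Phi 0 p)%C) by (rewrite <- Hy; exact HR).
  assert (Cmod y <= B + eps / 2).
  { rewrite Ey.
    eapply Rle_trans; [apply (Cmod_sum _ (Phi 1 q - Phi 1 p) (- (Phi 1 q - Phi 0 q -
      (Phi 1 p - Phi 0 p)))); ring|].
    rewrite Cmod_opp. lra. }
  assert (Cmod I <= Cmod y + Cmod (y - I)).
  { rewrite (Cmod_sub_sym y I). apply Cmod_sum; ring. }
  lra.
Qed.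

(** * Integration along arcs satisfying the angle condition *)

(** The primitive of [rho ^ l * exp (- delta * rho)] vanishing at infinity. *)
Fixpoint gamma_prim (delta : R) (l : nat) (rho : R) : R :=
  match l with
  | O => - exp (- delta * rho) / delta
  | S k => - (rho ^ S k * exp (- delta * rho)) / delta + INR (S k) / delta * gamma_prim delta k rho
  end.

Lemma gamma_prim_derive (delta : R) (l : nat) (rho : R) : 0 < delta ->
  is_derive (gamma_prim delta l) rho (rho ^ l * exp (- delta * rho)).
Proof.
  intros Hd. induction l as [|l IH].
  - simpl. auto_derive; [lra|]. field; lra.
  - set (e := exp (- delta * rho)) in *.
    replace (rho ^ S l * e) with
      (- (INR (S l) * rho ^ l * e - delta * (rho ^ S l * e)) / delta + INR (S l) / delta *
        (rho ^ l * e))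
      by (field; lra).
    apply (is_derive_plus (K:=R_AbsRing) (V:=R_NormedModule)
      (fun rho => - (rho ^ S l * exp (- delta * rho)) / delta)
      (fun rho => INR (S l) / delta * gamma_prim delta l rho)).
    + auto_derive; [auto|]. fold e. change (Init.Nat.pred (S l)) with l.
      change (rho ^ S l) with (rho * rho ^ l). rewrite S_INR. simpl.
      destruct l; simpl; field; lra.
    + apply is_derive_scal. exact IH.
Qed.

(** The value at 0 is minus the whole integral over [0, +oo), by recursion on [l], and the primitive
    increases from there; the upper bound follows from the signs in the recursion. *)
Lemma gamma_prim_range (delta : R) (l : nat) (rho : R) : 0 < delta -> 0 <= rho ->
  - (INR (fact l) / delta ^ S l) <= gamma_prim delta l rho <= 0.
Proof.
  intros Hd Hr. split.
  - replace (- (INR (fact l) / delta ^ S l)) with (gamma_prim delta l 0).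
    + assert (H : - gamma_prim delta l rho <= - gamma_prim delta l 0); [|lra].
      apply (increment_le_real (fun r => - gamma_prim delta l r) (fun r => - (r ^ l * exp
        (- delta * r))) 0 rho Hr).
      * intros t Ht. apply (is_derive_opp (K:=R_AbsRing) (V:=R_NormedModule)).
        apply gamma_prim_derive; auto.
      * intros t Ht. assert (0 <= t ^ l) by (apply pow_le; lra). pose proof (exp_pos (- delta * t)).
        nra.
    + induction l as [|l IH].
      * simpl. rewrite Rmult_0_r, exp_0. field; lra.
      * change (gamma_prim delta (S l) 0) with
          (- (0 ^ S l * exp (- delta * 0)) / delta + INR (S l) / delta * gamma_prim delta l 0).
        rewrite IH. change (fact (S l)) with (S l * fact l)%nat. rewrite mult_INR.
        rewrite (pow_i (S l)) by lia. simpl (delta ^ S (S l)). simpl (delta ^ S l). field.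
        split; [|lra]. apply pow_nonzero; lra.
  - induction l as [|l IH].
    + simpl. pose proof (exp_pos (- delta * rho)).
      assert (0 < exp (- delta * rho) / delta) by (apply Rdiv_lt_0_compat; auto).
      unfold Rdiv in *; lra.
    + change (gamma_prim delta (S l) rho) with
          (- (rho ^ S l * exp (- delta * rho)) / delta + INR
            (S l) / delta * gamma_prim delta l rho).
      assert (0 <= rho ^ S l) by (apply pow_le; lra). pose proof (exp_pos (- delta * rho)).
      assert (0 <= rho ^ S l * exp (- delta * rho) / delta) by (apply Rdiv_le_0_compat; [nra|auto]).
      assert (0 <= INR (S l) / delta) by (apply Rdiv_le_0_compat; [apply pos_INR|auto]).
      unfold Rdiv in *. nra.
Qed.

Definition cdot (z v : C) : R := fst z * fst v + snd z * snd v.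

Lemma pderiv_components (g : R -> C) (t : R) (v : C) : pderiv g t v ->
  is_derive (fun s => fst (g s)) t (fst v) /\ is_derive (fun s => snd (g s)) t (snd v).
Proof.
  intros H. assert (H1 := pderiv_dot g t v 1 H). assert (H2 := pderiv_dot g t v Ci H).
  simpl in H1, H2. split.
  - replace (fst v) with (1 * fst v + 0 * snd v) by ring. eapply is_derive_ext; [|exact H1].
    intros; simpl; ring.
  - replace (snd v) with (0 * fst v + 1 * snd v) by ring. eapply is_derive_ext; [|exact H2].
    intros; simpl; ring.
Qed.

Lemma Cmod_derive (g : R -> C) (t : R) (v : C) : pderiv g t v -> g t <> 0 ->
  is_derive (fun s => Cmod (g s)) t (cdot (g t) v / Cmod (g t)).
Proof.
  intros H H0. apply pderiv_components in H. destruct H as [H1 H2].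
  apply Cmod_gt_0 in H0.
  assert (Hgen : forall u w : R -> R, is_derive u t (fst v) -> is_derive w t (snd v) ->
    0 < sqrt (u t ^ 2 + w t ^ 2) ->
    is_derive (fun s => sqrt (u s ^ 2 + w s ^ 2)) t
      ((u t * fst v + w t * snd v) / sqrt (u t ^ 2 + w t ^ 2))).
  { intros u w Hu Hw Hp.
    assert (0 < u t ^ 2 + w t ^ 2) by (apply sqrt_lt_0_alt; rewrite sqrt_0; auto).
    auto_derive.
    - repeat split; try (eexists; eassumption). simpl in H. lra.
    - replace (Derive (fun x => u x) t) with (fst v) by (symmetry; apply is_derive_unique; auto).
      replace (Derive (fun x => w x) t) with (snd v) by (symmetry; apply is_derive_unique; auto).
      simpl in *. field. lra. }
  apply (Hgen (fun s => fst (g s)) (fun s => snd (g s))); auto.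
Qed.

Lemma arc_increment (F : C -> C) (g phi : R -> C) (p q A b delta : R) (l : nat) :
  p <= q -> C1_on g p q -> lifted1 F g p q phi -> 0 < b -> 0 < delta -> 0 <= A ->
  (forall t, p < t < q -> g t <> 0 /\ curve_deriv g t <> 0 /\
     b <= Rabs (cos_angle (g t) (curve_deriv g t)) /\
     Cmod (F (g t)) <= A * (Cmod (g t) ^ l * exp (- delta * Cmod (g t)))) ->
  Cmod (phi q - phi p) <= A / b * (INR (fact l) / delta ^ S l).
Proof.
  intros Hpq [Hg [D [HD HgD]]] L Hb Hdelta HA HF.
  assert (Hgc : forall t, p <= t <= q -> path_cont (fun t => p <= t <= q) g t).
  { intros t Ht. apply continuous_on_path_cont; auto. }
  assert (HgD' : forall t, p < t < q -> pderiv g t (D t)).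
  { intros; apply pderiv_is_derive; auto. }
  assert (HAb : 0 <= A / b) by (apply Rdiv_le_0_compat; auto).
  assert (Hfd : 0 <= INR (fact l) / delta ^ S l).
  { apply Rdiv_le_0_compat; [apply pos_INR|]. apply pow_lt; auto. }
  apply increment_closure; auto.
  { apply Rmult_le_pos; auto. }
  { eapply lifted1_cont; eauto; [apply Hgc|]; lra. }
  { eapply lifted1_cont; eauto; [apply Hgc|]; lra. }
  intros x y Hx Hxy Hy.
  (* A vanishing scalar product would make the cosine zero, against the lower bound [b]. *)
  assert (Hne : forall t, x <= t <= y -> cdot (g t) (D t) <> 0).
  { intros t Ht E. destruct (HF t) as [H0 [H1 [H2 _]]]; [lra|].
    rewrite (pderiv_curve_deriv g t (D t)) in H2 by (apply HgD'; lra).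
    unfold cos_angle in H2. unfold cdot in E. rewrite E in H2.
    unfold Rdiv in H2. rewrite Rmult_0_l, Rabs_R0 in H2. lra. }
  assert (Hcont : forall t, x <= t <= y -> continuity_pt (fun t => cdot (g t) (D t)) t).
  { intros t Ht. apply continuity_pt_filterlim. unfold cdot.
    destruct (pderiv_components g t (D t)) as [H1 H2]; [apply HgD'; lra|].
    assert (H3 : continuous (fun s => fst (D s)) t).
    { apply (continuous_comp (V := C_UniformSpace) D fst); [apply HD|]. apply continuous_fst. }
    assert (H4 : continuous (fun s => snd (D s)) t).
    { apply (continuous_comp (V := C_UniformSpace) D snd); [apply HD|]. apply continuous_snd. }
    apply (continuous_plus (V := R_NormedModule) (fun t => fst (g t) * fst (D t)) (fun t => snd
      (g t) * snd (D t)));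
    apply (continuous_mult (K := R_AbsRing)); auto;
    apply (ex_derive_continuous (K := R_AbsRing) (V := R_NormedModule)); eexists; eassumption. }
  (* By the intermediate value theorem the nonvanishing continuous scalar product keeps its sign,
     which is the sign of the derivative of |g|. *)
  assert (Hsign : exists sg, (sg = 1 \/ sg = -1) /\ forall t, x <= t <= y ->
    0 < sg * cdot (g t) (D t)).
  { assert (Hivt : forall sg u w, (sg = 1 \/ sg = -1) -> x <= u <= y -> x <= w <= y -> u < w ->
      sg * cdot (g u) (D u) < 0 -> sg * cdot (g w) (D w) > 0 -> False).
    { intros sg u w Hsg Hu Hw Huw H1 H2.
      destruct (Ranalysis5.IVT_interv (fun t => sg * cdot (g t) (D t)) u w) as [z [Hz Ez]]; auto.
      - intros a Ha. apply (continuity_pt_scal (fun t => cdot (g t) (D t))). apply Hcont; lra.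
      - apply (Hne z); [lra|]. destruct Hsg; subst sg; lra. }
    destruct (Rlt_dec 0 (cdot (g x) (D x))) as [Hp|Hn].
    - exists 1. split; auto. intros t Ht.
      destruct (Rtotal_order 0 (cdot (g t) (D t))) as [H1|[H1|H1]]; [lra|exfalso;
        apply (Hne t Ht); auto|].
      exfalso. destruct (Req_dec x t) as [->|]; [lra|].
      apply (Hivt (-1) x t); try lra; auto.
    - exists (-1). split; auto. assert (Hx0 := Hne x ltac:(lra)). intros t Ht.
      destruct (Rtotal_order 0 (cdot (g t) (D t))) as [H1|[H1|H1]]; [|exfalso; apply (Hne t Ht);
        auto|lra].
      exfalso. destruct (Req_dec x t) as [->|]; [lra|].
      apply (Hivt 1 x t); try lra; auto. }
  destruct Hsign as [sg [Hsg Hpos]].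
  set (E := gamma_prim delta l).
  (* The angle condition reads b |D| <= sg d|g|/dt, so this comparison function grows at least as
     fast as |F(g) D|. *)
  apply Rle_trans with (A / b * sg * E (Cmod (g y)) - A / b * sg * E (Cmod (g x))).
  - apply (increment_bound phi (fun t => F (g t) * D t)%C (fun t => A / b * sg * E (Cmod (g t)))
      (fun t => A / b * sg * (cdot (g t) (D t) / Cmod (g t) * (Cmod (g t) ^ l * exp
        (- delta * Cmod (g t)))))); [lra| | |].
    + intros t Ht. apply (lifted1_pderiv F g phi p q); auto; [lra|]. apply HgD'; lra.
    + intros t Ht. apply is_derive_scal.
      apply (is_derive_comp (K := R_AbsRing) (V := R_NormedModule) E (fun t => Cmod (g t))).
      * apply gamma_prim_derive; auto.
      * apply Cmod_derive; [apply HgD'; lra|apply HF; lra].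
    + intros t Ht. destruct (HF t) as [H0 [H1 [H2 H3]]]; [lra|].
      rewrite (pderiv_curve_deriv g t (D t)) in H1, H2 by (apply HgD'; lra).
      rewrite Cmod_mult. apply Cmod_gt_0 in H0. apply Cmod_gt_0 in H1.
      specialize (Hpos t Ht). unfold cos_angle in H2. fold (cdot (g t) (D t)) in H2.
      set (r := Cmod (g t)) in *. set (m := Cmod (D t)) in *. set (c := cdot (g t) (D t)) in *.
      assert (Hc : b * (r * m) <= sg * c).
      { unfold Rdiv in H2. rewrite Rabs_mult, Rabs_inv, (Rabs_pos_eq (r * m)) in H2 by nra.
        apply (Rmult_le_compat_r (r * m)) in H2; [|nra]. rewrite Rmult_assoc, Rinv_l in H2 by nra.
        replace (sg * c) with (Rabs c); [lra|].
        unfold Rabs; destruct Rcase_abs; destruct Hsg; subst sg; lra. }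
      set (e := r ^ l * exp (- delta * r)) in *.
      assert (He : 0 <= e).
      { unfold e. apply Rmult_le_pos; [apply pow_le; lra|]. apply Rlt_le, exp_pos. }
      apply Rle_trans with (A * e * m); [apply Rmult_le_compat_r; lra|].
      replace (A / b * sg * (c / r * e)) with (A * e * (sg * c / (b * r))) by (field; lra).
      apply Rmult_le_compat_l; [nra|].
      apply (Rmult_le_reg_r (b * r)); [nra|]. unfold Rdiv. rewrite Rmult_assoc, Rinv_l by nra. nra.
  (* Both values of [E] lie in an interval of length l! / delta^(l+1), so the bound does not depend
     on whether the arc moves away from 0 or towards it. *)
  - replace (A / b * sg * E (Cmod (g y)) - A / b * sg * E (Cmod (g x))) with
      (A / b * (sg * (E (Cmod (g y)) - E (Cmod (g x))))) by ring.
    apply Rmult_le_compat_l; auto.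
    destruct (gamma_prim_range delta l (Cmod (g y)) Hdelta (Cmod_ge_0 _)).
    destruct (gamma_prim_range delta l (Cmod (g x)) Hdelta (Cmod_ge_0 _)).
    fold E in H, H0, H1, H2. destruct Hsg; subst sg; lra.
Qed.

Lemma smooth_segments_range (ct : curve_type) (d : nat) (tau : nat -> R) (g : R -> C) :
  smooth_segments ct d tau g -> forall j, (j <= d)%nat -> 0 <= tau j <= 1.
Proof.
  intros [H0 [H1 H]].
  assert (Hm : forall j k, (j + k <= d)%nat -> tau j <= tau (j + k)%nat).
  { intros j k. induction k as [|k IH]; intros Hk; [rewrite Nat.add_0_r; lra|].
    rewrite Nat.add_succ_r. destruct (H (j + k)%nat) as [Hlt _]; [lia|]. specialize (IH ltac:(lia)).
    lra. }
  intros j Hj. split.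
  - rewrite <- H0. apply (Hm O j); lia.
  - rewrite <- H1. specialize (Hm j (d - j)%nat ltac:(lia)).
    replace (j + (d - j))%nat with d in Hm by lia. auto.
Qed.

Lemma contour_bound (ct : curve_type) (d l : nat) (tau : nat -> R) (F : C -> C)
    (g : R -> C)
    (A b delta : R) :
  smooth_segments ct d tau g -> angle_condition d b tau g -> 0 < b -> 0 < delta -> 0 <= A ->
  (forall t, dom ct t -> g t <> 0 ->
     Cmod (F (g t)) <= A * (Cmod (g t) ^ l * exp (- delta * Cmod (g t)))) ->
  forall p q phi, 0 < p -> p < q -> q < 1 -> lifted1 F g p q phi ->
  Cmod (phi q - phi p) <= INR d * (A / b * (INR (fact l) / delta ^ S l)).
Proof.
  intros HS Hang Hb Hdelta HA HF p q phi Hp Hpq Hq L.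
  assert (Hrange := smooth_segments_range ct d tau g HS).
  destruct HS as [H0 [H1 HS]].
  set (B := A / b * (INR (fact l) / delta ^ S l)).
  assert (HB : 0 <= B).
  { apply Rmult_le_pos; [apply Rdiv_le_0_compat; auto|].
    apply Rdiv_le_0_compat; [apply pos_INR|]. apply pow_lt; auto. }
  assert (Hdom : forall t, 0 < t < 1 -> dom ct t) by (intros t Ht; destruct ct as [|[] []];
    simpl; lra).
  assert (Hstep : forall j u v, (j < d)%nat -> p <= u -> u <= v -> v <= q -> tau j <= u -> v <=
    tau (S j) ->
    Cmod (phi v - phi u) <= B).
  { intros j u v Hj Hpu Huv Hvq Hju Hvj.
    destruct (Req_dec u v) as [->|Hne]; [rewrite Cmod_diag; auto|].
    destruct (HS j Hj) as [_ [HC1 Hnz]].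
    apply (arc_increment F g phi u v A b delta l); auto.
    - apply HC1; try lra; apply Hdom; lra.
    - eapply lifted1_sub; [| |exact L]; lra.
    - intros t Ht. assert (Htj : tau j < t < tau (S j)) by lra.
      destruct (Hnz t Htj) as [G0 G1].
      split; [auto|split; [auto|split; [apply (Hang j); auto|apply HF; auto; apply Hdom; lra]]]. }
  assert (Hind : forall j, (j <= d)%nat -> forall v, p <= v <= q -> v <= tau j ->
    Cmod (phi v - phi p) <= INR j * B).
  (* For [j = 0] the claim is vacuous, since [tau 0 = 0 < p]. Later, the starting point [p] may lie
     inside the current segment, in which case no earlier segment is met. *)
  { induction j as [|j IH]; intros Hj v Hv Hvj; [lra|].
    rewrite S_INR.
    destruct (Rle_dec v (tau j)) as [Hle|Hgt].
    { specialize (IH ltac:(lia) v Hv Hle). lra. }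
    destruct (Rle_dec p (tau j)) as [Hpj|Hpj].
    - assert (A1 := IH ltac:(lia) (tau j) ltac:(lra) ltac:(lra)).
      assert (A2 := Hstep j (tau j) v ltac:(lia) ltac:(lra) ltac:(lra) ltac:(lra) ltac:(lra) Hvj).
      eapply Rle_trans; [apply (Cmod_sum _ (phi v - phi (tau j)) (phi (tau j) - phi p)); ring|lra].
    - assert (A2 := Hstep j p v ltac:(lia) ltac:(lra) ltac:(lra) ltac:(lra) ltac:(lra) Hvj).
      pose proof (pos_INR j). nra. }
  apply Hind; auto; lra.
Qed.

(** * Laurent series *)

Lemma powerRZ_pos (x : R) (m : Z) : 0 < x -> 0 < powerRZ x m.
Proof. intros; apply powerRZ_lt; auto. Qed.

Lemma powerRZ_le_one (q : R) (m : Z) : 0 < q <= 1 -> (0 <= m)%Z -> powerRZ q m <= 1.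
Proof.
  intros Hq Hm. rewrite <- (Z2Nat.id m) by auto. rewrite <- pow_powerRZ.
  rewrite <- (pow1 (Z.to_nat m)). apply pow_incr; lra.
Qed.

Lemma one_le_powerRZ (q : R) (m : Z) : 1 <= q -> (0 <= m)%Z -> 1 <= powerRZ q m.
Proof.
  intros Hq Hm. rewrite <- (Z2Nat.id m) by auto. rewrite <- pow_powerRZ. apply pow_R1_Rle; auto.
Qed.

Lemma powerRZ_anti (q : R) (m n : Z) :
  0 < q <= 1 -> (n <= m)%Z -> powerRZ q m <= powerRZ q n.
Proof.
  intros Hq Hmn. replace m with (n + (m - n))%Z by lia. rewrite powerRZ_add by lra.
  pose proof (powerRZ_pos q n ltac:(lra)). pose proof (powerRZ_le_one q (m - n) Hq ltac:(lia)). nra.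
Qed.

Lemma powerRZ_mono (q : R) (m n : Z) : 1 <= q -> (m <= n)%Z -> powerRZ q m <= powerRZ q n.
Proof.
  intros Hq Hmn. replace n with (m + (n - m))%Z by lia. rewrite powerRZ_add by lra.
  pose proof (powerRZ_pos q m ltac:(lra)). pose proof (one_le_powerRZ q (n - m) Hq ltac:(lia)). nra.
Qed.

Lemma powerRZ_quot (x y : R) (m : Z) :
  0 < y -> powerRZ (x / y) m * powerRZ y m = powerRZ x m.
Proof.
  intros Hy. rewrite <- powerRZ_mult. f_equal. field; lra.
Qed.

Lemma Cpowz_mult (x y : C) (m : Z) :
  x <> 0 -> y <> 0 -> Cpowz (x * y) m = (Cpowz x m * Cpowz y m)%C.
Proof.
  intros Hx Hy. destruct m; simpl; [ring|apply Cpow_mult_l|].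
  rewrite Cpow_mult_l. field. split; apply Cpow_nz; auto.
Qed.

Lemma Cmod_Cpowz (z : C) (m : Z) : z <> 0 -> Cmod (Cpowz z m) = powerRZ (Cmod z) m.
Proof.
  intros Hz. destruct m; simpl; [apply Cmod_1|apply Cmod_pow|].
  rewrite Cmod_inv by (apply Cpow_nz; auto). rewrite Cmod_pow; auto.
Qed.

Definition psum (u : nat -> C) (n : nat) : C := fold_right Cplus (RtoC 0) (map u (seq 0 n)).

Fixpoint rsum (u : nat -> R) (n : nat) : R :=
  match n with O => 0 | S k => rsum u k + u k end.

Lemma fold_right_Cplus (l : list C) (z : C) :
  fold_right Cplus z l = (fold_right Cplus (RtoC 0) l + z)%C.
Proof. induction l as [|x l IH]; simpl; [ring|rewrite IH; ring]. Qed.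

Lemma psum_S (u : nat -> C) (n : nat) : psum u (S n) = (psum u n + u n)%C.
Proof.
  unfold psum. rewrite seq_S, map_app, fold_right_app. simpl.
  rewrite fold_right_Cplus. ring.
Qed.

Lemma psum_0 (u : nat -> C) : psum u 0 = 0.
Proof. reflexivity. Qed.

Lemma psum_sum_n (u : nat -> C) (n : nat) :
  psum u (S n) = sum_n (G := C_NormedModule) u n.
Proof.
  induction n as [|n IH].
  - rewrite sum_O, psum_S, psum_0. ring.
  - rewrite sum_Sn, psum_S, IH. reflexivity.
Qed.

Lemma rsum_sum_n (u : nat -> R) (n : nat) : rsum u (S n) = sum_n u n.
Proof.
  induction n as [|n IH].
  - rewrite sum_O. simpl. ring.
  - rewrite sum_Sn, <- IH. reflexivity.
Qed.

Lemma rsum_le_Series (u : nat -> R) (n : nat) : (forall j, 0 <= u j) -> ex_series u ->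
  0 <= rsum u n <= Series u.
Proof.
  intros Hu Hs.
  assert (H0 : forall k, 0 <= rsum u k) by (induction k as [|k IH]; simpl;
    [lra|specialize (Hu k); lra]).
  split; auto.
  assert (Hle : rsum u n <= rsum u (S n)) by (simpl; specialize (Hu n); lra).
  apply Rle_trans with (1 := Hle). rewrite rsum_sum_n.
  assert (Hl : is_lim_seq (sum_n u) (Series u)).
  { apply Series_correct in Hs. exact Hs. }
  apply (is_lim_seq_incr_compare _ _ Hl). intros k. rewrite sum_Sn.
  change (plus (sum_n u k) (u (S k))) with (sum_n u k + u (S k)). specialize (Hu (S k)). lra.
Qed.

Definition laurent_term (n0 : nat) (a : Z -> C) (z : C) (j : nat) : C :=
  (a (laurent_index n0 j) * Cpowz z (laurent_index n0 j))%C.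

Definition laurent_mag (n0 : nat) (a : Z -> C) (r : R) (j : nat) : R :=
  Cmod (a (laurent_index n0 j)) * powerRZ r (laurent_index n0 j).

Lemma laurent_mag_ge_0 (n0 : nat) (a : Z -> C) (r : R) (j : nat) :
  0 < r -> 0 <= laurent_mag n0 a r j.
Proof. intros Hr. apply Rmult_le_pos; [apply Cmod_ge_0|]. apply Rlt_le, powerRZ_pos; auto. Qed.

Lemma Cmod_laurent_term (n0 : nat) (a : Z -> C) (z : C) (j : nat) :
  z <> 0 -> Cmod (laurent_term n0 a z j) = laurent_mag n0 a (Cmod z) j.
Proof. intros Hz. unfold laurent_term, laurent_mag. rewrite Cmod_mult, Cmod_Cpowz; auto. Qed.

Lemma psum_term_lim (f : C -> C) (n0 : nat) (a : Z -> C) (z : C) :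
  laurent_expansion f n0 a -> z <> 0 -> Rbar_lt (Cmod z) (pole_radius f) ->
  forall eps, 0 < eps -> exists N, forall n, (N <= n)%nat ->
    Cmod (psum (laurent_term n0 a z) n - f z) < eps.
Proof.
  intros Hf Hz Hr eps He.
  assert (H := Hf z Hz Hr).
  change (is_series (K := C_AbsRing) (V := C_NormedModule) (laurent_term n0 a z) (f z)) in H.
  assert (HP : locally (T := C_UniformSpace) (f z) (fun x => Cmod (x - f z) < eps)).
  { apply locally_C_iff. exists eps; auto. }
  destruct (H _ HP) as [N HN]. exists (S N). intros n Hn.
  destruct n as [|n]; [lia|]. rewrite psum_sum_n. apply HN. lia.
Qed.

(** Abel's argument: convergence at a radius [rho] above [r] bounds the late terms there by 2, as
    differences of partial sums within 1 of the limit; the ratio r / rho then gives a geometric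
    majorant. *)
Lemma kappa_ex_series (f : C -> C) (n0 : nat) (a : Z -> C) (r : R) :
  laurent_expansion f n0 a -> 0 < r -> Rbar_lt r (pole_radius f) ->
  ex_series (laurent_mag n0 a r).
Proof.
  intros Hf Hr0 Hr.
  assert (Hrho : exists rho, r < rho /\ Rbar_lt rho (pole_radius f)).
  { destruct (pole_radius f) as [x| |]; simpl in *; [exists ((r + x) / 2); lra|exists (r + 1);
      split; [lra|auto]|contradiction]. }
  destruct Hrho as [rho [Hrr Hrho]].
  assert (Hz0 : RtoC rho <> 0).
  { apply Cmod_gt_0. rewrite Cmod_R, Rabs_pos_eq; lra. }
  assert (Hmr : Cmod (RtoC rho) = rho) by (rewrite Cmod_R, Rabs_pos_eq; lra).
  destruct (psum_term_lim f n0 a (RtoC rho) Hf Hz0) with (eps := 1) as [N HN]; [rewrite Hmr;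
    auto|lra|].
  assert (Hb : forall k, laurent_mag n0 a rho (N + k) <= 2).
  { intros k. rewrite <- Hmr, <- Cmod_laurent_term by auto.
    assert (A1 := HN (N + k)%nat ltac:(lia)). assert (A2 := HN (S (N + k)) ltac:(lia)).
    rewrite psum_S in A2. rewrite Cmod_sub_sym in A1.
    eapply Rle_trans; [apply (Cmod_sum _ (psum (laurent_term n0 a rho)
      (N + k) + laurent_term n0 a rho (N + k) - f rho) (f rho - psum (laurent_term n0 a rho)
        (N + k))); ring|lra]. }
  apply (ex_series_incr_n (laurent_mag n0 a r) N).
  assert (Hq : 0 < r / rho < 1).
  { split; [apply Rdiv_lt_0_compat; lra|]. apply (Rmult_lt_reg_r rho); [lra|]. unfold Rdiv.
    rewrite Rmult_assoc, Rinv_l; lra. }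
  apply (ex_series_le (K := R_AbsRing) (V := R_CompleteNormedModule) _ (fun k => 2 * powerRZ
    (r / rho) (laurent_index n0 N) * (r / rho) ^ k)).
  - intros k.
    change (Rabs (laurent_mag n0 a r (N + k)) <=
      2 * powerRZ (r / rho) (laurent_index n0 N) * (r / rho) ^ k).
    rewrite Rabs_pos_eq by (apply laurent_mag_ge_0; auto).
    replace (laurent_mag n0 a r (N + k)) with (laurent_mag n0 a rho (N + k) * (powerRZ (r / rho)
      (laurent_index n0 N) * (r / rho) ^ k)).
    + rewrite Rmult_assoc. apply Rmult_le_compat_r; auto.
      apply Rmult_le_pos; [apply Rlt_le, powerRZ_pos; lra|apply pow_le; lra].
    + unfold laurent_mag. rewrite pow_powerRZ, <- powerRZ_add by lra.
      replace (laurent_index n0 N + Z.of_nat k)%Z with (laurent_index n0 (N + k))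
        by (unfold laurent_index; lia).
      rewrite <- (powerRZ_quot r rho (laurent_index n0 (N + k))) by lra. ring.
  - apply (ex_series_scal_l (2 * powerRZ (r / rho) (laurent_index n0 N)) (fun k => (r / rho) ^ k)).
    apply ex_series_geom. rewrite Rabs_pos_eq; lra.
Qed.

Lemma rsum_mag_le_kappa (f : C -> C) (n0 : nat) (a : Z -> C) (r : R) (n : nat) :
  laurent_expansion f n0 a -> 0 < r -> Rbar_lt r (pole_radius f) ->
  0 <= rsum (laurent_mag n0 a r) n <= kappa n0 a r.
Proof.
  intros Hf Hr Hr'.
  apply rsum_le_Series; [intros; apply laurent_mag_ge_0; auto|apply (kappa_ex_series f); auto].
Qed.

Lemma kappa_ge_0 (f : C -> C) (n0 : nat) (a : Z -> C) (r : R) :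
  laurent_expansion f n0 a -> 0 < r -> Rbar_lt r (pole_radius f) -> 0 <= kappa n0 a r.
Proof. intros Hf Hr Hr'. pose proof (rsum_mag_le_kappa f n0 a r O Hf Hr Hr'). lra. Qed.

Lemma laurent_mag_scale (n0 : nat) (a : Z -> C) (x r : R) (j : nat) :
  0 < r ->
  laurent_mag n0 a x j = powerRZ (x / r) (laurent_index n0 j) * laurent_mag n0 a r j.
Proof.
  intros Hr. unfold laurent_mag. rewrite <- (powerRZ_quot x r (laurent_index n0 j)) by auto. ring.
Qed.

(** With q = |z| / r <= 1 the lowest power of [q] dominates the whole tail and factors out, leaving
    a tail of the series [kappa n0 a r]. *)
Lemma laurent_tail (f : C -> C) (n0 : nat) (a : Z -> C) (z : C) (r : R) (N : nat) :
  laurent_expansion f n0 a -> z <> 0 -> Cmod z <= r -> Rbar_lt r (pole_radius f) ->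
  Cmod (f z - psum (laurent_term n0 a z) N) <=
    powerRZ (Cmod z / r) (laurent_index n0 N) * kappa n0 a r.
Proof.
  intros Hf Hz Hzr Hr. assert (Hm : 0 < Cmod z) by (apply Cmod_gt_0; auto).
  assert (Hr0 : 0 < r) by lra.
  set (q := Cmod z / r).
  assert (Hq : 0 < q <= 1).
  { unfold q. split; [apply Rdiv_lt_0_compat; lra|]. apply (Rmult_le_reg_r r); auto. unfold Rdiv.
    rewrite Rmult_assoc, Rinv_l; lra. }
  assert (Hk : forall k, Cmod (psum (laurent_term n0 a z) (N + k) - psum (laurent_term n0 a z) N) <=
    powerRZ q (laurent_index n0 N) * (rsum (laurent_mag n0 a r) (N + k) - rsum
      (laurent_mag n0 a r) N)).
  { induction k as [|k IH].
    - rewrite Nat.add_0_r, Cmod_diag. lra.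
    - rewrite Nat.add_succ_r, psum_S. simpl rsum.
      eapply Rle_trans; [apply (Cmod_sum _ (psum (laurent_term n0 a z) (N + k) - psum
        (laurent_term n0 a z) N) (laurent_term n0 a z (N + k))); ring|].
      rewrite Cmod_laurent_term by auto. rewrite (laurent_mag_scale n0 a _ r) by auto. fold q.
      assert (powerRZ q (laurent_index n0 (N + k)) <= powerRZ q (laurent_index n0 N)).
      { apply powerRZ_anti; auto. unfold laurent_index; lia. }
      pose proof (laurent_mag_ge_0 n0 a r (N + k) Hr0). nra. }
  assert (Hk' : forall k, Cmod (psum (laurent_term n0 a z) (N + k) - psum
    (laurent_term n0 a z) N) <=
    powerRZ q (laurent_index n0 N) * kappa n0 a r).
  { intros k. eapply Rle_trans; [apply Hk|].
    apply Rmult_le_compat_l; [apply Rlt_le, powerRZ_pos; lra|].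
    pose proof (rsum_mag_le_kappa f n0 a r (N + k) Hf Hr0 Hr).
    pose proof (rsum_mag_le_kappa f n0 a r N Hf Hr0 Hr). lra. }
  apply Rle_plus_epsilon. intros eps He.
  destruct (psum_term_lim f n0 a z Hf Hz) with (eps := eps) as [M HM]; auto.
  { eapply Rbar_le_lt_trans; [|exact Hr]. exact Hzr. }
  specialize (HM (N + M)%nat ltac:(lia)). rewrite Cmod_sub_sym in HM.
  eapply Rle_trans; [apply (Cmod_sum _ (f z - psum (laurent_term n0 a z) (N + M)) (psum
    (laurent_term n0 a z) (N + M) - psum (laurent_term n0 a z) N)); ring|].
  specialize (Hk' M). lra.
Qed.

(** Outside the circle the highest power of |z| / r dominates. The sum stops before index [N], so
    the hypothesis on [laurent_index n0 N] says that its degrees are at most [m]. *)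
Lemma laurent_head (f : C -> C) (n0 : nat) (a : Z -> C) (z : C) (r : R) (N : nat)
    (m : Z) :
  laurent_expansion f n0 a -> 0 < r -> r <= Cmod z -> Rbar_lt r (pole_radius f) ->
  (laurent_index n0 N <= m + 1)%Z ->
  Cmod (psum (laurent_term n0 a z) N) <= powerRZ (Cmod z / r) m * kappa n0 a r.
Proof.
  intros Hf Hr0 Hzr Hr Hm. assert (Hz : z <> 0) by (apply Cmod_gt_0; lra).
  set (q := Cmod z / r).
  assert (Hq : 1 <= q).
  { unfold q. apply (Rmult_le_reg_r r); auto. unfold Rdiv. rewrite Rmult_assoc, Rinv_l; lra. }
  assert (Hk : forall k, (k <= N)%nat -> Cmod (psum (laurent_term n0 a z) k) <=
    powerRZ q m * rsum (laurent_mag n0 a r) k).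
  { induction k as [|k IH]; intros Hk.
    - rewrite psum_0, Cmod_0. simpl. lra.
    - rewrite psum_S. simpl rsum. eapply Rle_trans; [apply Cmod_triangle|].
      rewrite Cmod_laurent_term by auto. rewrite (laurent_mag_scale n0 a _ r) by auto. fold q.
      specialize (IH ltac:(lia)).
      assert (powerRZ q (laurent_index n0 k) <= powerRZ q m).
      { apply powerRZ_mono; auto. unfold laurent_index in *; lia. }
      pose proof (laurent_mag_ge_0 n0 a r k Hr0). nra. }
  eapply Rle_trans; [apply Hk; auto|]. apply Rmult_le_compat_l; [apply Rlt_le, powerRZ_pos; lra|].
  apply (rsum_mag_le_kappa f); auto.
Qed.

Lemma partial_sum_psum (n0 : nat) (u : Z -> C) (n : Z) :
  partial_sum n0 u n = psum (fun j => u (laurent_index n0 j)) (Z.to_nat (n + Z.of_nat n0 + 1)).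
Proof. reflexivity. Qed.

(** Below [|z| = r] the tail of the series is estimated, above it [f] and the
    partial sum separately; both exponents [k = n] and [k = n + 1] are then
    possible. *)
Lemma laurent_remainder (f : C -> C) (n0 : nat) (a : Z -> C) (z : C) (r c cg e : R)
    (n k : Z) :
  laurent_expansion f n0 a ->
  z <> 0 -> 0 < r -> Rbar_lt r (pole_radius f) -> 0 < c <= cg -> 1 <= e ->
  (- Z.of_nat n0 - 1 <= n)%Z -> (0 <= k)%Z -> (k = n \/ k = n + 1)%Z ->
  Cmod (f z) <= cg * e / Cmod z ^ n0 ->
  Cmod (f z - partial_sum n0 (fun m => a m * Cpowz z m)%C n) <=
    cg / c * e * powerRZ (Cmod z) k * (1 / powerRZ r k * (c * powerRZ r
      (- Z.of_nat n0) + kappa n0 a r)).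
Proof.
  intros Hf Hz Hr0 Hr Hc He Hn Hk Hkn Hfz.
  rewrite partial_sum_psum. set (N := Z.to_nat (n + Z.of_nat n0 + 1)).
  change (fun j => a (laurent_index n0 j) * Cpowz z (laurent_index n0 j))%C
    with (laurent_term n0 a z).
  assert (HN : laurent_index n0 N = (n + 1)%Z) by (unfold laurent_index, N; lia).
  assert (Hm : 0 < Cmod z) by (apply Cmod_gt_0; auto).
  pose proof (kappa_ge_0 f n0 a r Hf Hr0 Hr) as Hkap.
  set (q := Cmod z / r).
  assert (Hq0 : 0 < q) by (apply Rdiv_lt_0_compat; lra).
  assert (Hqk : 0 < powerRZ q k) by (apply powerRZ_pos; auto).
  assert (Hrk : 0 < powerRZ r k) by (apply powerRZ_pos; auto).
  assert (Hrn : 0 < powerRZ r (- Z.of_nat n0)) by (apply powerRZ_pos; auto).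
  assert (Hmain : Cmod (f z - psum (laurent_term n0 a z) N) <=
    powerRZ q k * (cg * e * powerRZ r (- Z.of_nat n0) + kappa n0 a r)).
  { assert (Hce : 0 <= cg * e * powerRZ r (- Z.of_nat n0)).
    { apply Rmult_le_pos; [|lra]. apply Rmult_le_pos; lra. }
    destruct (Rle_dec (Cmod z) r) as [Hle|Hgt].
    - eapply Rle_trans; [apply (laurent_tail f n0 a z r N); auto|]. fold q. rewrite HN.
      assert (Hq1 : q <= 1).
      { unfold q. apply (Rmult_le_reg_r r); auto. unfold Rdiv. rewrite Rmult_assoc, Rinv_l; lra. }
      assert (powerRZ q (n + 1) <= powerRZ q k) by (apply powerRZ_anti; [lra|lia]). nra.
    - assert (Hq1 : 1 <= q).
      { unfold q. apply (Rmult_le_reg_r r); auto. unfold Rdiv. rewrite Rmult_assoc, Rinv_l; lra. }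
      assert (Hhead := laurent_head f n0 a z r N k Hf Hr0 ltac:(lra) Hr ltac:(lia)).
      fold q in Hhead.
      assert (H1 : 1 <= powerRZ q k) by (apply one_le_powerRZ; auto).
      assert (Hf2 : Cmod (f z) <= cg * e * powerRZ r (- Z.of_nat n0)).
      { eapply Rle_trans; [exact Hfz|]. unfold Rdiv.
        apply Rmult_le_compat_l; [apply Rmult_le_pos; lra|].
        rewrite powerRZ_neg', <- pow_powerRZ.
        apply Rinv_le_contravar; [apply pow_lt; auto|]. apply pow_incr; lra. }
      unfold Cminus. eapply Rle_trans; [apply Cmod_triangle|]. rewrite Cmod_opp. nra. }
  eapply Rle_trans; [exact Hmain|].
  rewrite <- (powerRZ_quot (Cmod z) r k) by auto. fold q.
  replace (cg / c * e * (powerRZ q k * powerRZ r k) * (1 / powerRZ r k * (c * powerRZ r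
    (- Z.of_nat n0) + kappa n0 a r)))
    with (powerRZ q k * (cg * e * powerRZ r (- Z.of_nat n0) + (cg * e / c) * kappa n0 a r))
      by (field; lra).
  (* Since [c <= cg] and [1 <= e], the factor [cg * e / c] is at least 1 and may be put in front of
     [kappa] too. This is where the lower bound [c] of the constants enters [cprime]. *)
  apply Rmult_le_compat_l; [lra|]. apply Rplus_le_compat_l.
  rewrite <- (Rmult_1_l (kappa n0 a r)) at 1. apply Rmult_le_compat_r; auto.
  apply (Rmult_le_reg_r c); [lra|]. unfold Rdiv. rewrite Rmult_assoc, Rinv_l by lra. nra.
Qed.

(** For [Y > 0] the quotient X / Y is a lower bound of the set; for [Y = 0] one admissible radius
    suffices. Nonnegativity of the set and the existence of a radius make the infimum finite, so
    [real] does not return its default value. *)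
Lemma cprime_ge (f : C -> C) (n0 : nat) (a : Z -> C) (c : R) (k : Z) (X Y : R) :
  laurent_expansion f n0 a -> Rbar_lt 0 (pole_radius f) -> 0 < c -> 0 <= Y ->
  (forall r, 0 < r -> Rbar_lt r (pole_radius f) ->
     X <= Y * (1 / powerRZ r k * (c * powerRZ r (- Z.of_nat n0) + kappa n0 a r))) ->
  X <= Y * cprime f n0 a c k.
Proof.
  intros Hf Hpos Hc HY H.
  unfold cprime. set (Es := fun x => exists r, 0 < r /\ Rbar_lt r (pole_radius f) /\
    x = 1 / powerRZ r k * (c * powerRZ r (- Z.of_nat n0) + kappa n0 a r)).
  destruct (Glb_Rbar_correct Es) as [Hlb Hglb].
  assert (Hr : exists r, 0 < r /\ Rbar_lt r (pole_radius f)).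
  { destruct (pole_radius f) as [x| |]; simpl in *; [exists (x / 2); lra|exists 1; split;
      [lra|auto]|contradiction]. }
  destruct Hr as [r [Hr0 Hr]].
  assert (Hge0 : Rbar_le 0 (Glb_Rbar Es)).
  { apply Hglb. intros x [s [Hs0 [Hs ->]]]. simpl.
    pose proof (kappa_ge_0 f n0 a s Hf Hs0 Hs). pose proof (powerRZ_pos s k Hs0).
    pose proof (powerRZ_pos s (- Z.of_nat n0) Hs0).
    apply Rmult_le_pos; [apply Rdiv_le_0_compat; lra|nra]. }
  assert (HEr : Es (1 / powerRZ r k * (c * powerRZ r (- Z.of_nat n0) + kappa n0 a r)))
    by (exists r; auto).
  assert (Hle := Hlb _ HEr).
  assert (HXY : 0 < Y -> Rbar_le (X / Y) (Glb_Rbar Es)).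
  { intros HY0. apply Hglb. intros x [s [Hs0 [Hs ->]]]. simpl. specialize (H s Hs0 Hs).
    apply (Rmult_le_reg_l Y); auto. replace (Y * (X / Y)) with X by (field; lra). auto. }
  destruct (Glb_Rbar Es) as [x| |]; simpl in *; try contradiction.
  destruct (Req_dec Y 0) as [->|HYn].
  - specialize (H r Hr0 Hr). lra.
  - specialize (HXY ltac:(lra)). apply (Rmult_le_compat_l Y) in HXY; auto.
    replace (Y * (X / Y)) with X in HXY by (field; lra). auto.
Qed.

(** * Poles *)

(** If both held, h(x) (x - z)^(k+1) would tend to 0 by continuity of [h] and to g(z), which is
    nonzero. *)
Lemma holo_not_pole (h : C -> C) (z : C) : holo_at h z -> ~ is_pole h z.
Proof.
  intros Hh [k [g [Hg [Hgz Heq]]]].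
  apply holo_at_cdiff in Hh. destruct Hh as [d1 [Hd1 Hh]].
  apply holo_at_cdiff in Hg. destruct Hg as [d2 [Hd2 Hg]].
  apply locally_C_iff in Heq. destruct Heq as [d3 [Hd3 Heq]].
  assert (Hgz0 : 0 < Cmod (g z)) by (apply Cmod_gt_0; auto).
  assert (C1 : cdiff (fun x => h x * (x - z) ^ S k)%C z).
  { apply cdiff_mult; [apply Hh; rewrite Cmod_diag; auto|].
    destruct (cdiff_pow (S k) (z - z)) as [l Hl]. exists (l * (1 + 0))%C.
    apply (cderiv_comp (fun x => x ^ S k)%C (fun x => x - z)%C); auto.
    apply (cderiv_plus (fun x => x) (fun _ => - z)%C); [apply cderiv_id|apply cderiv_const]. }
  assert (C2 : cdiff g z) by (apply Hg; rewrite Cmod_diag; auto).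
  destruct (cdiff_cont _ z C1 (Cmod (g z) / 2)) as [e1 [He1 H1]]; [lra|].
  destruct (cdiff_cont _ z C2 (Cmod (g z) / 2)) as [e2 [He2 H2]]; [lra|].
  set (m := Rmin (Rmin e1 e2) d3 / 2).
  assert (Hm : 0 < m) by (unfold m; apply Rdiv_lt_0_compat; [repeat apply Rmin_pos; auto|lra]).
  assert (Hm' : m < e1 /\ m < e2 /\ m < d3).
  { unfold m in *. pose proof (Rmin_l (Rmin e1 e2) d3). pose proof (Rmin_r (Rmin e1 e2) d3).
    pose proof (Rmin_l e1 e2). pose proof (Rmin_r e1 e2). lra. }
  set (z' := (z + RtoC m)%C).
  assert (Hz' : Cmod (z' - z) = m).
  { unfold z'. replace (z + RtoC m - z)%C with (RtoC m) by ring. rewrite Cmod_R, Rabs_pos_eq; lra. }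
  assert (Hne : (z' - z)%C <> 0) by (apply Cmod_gt_0; lra).
  assert (Hne' : z' <> z) by (intros E; apply Hne; rewrite E; ring).
  specialize (H1 z' ltac:(lra)). specialize (H2 z' ltac:(lra)). specialize (Heq z' ltac:(lra) Hne').
  rewrite Heq in H1.
  replace (g z' / (z' - z) ^ S k * (z' - z) ^ S k - h z * (z - z) ^ S k)%C with (g z') in H1.
  - assert (Cmod (g z) <= Cmod (g z') + Cmod (g z' - g z)); [|lra].
    rewrite (Cmod_sub_sym (g z')). apply Cmod_sum; ring.
  - replace (z - z)%C with (RtoC 0) by ring. simpl (0 ^ S k)%C.
    replace (h z * (0 * 0 ^ k))%C with (RtoC 0) by ring. field. apply Cpow_nz; auto.
Qed.

(** Includes [k = 0], where the factor [g] is [h] itself. *)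
Lemma pole_order_factor (h : C -> C) (k : nat) : pole_order h 0 k ->
  exists g del, 0 < del /\ (forall z, Cmod z < del -> cdiff g z) /\
    forall z, Cmod z < del -> z <> 0 -> h z = (g z / z ^ k)%C.
Proof.
  assert (E : forall z : C, (z - 0)%C = z) by (intros; ring).
  destruct k as [|k]; simpl.
  - intros H. apply holo_at_cdiff in H. destruct H as [d [Hd H]].
    exists h, d. split; auto. split.
    + intros z Hz. apply H. rewrite E; auto.
    + intros z _ _. field. 
  - intros [g [Hg [_ Heq]]].
    apply holo_at_cdiff in Hg. destruct Hg as [d1 [Hd1 Hg]].
    apply locally_C_iff in Heq. destruct Heq as [d2 [Hd2 Heq]].
    exists g, (Rmin d1 d2). split; [apply Rmin_pos; auto|]. split.
    + intros z Hz. apply Hg. rewrite E. eapply Rlt_le_trans; [exact Hz|apply Rmin_l].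
    + intros z Hz Hz0. rewrite Heq; auto; rewrite E; auto.
      eapply Rlt_le_trans; [exact Hz|apply Rmin_r].
Qed.

Lemma pole_order_punctured (h : C -> C) (k : nat) : pole_order h 0 k ->
  exists del, 0 < del /\ forall z, Cmod z < del -> z <> 0 -> cdiff h z.
Proof.
  intros H. destruct (pole_order_factor h k H) as [g [d [Hd [Hg E]]]].
  exists d. split; auto. intros z Hz Hz0.
  assert (Hm : 0 < Cmod z) by (apply Cmod_gt_0; auto).
  apply (cdiff_ext_loc (fun x => g x * / x ^ k)%C h z (Rmin (Cmod z) (d - Cmod z))).
  - apply Rmin_pos; lra.
  - intros z' Hz'.
    pose proof (Rmin_l (Cmod z) (d - Cmod z)). pose proof (Rmin_r (Cmod z) (d - Cmod z)).
    assert (Cmod z' <= Cmod (z' - z) + Cmod z) by (apply Cmod_sum; ring).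
    assert (Cmod z <= Cmod (z' - z) + Cmod z') by (rewrite (Cmod_sub_sym z'); apply Cmod_sum; ring).
    symmetry. apply E; [lra|]. apply Cmod_gt_0. lra.
  - apply cdiff_mult; auto.
    apply (cdiff_inv (fun x => x ^ k)%C); [apply cdiff_pow|apply Cpow_nz; auto].
Qed.

Lemma holo_of_punctured (h : C -> C) (d : R) (z : C) :
  (forall z, Cmod z < d -> z <> 0 -> cdiff h z) -> Cmod z < d -> z <> 0 -> holo_at h z.
Proof.
  intros H Hz Hz0. apply holo_at_cdiff. assert (Hm : 0 < Cmod z) by (apply Cmod_gt_0; auto).
  exists (Rmin (Cmod z) (d - Cmod z)). split; [apply Rmin_pos; lra|]. intros z' Hz'.
  pose proof (Rmin_l (Cmod z) (d - Cmod z)). pose proof (Rmin_r (Cmod z) (d - Cmod z)).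
  assert (Cmod z' <= Cmod (z' - z) + Cmod z) by (apply Cmod_sum; ring).
  assert (Cmod z <= Cmod (z' - z) + Cmod z') by (rewrite (Cmod_sub_sym z'); apply Cmod_sum; ring).
  apply H; [lra|]. apply Cmod_gt_0. lra.
Qed.

Lemma pole_radius_pos (f : C -> C) (n0 : nat) :
  pole_order f 0 n0 -> Rbar_lt 0 (pole_radius f).
Proof.
  intros H. destruct (pole_order_punctured f n0 H) as [d [Hd Hd']].
  unfold pole_radius.
  destruct (Glb_Rbar_correct (fun x => exists z, is_pole f z /\ z <> 0 /\ x = Cmod z)) as [_ Hg].
  apply Rbar_lt_le_trans with (Finite d); [exact Hd|]. apply Hg.
  intros x [z [Hp [Hz ->]]]. simpl. apply Rnot_lt_le. intros Hlt.
  apply (holo_not_pole f z); auto. apply (holo_of_punctured f d); auto.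
Qed.

(** * The remainder integrand *)

(** Written as a combination of the integrands whose integrals are assumed to exist, so that
    linearity applies; [remainder_factor] gives the product form used in estimates. *)
Definition remainder (Kw f : C -> C) (n0 : nat) (a : Z -> C) (gam : C) (n : Z) (z : C) : C :=
  (transform_integrand Kw f gam z -
   partial_sum n0 (fun m => a m * Cpowz gam m * moment_integrand Kw m z) n)%C.

Lemma psum_ext (u v : nat -> C) (n : nat) :
  (forall j, (j < n)%nat -> u j = v j) -> psum u n = psum v n.
Proof.
  induction n as [|n IH]; intros H; [reflexivity|].
  rewrite !psum_S, IH, H; auto.
Qed.

Lemma psum_scal (k : C) (u : nat -> C) (n : nat) :
  psum (fun j => k * u j)%C n = (k * psum u n)%C.
Proof.
  induction n as [|n IH]; [rewrite !psum_0; ring|]. rewrite !psum_S, IH. ring.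
Qed.

Lemma remainder_factor (Kw f : C -> C) (n0 : nat) (a : Z -> C) (gam z : C) (n : Z) :
  gam <> 0 -> z <> 0 ->
  remainder Kw f n0 a gam n z =
  (Kw z * (f (gam * z) - partial_sum n0 (fun m => a m * Cpowz (gam * z) m) n))%C.
Proof.
  intros Hg Hz. unfold remainder, transform_integrand, moment_integrand, dilate.
  rewrite !partial_sum_psum.
  rewrite (psum_ext _ (fun j => Kw z * (a (laurent_index n0 j) * Cpowz (gam * z)
    (laurent_index n0 j)))%C).
  - rewrite psum_scal. ring.
  - intros j _. rewrite Cpowz_mult; auto. ring.
Qed.

Lemma cdiff_psum (u : C -> nat -> C) (z : C) (n : nat) :
  (forall j, (j < n)%nat -> cdiff (fun x => u x j) z) -> cdiff (fun x => psum (u x) n) z.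
Proof.
  induction n as [|n IH]; intros H.
  - apply (cdiff_const (RtoC 0)).
  - apply (cdiff_ext_loc (fun x => psum (u x) n + u x n)%C _ z 1); [lra|intros; symmetry;
      apply psum_S|].
    apply cdiff_plus; auto.
Qed.

Lemma cdiff_minus (F G : C -> C) (z : C) :
  cdiff F z -> cdiff G z -> cdiff (fun x => F x - G x)%C z.
Proof.
  intros HF [l HG]. apply cdiff_plus; auto. exists (- (1) * l)%C.
  generalize (cderiv_scal G (- (1)) z l HG). intros H.
  apply (cderiv_ext_loc (fun x => - (1) * G x)%C _ z _ 1); [lra|intros; ring|auto].
Qed.

Lemma cdiff_remainder (Kw f : C -> C) (n0 : nat) (a : Z -> C) (gam z : C) (n : Z) :
  cdiff Kw z -> cdiff (dilate f gam) z -> n0 = O \/ z <> 0 ->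
  cdiff (remainder Kw f n0 a gam n) z.
Proof.
  intros HK Hf H. unfold remainder, transform_integrand, moment_integrand.
  apply cdiff_minus; [apply cdiff_mult; auto|].
  apply (cdiff_psum (fun x j => a (laurent_index n0 j) * Cpowz gam (laurent_index n0 j) *
    (Kw x * Cpowz x (laurent_index n0 j)))%C).
  intros j _. apply cdiff_mult; [apply cdiff_const|]. apply cdiff_mult; auto.
  apply cdiff_Cpowz. destruct H as [->|H]; [left; unfold laurent_index; lia|auto].
Qed.

Lemma cdiff_dilate (f : C -> C) (gam z : C) : cdiff f (gam * z) -> cdiff (dilate f gam) z.
Proof. intros [l H]. exists (gam * l)%C. apply cderiv_dilate; auto. Qed.

(** The quotient of the Laurent remainder by [zeta ^ p], [p = n + 1], extended
    by its limit at [0]. *)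
Definition laurent_quotient (f : C -> C) (n0 : nat) (a : Z -> C) (p : nat) (zeta : C) : C :=
  if excluded_middle_informative (zeta = 0) then a (Z.of_nat p)
  else ((f zeta - partial_sum n0 (fun m => a m * Cpowz zeta m) (Z.of_nat p - 1)) / zeta ^ p)%C.

Lemma partial_sum_succ (n0 : nat) (u : Z -> C) (n : Z) : (- Z.of_nat n0 - 1 <= n)%Z ->
  partial_sum n0 u (n + 1) = (partial_sum n0 u n + u (n + 1)%Z)%C.
Proof.
  intros Hn. rewrite !partial_sum_psum.
  replace (Z.to_nat (n + 1 + Z.of_nat n0 + 1)) with (S (Z.to_nat (n + Z.of_nat n0 + 1))) by lia.
  rewrite psum_S. repeat f_equal. unfold laurent_index. lia.
Qed.

Lemma Cpowz_nat (z : C) (p : nat) : Cpowz z (Z.of_nat p) = (z ^ p)%C.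
Proof.
  destruct p as [|p]; [reflexivity|]. simpl Z.of_nat. unfold Cpowz.
  rewrite SuccNat2Pos.id_succ. reflexivity.
Qed.

(** No removable singularity theorem is used: after subtracting the terms of degrees p and p + 1,
    the tail estimate gives an error of order |z|^2 in the quotient, so the derivative at 0 is the
    coefficient of index p + 1. *)
Lemma laurent_quotient_cdiff (f : C -> C) (n0 : nat) (a : Z -> C) (p : nat) :
  laurent_expansion f n0 a -> pole_order f 0 n0 -> cdiff (laurent_quotient f n0 a p) 0.
Proof.
  intros Hf Hp.
  assert (Hr : exists r, 0 < r /\ Rbar_lt r (pole_radius f)).
  { assert (Hpos := pole_radius_pos f n0 Hp).
    destruct (pole_radius f) as [x| |]; simpl in *; [exists (x / 2); lra|exists 1; split;
      [lra|auto]|contradiction]. }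
  destruct Hr as [r [Hr0 Hr]].
  pose proof (kappa_ge_0 f n0 a r Hf Hr0 Hr) as Hkap.
  set (M := powerRZ (/ r) (Z.of_nat p + 2) * kappa n0 a r).
  assert (HM : 0 <= M).
  { apply Rmult_le_pos; auto. apply Rlt_le, powerRZ_pos, Rinv_0_lt_compat; auto. }
  exists (a (Z.of_nat p + 1)%Z). intros eps He.
  exists (Rmin r (eps / (M + 1))). split; [apply Rmin_pos; auto; apply Rdiv_lt_0_compat; lra|].
  intros z Hz.
  pose proof (Rmin_l r (eps / (M + 1))). pose proof (Rmin_r r (eps / (M + 1))).
  replace (z - 0)%C with z in * by ring.
  unfold laurent_quotient at 2.
  destruct excluded_middle_informative as [_|N]; [|exfalso; apply N; auto].
  unfold laurent_quotient. destruct excluded_middle_informative as [->|Hz0].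
  { replace (a (Z.of_nat p) - a (Z.of_nat p) - a (Z.of_nat p + 1)%Z * 0)%C with (RtoC 0) by ring.
    rewrite Cmod_0. lra. }
  assert (Hm : 0 < Cmod z) by (apply Cmod_gt_0; auto).
  set (u := fun m => (a m * Cpowz z m)%C).
  assert (E1 : partial_sum n0 u (Z.of_nat p + 1) =
    (partial_sum n0 u (Z.of_nat p - 1) + a (Z.of_nat p) * z ^ p + a (Z.of_nat p + 1)%Z *
      (z ^ p * z))%C).
  { rewrite (partial_sum_succ n0 u (Z.of_nat p)) by lia.
    replace (Z.of_nat p) with (Z.of_nat p - 1 + 1)%Z at 1 by lia.
    rewrite (partial_sum_succ n0 u) by lia. replace (Z.of_nat p - 1 + 1)%Z with (Z.of_nat p) by lia.
    unfold u. rewrite Cpowz_nat. replace (Z.of_nat p + 1)%Z with (Z.of_nat (S p)) by lia.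
    rewrite Cpowz_nat. simpl. ring. }
  replace ((f z - partial_sum n0 u (Z.of_nat p - 1)) / z ^ p - a (Z.of_nat p) - a
    (Z.of_nat p + 1)%Z * z)%C
    with ((f z - partial_sum n0 u (Z.of_nat p + 1)) / z ^ p)%C
    by (rewrite E1; field; apply Cpow_nz; auto).
  rewrite Cmod_div, Cmod_pow by (apply Cpow_nz; auto).
  rewrite partial_sum_psum. set (N := Z.to_nat (Z.of_nat p + 1 + Z.of_nat n0 + 1)).
  assert (T := laurent_tail f n0 a z r N Hf Hz0 ltac:(lra) Hr).
  change (laurent_term n0 a z) with (fun j => u (laurent_index n0 j)) in T.
  replace (laurent_index n0 N) with (Z.of_nat p + 2)%Z in T by (unfold laurent_index, N; lia).
  assert (Hzp : 0 < Cmod z ^ p) by (apply pow_lt; auto).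
  apply Rle_trans with (M * Cmod z * Cmod z).
  - apply (Rmult_le_reg_r (Cmod z ^ p)); auto. unfold Rdiv at 1.
    rewrite Rmult_assoc, Rinv_l, Rmult_1_r by lra.
    eapply Rle_trans; [exact T|]. unfold M, Rdiv. rewrite powerRZ_mult.
    rewrite (powerRZ_add (Cmod z)) by lra. rewrite <- pow_powerRZ. simpl (powerRZ (Cmod z) 2).
    right; ring.
  - apply Rmult_le_compat_r; [lra|].
    apply Rle_trans with (M * (eps / (M + 1))); [apply Rmult_le_compat_l; lra|].
    apply (Rmult_le_reg_r (M + 1)); [lra|].
    replace (M * (eps / (M + 1)) * (M + 1)) with (M * eps) by (field; lra). nra.
Qed.

Lemma dilate_pole (f : C -> C) (gam z : C) :
  gam <> 0 -> is_pole f (gam * z) -> is_pole (dilate f gam) z.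
Proof.
  intros Hg [k [g [H1 [H2 H3]]]].
  assert (Hgp : (gam ^ S k)%C <> 0) by (apply Cpow_nz; auto).
  assert (Hm : 0 < Cmod gam) by (apply Cmod_gt_0; auto).
  assert (E : forall z', Cmod (gam * z' - gam * z) = Cmod gam * Cmod (z' - z)).
  { intros z'. rewrite <- Cmod_mult. f_equal. ring. }
  assert (Hsc : forall d x, Cmod (x - z) < d / Cmod gam -> Cmod (gam * x - gam * z) < d).
  { intros d x Hx. rewrite E. apply (Rmult_lt_compat_l (Cmod gam)) in Hx; auto.
    replace (Cmod gam * (d / Cmod gam)) with d in Hx by (field; lra). auto. }
  (* The constant factor comes from (gam x - gam z)^(k+1) = gam^(k+1) (x - z)^(k+1). *)
  exists k, (fun x => g (gam * x) * / gam ^ S k)%C. split; [|split].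
  - apply holo_at_cdiff in H1. destruct H1 as [d [Hd H1]]. apply holo_at_cdiff.
    exists (d / Cmod gam). split; [apply Rdiv_lt_0_compat; auto|]. intros x Hx.
    apply cdiff_mult; [|apply cdiff_const]. apply (cdiff_dilate g). auto.
  - apply Cmult_neq_0; auto. intros E0. apply (f_equal (fun x => x * gam ^ S k)%C) in E0.
    rewrite Cinv_l in E0 by auto. rewrite Cmult_0_l in E0.
    apply C1_nz. auto.
  - apply locally_C_iff in H3. destruct H3 as [d [Hd H3]]. apply locally_C_iff.
    exists (d / Cmod gam). split; [apply Rdiv_lt_0_compat; auto|]. intros x Hx Hxz.
    assert (Hne : (gam * x)%C <> (gam * z)%C).
    { intros E0. apply Hxz.
      assert (Hc : forall y : C, (/ gam * (gam * y))%C = y) by (intros; field; auto).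
      rewrite <- (Hc x), <- (Hc z), E0. reflexivity. }
    unfold dilate. rewrite H3 by auto.
    assert (Hxz' : (x - z)%C <> 0).
    { intros E0. apply Hxz. apply Cmod_sub_eq0. rewrite E0, Cmod_0. lra. }
    replace (gam * x - gam * z)%C with (gam * (x - z))%C by ring.
    rewrite Cpow_mult_l. change (Cpow (x - z)%C (S k)) with ((x - z) ^ S k)%C.
    field. split; auto. apply Cpow_nz; auto.
Qed.

Lemma not_pole_holo (h : C -> C) (z : C) : meromorphic h -> ~ is_pole h z -> holo_at h z.
Proof.
  intros H Hn. destruct (H z) as [[|k] Hk]; auto. exfalso; apply Hn; exists k; auto.
Qed.

Lemma dilate_holo (f : C -> C) (gam z : C) :
  gam <> 0 -> holo_at f (gam * z) -> holo_at (dilate f gam) z.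
Proof.
  intros Hg H. assert (Hm : 0 < Cmod gam) by (apply Cmod_gt_0; auto).
  apply holo_at_cdiff in H. destruct H as [d [Hd H]]. apply holo_at_cdiff.
  exists (d / Cmod gam). split; [apply Rdiv_lt_0_compat; auto|]. intros x Hx. apply cdiff_dilate, H.
  replace (gam * x - gam * z)%C with (gam * (x - z))%C by ring. rewrite Cmod_mult.
  apply (Rmult_lt_compat_l (Cmod gam)) in Hx; auto.
  replace (Cmod gam * (d / Cmod gam)) with d in Hx by (field; lra). auto.
Qed.

Lemma holo_remainder (Kw f : C -> C) (n0 : nat) (a : Z -> C) (gam z : C) (n : Z) :
  holo_at Kw z -> holo_at (dilate f gam) z -> n0 = O \/ z <> 0 ->
  holo_at (remainder Kw f n0 a gam n) z.
Proof.
  intros HK Hf Hz. apply holo_at_cdiff in HK. apply holo_at_cdiff in Hf. apply holo_at_cdiff.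
  destruct HK as [d1 [Hd1 HK]]. destruct Hf as [d2 [Hd2 Hf]].
  destruct Hz as [Hn|Hz].
  - exists (Rmin d1 d2). split; [apply Rmin_pos; auto|]. intros x Hx.
    pose proof (Rmin_l d1 d2). pose proof (Rmin_r d1 d2).
    apply cdiff_remainder; auto; [apply HK|apply Hf]; lra.
  - assert (Hm : 0 < Cmod z) by (apply Cmod_gt_0; auto).
    exists (Rmin (Rmin d1 d2) (Cmod z)). split; [repeat apply Rmin_pos; auto|]. intros x Hx.
    pose proof (Rmin_l d1 d2). pose proof (Rmin_r d1 d2).
    pose proof (Rmin_l (Rmin d1 d2) (Cmod z)). pose proof (Rmin_r (Rmin d1 d2) (Cmod z)).
    apply cdiff_remainder; [apply HK; lra|apply Hf; lra|right]. apply Cmod_gt_0.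
    assert (Cmod z <= Cmod (x - z) + Cmod x) by (rewrite (Cmod_sub_sym x); apply Cmod_sum; ring).
    lra.
Qed.

(** Since [n >= k0 - 1], the pole of the kernel at [0] is cancelled. *)
Lemma remainder_extension (Kw f : C -> C) (k0 n0 : nat) (a : Z -> C) (gam : C) (n : Z) :
  gam <> 0 -> meromorphic Kw -> meromorphic f -> pole_order Kw 0 k0 -> pole_order f 0 n0 ->
  laurent_expansion f n0 a -> (Z.of_nat k0 - 1 <= n)%Z ->
  exists F : C -> C,
    (forall z : C, z <> 0 -> F z = remainder Kw f n0 a gam n z) /\
    (k0 = O -> n0 = O -> forall z, F z = remainder Kw f n0 a gam n z) /\
    (forall z, ~ ((is_pole Kw z \/ is_pole (dilate f gam) z) /\ z <> 0) -> holo_at F z).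
Proof.
  intros Hg HK Hf HpK Hpf HL Hn.
  set (Rm := remainder Kw f n0 a gam n).
  assert (Hnp : forall z, ~ is_pole (dilate f gam) z -> holo_at (dilate f gam) z).
  { intros z Hz. apply dilate_holo; auto. apply not_pole_holo; auto.
    intros Hp. apply Hz. apply dilate_pole; auto. }
  assert (Hoff : forall z : C, z <> 0 -> ~ ((is_pole Kw z \/ is_pole (dilate f gam) z) /\
    z <> 0) -> holo_at Rm z).
  { intros z Hz Hno. apply holo_remainder; auto.
    - apply not_pole_holo; tauto.
    - apply Hnp; tauto. }
  (* Without poles at 0 the original contour may pass through 0, so [F] must keep the value of the
     remainder there. In the other case that contour avoids 0 and the value may be redefined. *)
  destruct (classic (k0 = O /\ n0 = O)) as [[-> ->]|Hkn].
  - exists Rm. split; [auto|]. split; [auto|]. intros z Hz.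
    destruct (classic (z = 0)) as [->|Hz0]; auto.
    apply holo_remainder; auto. apply dilate_holo; auto. replace (gam * 0)%C with (RtoC 0) by ring.
    auto.
  - destruct (pole_order_factor Kw k0 HpK) as [g [d [Hd [Hgd HgE]]]].
    set (p := Z.to_nat (n + 1)).
    assert (Hpn : Z.of_nat p = (n + 1)%Z) by (unfold p; lia).
    (* The kernel is g / z^k0 and the Laurent remainder is (gam z)^p times the quotient. The
       subtraction [p - k0] is exact because n >= k0 - 1. *)
    set (G := fun z => (g z * (gam ^ p * z ^ (p - k0)) * laurent_quotient f n0 a p (gam * z))%C).
    set (F := fun z : C => if excluded_middle_informative (z = 0) then G z else Rm z).
    assert (HFR : forall z : C, z <> 0 -> F z = Rm z).
    { intros z Hz. unfold F. destruct excluded_middle_informative; [contradiction|auto]. }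
    assert (HFG : forall z, Cmod z < d -> G z = F z).
    { intros z Hz. unfold F. destruct excluded_middle_informative as [E|Hz0]; auto.
      unfold G, Rm. rewrite remainder_factor by auto. rewrite HgE by auto.
      unfold laurent_quotient. destruct excluded_middle_informative as [E|_].
      { exfalso. apply (Cmult_neq_0 gam z); auto. }
      replace (Z.of_nat p - 1)%Z with n by lia.
      assert (Ep : (z ^ (p - k0) * z ^ k0)%C = (z ^ p)%C).
      { rewrite <- Cpow_add_r. f_equal. unfold p; lia. }
      rewrite Cpow_mult_l, <- Ep.
      field. repeat split; auto; apply Cpow_nz; auto. }
    exists F. split; auto. split; [intros; exfalso; auto|].
    (* Differentiability of the quotient is known at the point 0 alone; at the nearby points [F] is
       the remainder itself, and the two facts together make it holomorphic at 0. *)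
    assert (HF0 : cdiff F 0).
    { apply (cdiff_ext_loc G F 0 d); auto.
      - intros z' Hz'. apply HFG. replace (z' - 0)%C with z' in Hz' by ring. auto.
      - unfold G. apply cdiff_mult.
        + apply cdiff_mult; [apply Hgd; rewrite Cmod_0; auto|].
          apply cdiff_mult; [apply cdiff_const|apply cdiff_pow].
        + apply (cdiff_dilate (laurent_quotient f n0 a p)).
          replace (gam * 0)%C with (RtoC 0) by ring. apply laurent_quotient_cdiff; auto. }
    intros z Hz. destruct (classic (z = 0)) as [->|Hz0].
    + apply holo_at_cdiff.
      destruct (pole_order_punctured Kw k0 HpK) as [d1 [Hd1 H1]].
      destruct (pole_order_punctured f n0 Hpf) as [d2 [Hd2 H2]].
      assert (Hm : 0 < Cmod gam) by (apply Cmod_gt_0; auto).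
      exists (Rmin d1 (d2 / Cmod gam)).
      split; [apply Rmin_pos; auto; apply Rdiv_lt_0_compat; auto|].
      intros x Hx. replace (x - 0)%C with x in Hx by ring.
      pose proof (Rmin_l d1 (d2 / Cmod gam)). pose proof (Rmin_r d1 (d2 / Cmod gam)).
      destruct (classic (x = 0)) as [->|Hx0]; auto.
      assert (Hmx : 0 < Cmod x) by (apply Cmod_gt_0; auto).
      apply (cdiff_ext_loc Rm F x (Cmod x)); auto.
      * intros z' Hz'. symmetry. apply HFR. apply Cmod_gt_0.
        assert (Cmod x <= Cmod (z' - x) + Cmod z') by (rewrite (Cmod_sub_sym z'); apply Cmod_sum;
          ring). lra.
      * apply cdiff_remainder; auto; [apply H1; auto; lra|].
        apply cdiff_dilate, H2; [|apply Cmult_neq_0; auto].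
        rewrite Cmod_mult.
        assert (Hx2 : Cmod x < d2 / Cmod gam) by lra.
        apply (Rmult_lt_compat_l (Cmod gam)) in Hx2; auto.
        replace (Cmod gam * (d2 / Cmod gam)) with d2 in Hx2 by (field; lra). auto.
    + specialize (Hoff z Hz0 Hz). apply holo_at_cdiff in Hoff. destruct Hoff as [e [He Hoff]].
      apply holo_at_cdiff. assert (Hm : 0 < Cmod z) by (apply Cmod_gt_0; auto).
      exists (Rmin e (Cmod z)). split; [apply Rmin_pos; auto|]. intros x Hx.
      pose proof (Rmin_l e (Cmod z)). pose proof (Rmin_r e (Cmod z)).
      assert (Hx0 : 0 < Cmod x).
      { assert (Cmod z <= Cmod (x - z) + Cmod x) by (rewrite (Cmod_sub_sym x); apply Cmod_sum;
          ring). lra. }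
      apply (cdiff_ext_loc Rm F x (Cmod x)); auto.
      * intros z' Hz'. symmetry. apply HFR. apply Cmod_gt_0.
        assert (Cmod x <= Cmod (z' - x) + Cmod z') by (rewrite (Cmod_sub_sym z'); apply Cmod_sum;
          ring). lra.
      * apply Hoff. lra.
Qed.

(** * Linearity of contour integrals over the complex numbers *)

(** Only real scalars act on [C_R_NormedModule], so a complex factor is applied through the
    components. *)
Lemma is_RInt_Cmult (k : C) (h : R -> C) (p q : R) (l : C) :
  is_RInt (V := C_R_NormedModule) h p q l ->
  is_RInt (V := C_R_NormedModule) (fun t => k * h t)%C p q (k * l)%C.
Proof.
  intros H.
  assert (H1 := is_RInt_fct_extend_fst (U := R_NormedModule) (V := R_NormedModule) h p q l H).
  assert (H2 := is_RInt_fct_extend_snd (U := R_NormedModule) (V := R_NormedModule) h p q l H).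
  apply (is_RInt_fct_extend_pair (U := R_NormedModule) (V := R_NormedModule)
    (fun t => k * h t)%C p q
    (fst k * fst l - snd k * snd l) (fst k * snd l + snd k * fst l)); simpl.
  - apply (is_RInt_minus (V := R_NormedModule)); apply (is_RInt_scal (V := R_NormedModule)); auto.
  - apply (is_RInt_plus (V := R_NormedModule)); apply (is_RInt_scal (V := R_NormedModule)); auto.
Qed.

Lemma is_RInt_gen_Cmult (k : C) (h : R -> C) (Fa Fb : (R -> Prop) -> Prop) (l : C) :
  Filter Fa -> Filter Fb ->
  is_RInt_gen (V := C_R_NormedModule) h Fa Fb l ->
  is_RInt_gen (V := C_R_NormedModule) (fun t => k * h t)%C Fa Fb (k * l)%C.
Proof.
  intros HFa HFb H P HP. apply locally_C_iff in HP. destruct HP as [e [He HP]].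
  pose proof (Cmod_ge_0 k) as Hk.
  assert (Hl : locally (T := C_UniformSpace) l (fun z => Cmod (z - l) < e / (1 + Cmod k))).
  { apply locally_C_iff. exists (e / (1 + Cmod k)). split; auto. apply Rdiv_lt_0_compat; lra. }
  specialize (H _ Hl). unfold filtermapi in *. revert H. apply filter_imp.
  intros [p q] [y [Hy Hyl]]. exists (k * y)%C. split; [apply is_RInt_Cmult; auto|].
  apply HP. replace (k * y - k * l)%C with (k * (y - l))%C by ring. rewrite Cmod_mult.
  assert (e = (1 + Cmod k) * (e / (1 + Cmod k))) by (field; lra).
  pose proof (Cmod_ge_0 (y - l)). nra.
Qed.

Lemma path_integrand_psum (u : nat -> C -> C) (k : nat -> C) (g : R -> C) (n : nat)
    (t : R) :
  path_integrand (fun z => psum (fun j => k j * u j z)%C n) g t =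
  psum (fun j => k j * path_integrand (u j) g t)%C n.
Proof.
  unfold path_integrand. induction n as [|n IH]; [rewrite !psum_0; ring|].
  rewrite !psum_S, <- IH. ring.
Qed.

Lemma is_RInt_gen_psum (h : nat -> R -> C) (l : nat -> C) (Fa Fb :
    (R -> Prop) -> Prop) (n : nat) :
  Filter Fa -> Filter Fb ->
  (forall j, (j < n)%nat -> is_RInt_gen (V := C_R_NormedModule) (h j) Fa Fb (l j)) ->
  is_RInt_gen (V := C_R_NormedModule) (fun t => psum (fun j => h j t) n) Fa Fb (psum l n).
Proof.
  intros HFa HFb. induction n as [|n IH]; intros H.
  - rewrite psum_0. intros P HP. unfold filtermapi. apply filter_forall. intros [p q].
    exists (RtoC 0). split; [|apply (locally_singleton _ _ HP)].
    assert (Hc := is_RInt_const (V := C_R_NormedModule) p q (RtoC 0)).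
    rewrite (scal_zero_r (V := C_R_NormedModule)) in Hc. exact Hc.
  - rewrite psum_S.
    apply (is_RInt_gen_ext (V := C_R_NormedModule) (fun t => psum (fun j => h j t) n + h n t)%C).
    + apply filter_forall. intros [p q] t _. symmetry; apply psum_S.
    + apply (is_RInt_gen_plus (V := C_R_NormedModule)); auto.
Qed.

(** * Open ends *)

Definition negligible (F : C -> C) (H : R -> R -> C) (e : (R -> Prop) -> Prop) : Prop :=
  forall eps, 0 < eps -> e (small_transversal F H eps).

Lemma negligible_end_negligible (F : C -> C) (H : R -> R -> C) (e : (R -> Prop) -> Prop) :
  Filter e -> negligible_end F H e -> negligible F H e.
Proof.
  intros He [H1 H2] eps Heps.
  assert (HP : locally (T := C_UniformSpace) (RtoC 0) (fun z => Cmod (z - 0) < eps)).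
  { apply locally_C_iff. exists eps; auto. }
  specialize (H2 _ HP). unfold filtermap in H2.
  assert (H3 := filter_and _ _ H1 H2). revert H3. apply filter_imp. intros t [Hex Hsm].
  eexists. split; [apply (RInt_correct (V := C_R_CompleteNormedModule)); exact Hex|].
  assert (E : forall x : C, Cmod x = Cmod (x - 0)) by (intros; f_equal; ring).
  eapply Rle_lt_trans; [|exact Hsm]. right. apply E.
Qed.

Lemma negligible_combination (F : C -> C) (u : nat -> C -> C) (k : nat -> C) (n : nat)
    (H : R -> R -> C) (e : (R -> Prop) -> Prop) :
  Filter e -> negligible F H e -> (forall j, (j < n)%nat -> negligible (u j) H e) ->
  negligible (fun z => F z - psum (fun j => k j * u j z) n)%C H e.
Proof.
  intros He HF. induction n as [|n IH]; intros Hu.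
  - intros eps Heps. generalize (HF eps Heps). apply filter_imp. intros t [T [HT HTe]].
    exists T. split; auto. revert HT. apply is_RInt_ext. intros s _. unfold path_integrand.
    match goal with |- ?x = ?y => change (@eq C x y) end. rewrite psum_0. ring.
  - specialize (IH (fun j Hj => Hu j (Nat.lt_lt_succ_r _ _ Hj))).
    intros eps Heps. pose proof (Cmod_ge_0 (k n)) as Hk.
    assert (H1 := IH (eps / 2) ltac:(lra)).
    assert (Hpos : 0 < eps / (2 * (1 + Cmod (k n)))) by (apply Rdiv_lt_0_compat; lra).
    assert (H2 := Hu n (Nat.lt_succ_diag_r n) _ Hpos).
    generalize (filter_and _ _ H1 H2). apply filter_imp. intros t [[T [HT HTe]] [T' [HT' HTe']]].
    exists (T - k n * T')%C. split.
    + apply (is_RInt_Cmult (k n)) in HT'.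
      generalize (is_RInt_minus (V := C_R_NormedModule) _ _ _ _ _ _ HT HT').
      apply is_RInt_ext. intros s _. unfold path_integrand. rewrite psum_S.
      match goal with |- minus ?x ?y = ?z => change ((x - y)%C = z) end. ring.
    + unfold Cminus. eapply Rle_lt_trans; [apply Cmod_triangle|]. rewrite Cmod_opp, Cmod_mult.
      assert (Cmod (k n) * Cmod T' <= eps / 2); [|lra].
      apply Rle_trans with ((1 + Cmod (k n)) * (eps / (2 * (1 + Cmod (k n))))).
      * apply Rmult_le_compat; try lra. apply Cmod_ge_0.
      * right; field; lra.
Qed.

Lemma lifted1_exists (F : C -> C) (g : R -> C) (p q : R) : p <= q ->
  (forall t, p <= t <= q -> path_cont (fun t => p <= t <= q) g t) ->
  (forall t, p <= t <= q -> holo_at F (g t)) -> exists phi, lifted1 F g p q phi.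
Proof.
  intros Hpq Hg HF.
  destruct (lift_exists F (fun _ t => g t) 0 1 p q) as [Phi L]; auto; [lra| | |].
  - intros s t [_ Ht] eps He. destruct (Hg t Ht eps He) as [d [Hd H']].
    exists d; split; auto. intros s' t' [_ Ht'] _ Htt. auto.
  - intros s t [_ Ht]. apply holo_at_cdiff; auto.
  - exists (fun t => Phi 0 t). apply (lifted_slice_s F (fun _ t => g t) 0 1); auto; lra.
Qed.

(** The values of an integrand at [0] do not contribute to its integral along a
    path: an interval on which the path stays at [0] is one on which its
    derivative vanishes. *)
Lemma small_transversal_off_zero (F G : C -> C) (H : R -> R -> C) (eps t : R) :
  (forall z : C, z <> 0 -> F z = G z) -> piecewise_C1 (fun s => H s t) 0 1 ->
  (forall s, 0 <= s <= 1 -> holo_at F (H s t)) ->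
  small_transversal G H eps t -> small_transversal F H eps t.
Proof.
  intros E Hp HF [T [HT HTe]]. exists T. split; auto.
  set (g := fun s => H s t) in *.
  destruct (lifted1_exists F g 0 1) as [phi L]; auto; [lra|apply piecewise_C1_cont; auto|].
  assert (Hcd : forall s, 0 <= s <= 1 -> cdiff F (g s)).
  { intros s Hs. specialize (HF s Hs). apply holo_at_cdiff in HF. destruct HF as [d [Hd H']].
    apply H'. rewrite Cmod_diag; auto. }
  assert (HI := lifted1_RInt F g 0 1 Hp phi Hcd L).
  assert (Hd : (phi 1 - phi 0 - T)%C = RtoC 0).
  { apply (is_RInt_dense_zero (fun s => path_integrand F g s - path_integrand G g s)%C 0 1);
      [lra| |].
    - apply (is_RInt_minus (V := C_R_NormedModule) _ _ _ _ _ _ HI HT).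
    - intros x y Hx Hxy Hy. apply NNPP. intros Hno.
      assert (Hz : forall s, x <= s <= y -> g s = 0).
      { intros s Hs. apply NNPP. intros Hne. apply Hno. exists s. split; auto.
        unfold path_integrand. rewrite E by auto. ring. }
      apply Hno. exists ((x + y) / 2). split; [lra|].
      unfold path_integrand. rewrite (pderiv_curve_deriv g ((x + y) / 2) 0); [ring|].
      intros e He. exists ((y - x) / 2). split; [lra|]. intros s Hs. apply Rabs_def2 in Hs.
      rewrite !Hz by lra. replace (0 - 0 - RtoC (s - (x + y) / 2) * 0)%C with (RtoC 0) by ring.
      rewrite Cmod_0. pose proof (Rabs_pos (s - (x + y) / 2)). nra. }
  replace T with (phi 1 - phi 0)%C; auto.
  apply Cmod_sub_eq0. rewrite Hd, Cmod_0. lra.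
Qed.

Lemma negligible_remainder (Kw f F : C -> C) (n0 : nat) (a : Z -> C) (gam : C) (n : Z)
    (H : R -> R -> C) (e : (R -> Prop) -> Prop) :
  Filter e -> (- Z.of_nat n0 - 1 <= n)%Z ->
  (forall F, integrands Kw f n0 gam F -> negligible_end F H e) ->
  (forall z : C, z <> 0 -> F z = remainder Kw f n0 a gam n z) ->
  e (fun t => piecewise_C1 (fun s => H s t) 0 1) ->
  e (fun t => forall s, 0 <= s <= 1 -> holo_at F (H s t)) ->
  negligible F H e.
Proof.
  intros He Hn HFs HF Hp Hh eps Heps.
  assert (Hneg : negligible (remainder Kw f n0 a gam n) H e).
  { apply (negligible_combination (transform_integrand Kw f gam)
      (fun j => moment_integrand Kw (laurent_index n0 j))
      (fun j => a (laurent_index n0 j) * Cpowz gam (laurent_index n0 j))%C); auto.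
    - apply negligible_end_negligible; auto. apply HFs. left; auto.
    - intros j _. apply negligible_end_negligible; auto. apply HFs. right.
      exists (laurent_index n0 j). split; auto. unfold laurent_index; lia. }
  generalize (filter_and _ _ (Hneg eps Heps) (filter_and _ _ Hp Hh)). apply filter_imp.
  intros t [H1 [H2 H3]]. apply (small_transversal_off_zero F (remainder Kw f n0 a gam n)); auto.
Qed.

Lemma remainder_integral (K : C -> C -> C) (Gam : C -> R -> C) (f : C -> C) (n0 : nat)
    (a : Z -> C)
    (gam w : C) (n : Z) :
  ex_contour_int (transform_integrand (K w) f gam) (Gam w) ->
  (forall m, (- Z.of_nat n0 <= m)%Z -> ex_contour_int (moment_integrand (K w) m) (Gam w)) ->
  is_RInt_gen (V := C_R_NormedModule) (path_integrand (remainder (K w) f n0 a gam n) (Gam w))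
    (at_right 0) (at_left 1) (transform K Gam f gam w - formal_transform K Gam n0 a gam n w)%C.
Proof.
  intros HT HM.
  assert (H1 : is_RInt_gen (V := C_R_NormedModule)
    (path_integrand (transform_integrand (K w) f gam) (Gam w)) (at_right 0) (at_left 1)
    (transform K Gam f gam w)).
  { apply (RInt_gen_correct (V := C_R_CompleteNormedModule)). exact HT. }
  set (k := fun j => (a (laurent_index n0 j) * Cpowz gam (laurent_index n0 j))%C).
  set (N := Z.to_nat (n + Z.of_nat n0 + 1)).
  assert (H2 : is_RInt_gen (V := C_R_NormedModule)
    (fun t => psum (fun j => k j * path_integrand (moment_integrand (K w) (laurent_index n0 j))
      (Gam w) t)%C N)
    (at_right 0) (at_left 1)
    (psum (fun j => k j * moment K Gam (laurent_index n0 j) w)%C N)).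
  { apply (is_RInt_gen_psum (fun j t => k j * path_integrand (moment_integrand (K w)
      (laurent_index n0 j)) (Gam w) t)%C).
    - apply within_filter, locally_filter.
    - apply within_filter, locally_filter.
    - intros j _. apply is_RInt_gen_Cmult.
      + apply within_filter, locally_filter.
      + apply within_filter, locally_filter.
      + apply (RInt_gen_correct (V := C_R_CompleteNormedModule)). apply HM.
        unfold laurent_index; lia. }
  replace (formal_transform K Gam n0 a gam n w)
    with (psum (fun j => k j * moment K Gam (laurent_index n0 j) w)%C N).
  - generalize (is_RInt_gen_minus (V := C_R_NormedModule) _ _ _ _ H1 H2).
    apply is_RInt_gen_ext. apply filter_forall. intros [p q] t _.
    rewrite <- path_integrand_psum. unfold path_integrand, remainder.
    rewrite partial_sum_psum.
    match goal with |- minus ?x ?y = ?z => change ((x - y)%C = z) end. unfold k. fold N. ring.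
  - unfold formal_transform. rewrite partial_sum_psum. apply psum_ext. intros j _.
    unfold k, formal_coef. ring.
Qed.

(** The exponent [k] is left open between n and n + 1, because n = k0 - 1 requires the larger one
    and the other orders use the smaller. The radius [r] is fixed throughout the contour estimate,
    and the infimum is taken by [cprime_ge]. *)
Lemma transform_estimate (K : C -> C -> C) (f : C -> C) (ct : curve_type)
    (Gam Gam' : C -> R -> C)
    (k0 n0 : nat) (a : Z -> C) (d : nat) (tau : nat -> R)
    (b c delta1 delta2 cw cg : R) (w gam : C) (n k : Z) :
  gam <> 0 -> meromorphic (K w) -> meromorphic f -> is_curve ct (Gam w) ->
  (forall t, dom ct t -> ~ is_pole (K w) (Gam w t) /\ ~ is_pole (dilate f gam) (Gam w t)) ->
  ex_contour_int (transform_integrand (K w) f gam) (Gam w) ->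
  (forall m, (- Z.of_nat n0 <= m)%Z -> ex_contour_int (moment_integrand (K w) m) (Gam w)) ->
  pole_order (K w) 0 k0 -> pole_order f 0 n0 -> laurent_expansion f n0 a ->
  deformable ct (fun z => ~ ((is_pole (K w) z \/ is_pole (dilate f gam) z) /\ z <> 0))
    (integrands (K w) f n0 gam) (Gam w) (Gam' w) ->
  smooth_segments ct d tau (Gam' w) -> 0 < b -> angle_condition d b tau (Gam' w) ->
  0 < c -> 0 < delta2 -> 0 < delta1 - delta2 -> 0 <= cw -> c <= cg ->
  (forall t, dom ct t -> Gam' w t <> 0 ->
     Cmod (K w (Gam' w t)) <= cw * exp (- delta1 * Cmod (Gam' w t)) / Cmod (Gam' w t) ^ k0) ->
  (forall t, dom ct t -> Gam' w t <> 0 ->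
     Cmod (dilate f gam (Gam' w t)) <= cg * exp (delta2 * Cmod (Gam' w t)) / Cmod
       (gam * Gam' w t) ^ n0) ->
  (Z.of_nat k0 - 1 <= n)%Z -> (Z.of_nat k0 <= k)%Z -> (k = n \/ k = n + 1)%Z ->
  Cmod (transform K Gam f gam w - formal_transform K Gam n0 a gam n w) <=
    INR d * (cw * (cg / c * powerRZ (Cmod gam) k) / b *
      (INR (fact (Z.to_nat (k - Z.of_nat k0))) / (delta1 - delta2) ^ S (Z.to_nat
        (k - Z.of_nat k0))))
    * cprime f n0 a c k.
Proof.
  intros Hg HK Hf Hcurve Havoid HexT HexM HpK Hpf HL Hdef Hseg Hb Hang Hc Hd2 Hd Hcw Hcg HKb Hfb Hn Hk Hkn.
  set (l := Z.to_nat (k - Z.of_nat k0)).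
  set (I := (transform K Gam f gam w - formal_transform K Gam n0 a gam n w)%C).
  assert (HI := remainder_integral K Gam f n0 a gam w n HexT HexM). fold I in HI.
  destruct (remainder_extension (K w) f k0 n0 a gam n Hg HK Hf HpK Hpf HL Hn) as [F [HF0 [HF00 HFh]]].
  assert (Hgm : 0 < Cmod gam) by (apply Cmod_gt_0; auto).
  assert (Hcgc : 0 < cg / c) by (apply Rdiv_lt_0_compat; lra).
  assert (Hfact : 0 <= INR (fact l) / (delta1 - delta2) ^ S l).
  { apply Rdiv_le_0_compat; [apply pos_INR|apply pow_lt; auto]. }
  assert (Hpg : 0 < powerRZ (Cmod gam) k) by (apply powerRZ_pos; auto).
  assert (HA0 : 0 <= cw * (cg / c * powerRZ (Cmod gam) k)).
  { apply Rmult_le_pos; auto. apply Rmult_le_pos; lra. }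
  apply cprime_ge; auto; [eapply pole_radius_pos; eauto| |].
  { apply Rmult_le_pos; [apply pos_INR|]. apply Rmult_le_pos; auto. apply Rdiv_le_0_compat; auto. }
  intros r Hr0 Hr.
  set (X := 1 / powerRZ r k * (c * powerRZ r (- Z.of_nat n0) + kappa n0 a r)).
  assert (HX : 0 <= X).
  { pose proof (kappa_ge_0 f n0 a r HL Hr0 Hr). pose proof (powerRZ_pos r k Hr0).
    pose proof (powerRZ_pos r (- Z.of_nat n0) Hr0).
    apply Rmult_le_pos; [apply Rdiv_le_0_compat; lra|nra]. }
  set (A := cw * (cg / c * powerRZ (Cmod gam) k) * X).
  replace (INR d * (cw * (cg / c * powerRZ (Cmod gam) k) / b * (INR (fact l) /
    (delta1 - delta2) ^ S l)) * X)
    with (INR d * (A / b * (INR (fact l) / (delta1 - delta2) ^ S l))) by (unfold A; field;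
      repeat split; try lra; apply pow_nonzero; lra).
  assert (HFb : forall t, dom ct t -> Gam' w t <> 0 ->
    Cmod (F (Gam' w t)) <= A * (Cmod (Gam' w t) ^ l * exp (- (delta1 - delta2) * Cmod (Gam' w t)))).
  { intros t Ht Hz. specialize (HKb t Ht Hz). specialize (Hfb t Ht Hz).
    set (z := Gam' w t) in *. assert (Hzm : 0 < Cmod z) by (apply Cmod_gt_0; auto).
    rewrite HF0, remainder_factor, Cmod_mult by auto.
    assert (He : 1 <= exp (delta2 * Cmod z)).
    { pose proof (exp_ineq1_le (delta2 * Cmod z)). nra. }
    assert (HR := laurent_remainder f n0 a (gam * z) r c cg (exp (delta2 * Cmod z)) n k HL
      (Cmult_neq_0 _ _ Hg Hz) Hr0 Hr (conj Hc Hcg) He ltac:(lia) ltac:(lia) Hkn Hfb).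
    fold X in HR. rewrite Cmod_mult, powerRZ_mult in HR.
    eapply Rle_trans; [apply Rmult_le_compat;
      [apply Cmod_ge_0|apply Cmod_ge_0|exact HKb|exact HR]|].
    (* Of the [k] powers of |z|, [k0] cancel the pole of the kernel and [l] remain for the arc
       estimate; the exponentials combine to the rate [delta1 - delta2]. *)
    right. replace (powerRZ (Cmod z) k) with (Cmod z ^ k0 * Cmod z ^ l).
    - replace (- (delta1 - delta2) * Cmod z) with (- delta1 * Cmod z + delta2 * Cmod z) by ring.
      rewrite exp_plus. unfold A. field. split; [lra|]. apply pow_nonzero; lra.
    - rewrite <- pow_add, pow_powerRZ. f_equal. unfold l. lia. }
  destruct Hdef as [H [Hcont [Hends [HOm [Hloop [Hlb [Hrb [Hlo Hro]]]]]]]].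
  destruct Hcurve as [Hpc _].
  assert (Hho : forall s t, 0 <= s <= 1 -> dom ct t -> holo_at F (H s t)) by (intros; apply HFh;
    auto).
  assert (HA : 0 <= A) by (apply Rmult_le_pos; auto).
  apply (deformation_bound ct F H (Gam w) (Gam' w) I); auto.
  - intros Hopen. destruct (Hlo Hopen) as [Hp Hneg]. split; auto.
    apply (negligible_remainder (K w) f F n0 a gam n); auto;
      [apply within_filter, locally_filter|lia|].
    apply at_right_0_iff. exists 1. split; [lra|]. intros t Ht s Hs. apply Hho; auto.
    destruct ct as [|[] []]; simpl; lra.
  - intros Hopen. destruct (Hro Hopen) as [Hp Hneg]. split; auto.
    apply (negligible_remainder (K w) f F n0 a gam n); auto;
      [apply within_filter, locally_filter|lia|].
    apply at_left_1_iff. exists 1. split; [lra|]. intros t Ht s Hs. apply Hho; auto.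
    destruct ct as [|[] []]; simpl; lra.
  (* The known integral is that of the remainder. If the original contour meets 0, then 0 is a pole
     of neither factor, so [k0 = n0 = 0] and [F] agrees with the remainder there as well. *)
  - revert HI. apply is_RInt_gen_ext.
    assert (Hdom : forall t, 0 < t < 1 -> dom ct t) by (intros t Ht; destruct ct as [|[] []];
      simpl; lra).
    apply (Filter_prod _ _ _ (fun p => 0 < p < 1) (fun q => 0 < q < 1)).
    + apply at_right_0_iff. exists 1. split; [lra|auto].
    + apply at_left_1_iff. exists 1. split; [lra|]. intros; lra.
    + intros p q Hp Hq t Ht. simpl in Ht.
      assert (Ht1 : 0 < t < 1).
      { unfold Rmin, Rmax in Ht. destruct (Rle_dec p q); lra. }
      unfold path_integrand. f_equal.
      destruct (classic (Gam w t = 0)) as [E|Hne]; [|symmetry; apply HF0; auto].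
      symmetry. apply HF00; destruct (Havoid t (Hdom t Ht1)) as [N1 N2]; rewrite E in N1, N2.
      * destruct k0 as [|k1]; auto. exfalso; apply N1; exists k1; auto.
      * destruct n0 as [|n1]; auto. exfalso; apply N2. apply dilate_pole; auto.
        replace (gam * 0)%C with (RtoC 0) by ring. exists n1; auto.
  - intros p q phi Hp Hpq Hq L.
    apply (contour_bound ct d l tau F (Gam' w) A b
      (delta1 - delta2) Hseg Hang Hb Hd HA HFb p q phi); auto.
Qed.

(** * The constants and the asymptotic expansion *)

(** From PI <= 4 one gets PI (1 + 2l) <= 4 (l + 1)^2, so the root is at most 2 (l + 1). This weakens
    the factorial of the arc estimate to the form of the stated constant. *)
Lemma fact_sqrt_bound (l : nat) :
  INR (fact l) <= 2 / sqrt (PI * (1 + 2 * INR l)) * INR (fact (S l)).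
Proof.
  pose proof (pos_INR l) as Hl. pose proof PI_RGT_0 as HP. pose proof PI_4 as HP4.
  assert (Hs : 0 < sqrt (PI * (1 + 2 * INR l))) by (apply sqrt_lt_R0; nra).
  assert (Hle : sqrt (PI * (1 + 2 * INR l)) <= 2 * (INR l + 1)).
  { rewrite <- (sqrt_square (2 * (INR l + 1))) by lra. apply sqrt_le_1_alt. nra. }
  change (fact (S l)) with (S l * fact l)%nat. rewrite mult_INR, S_INR.
  assert (Hf : 0 < INR (fact l)) by apply INR_fact_lt_0.
  apply (Rmult_le_reg_r (sqrt (PI * (1 + 2 * INR l)))); auto.
  replace (2 / sqrt (PI * (1 + 2 * INR l)) * ((INR l + 1) * INR (fact l)) * sqrt (PI *
    (1 + 2 * INR l)))
    with (INR (fact l) * (2 * (INR l + 1))) by (field; lra).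
  apply Rmult_le_compat_l; lra.
Qed.

Lemma cprime_ge_0 (f : C -> C) (n0 : nat) (a : Z -> C) (c : R) (k : Z) :
  laurent_expansion f n0 a -> pole_order f 0 n0 -> 0 < c -> 0 <= cprime f n0 a c k.
Proof.
  intros HL Hp Hc. rewrite <- (Rmult_1_l (cprime f n0 a c k)).
  apply cprime_ge; auto; [eapply pole_radius_pos; eauto|lra|].
  intros r Hr0 Hr. rewrite Rmult_1_l.
  pose proof (kappa_ge_0 f n0 a r HL Hr0 Hr). pose proof (powerRZ_pos r k Hr0).
  pose proof (powerRZ_pos r (- Z.of_nat n0) Hr0).
  apply Rmult_le_pos; [apply Rdiv_le_0_compat; lra|nra].
Qed.

Lemma powerRZ_neg_nat (x : R) (m : nat) : powerRZ x (- Z.of_nat m) = / x ^ m.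
Proof. rewrite powerRZ_neg', <- pow_powerRZ. reflexivity. Qed.

Lemma estimate_constant (f : C -> C) (n0 k0 d : nat) (a : Z -> C)
    (b c cw cg delta : R) (gam : C) (n : Z) :
  gam <> 0 -> laurent_expansion f n0 a -> pole_order f 0 n0 -> 0 < b -> 0 < c -> 0 <= cw ->
    0 < cg ->
  0 < delta -> (Z.of_nat k0 - 1 <= n)%Z ->
  exists k, (Z.of_nat k0 <= k)%Z /\ (k = n \/ k = n + 1)%Z /\
    INR d * (cw * (cg / c * powerRZ (Cmod gam) k) / b *
      (INR (fact (Z.to_nat (k - Z.of_nat k0))) / delta ^ S (Z.to_nat (k - Z.of_nat k0))))
    * cprime f n0 a c k <=
    Cconst f n0 a k0 d b c delta gam n * cw * cg * powerRZ (Cmod gam) n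
      * powerRZ delta (- (n - Z.of_nat k0 + 1)) * INR (fact (Z.to_nat (n - Z.of_nat k0 + 1))).
Proof.
  intros Hg HL Hp Hb Hc Hcw Hcg Hd Hn.
  assert (Hgm : 0 < Cmod gam) by (apply Cmod_gt_0; auto).
  unfold Cconst. destruct (Z.eqb_spec n (Z.of_nat k0 - 1)) as [E|E].
  (* Here k = n + 1, so the factorial is 0!. The stated power of [delta] has exponent 0; the factor
     1 / delta and one power of |gam| are accounted for by [Cconst]. *)
  - exists (Z.of_nat k0). split; [lia|]. split; [right; lia|].
    replace (n - Z.of_nat k0 + 1)%Z with 0%Z by lia. rewrite Z.sub_diag. simpl.
    replace (powerRZ (Cmod gam) (Z.of_nat k0)) with (Cmod gam * powerRZ (Cmod gam) n).
    + right. field. lra.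
    + replace (Z.of_nat k0) with (1 + n)%Z by lia. rewrite powerRZ_add by lra. simpl. ring.
  (* The arc estimate has l! with l = n - k0, the stated bound (l + 1)!; the powers of [delta]
     already agree, and [fact_sqrt_bound] settles the rest. *)
  - exists n. split; [lia|]. split; [auto|].
    set (l := Z.to_nat (n - Z.of_nat k0)).
    replace (n - Z.of_nat k0 + 1)%Z with (Z.of_nat (S l)) by (unfold l; lia).
    rewrite Nat2Z.id, powerRZ_neg_nat.
    replace (IZR (n - Z.of_nat k0)) with (INR l) by (unfold l; rewrite INR_IZR_INZ; f_equal; lia).
    pose proof (cprime_ge_0 f n0 a c n HL Hp Hc) as Hcp.
    pose proof (fact_sqrt_bound l) as Hfs.
    assert (Hs : 0 < sqrt (PI * (1 + 2 * INR l))).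
    { apply sqrt_lt_R0. pose proof (pos_INR l). pose proof PI_RGT_0. nra. }
    assert (Hdl : 0 < delta ^ S l) by (apply pow_lt; auto).
    pose proof (powerRZ_pos (Cmod gam) n Hgm) as Hpg.
    set (Y := INR d * cw * cg * powerRZ (Cmod gam) n * cprime f n0 a c n / (b * c * delta ^ S l)).
    assert (HY : 0 <= Y).
    { unfold Y. apply Rdiv_le_0_compat; [|apply Rmult_lt_0_compat; [nra|auto]].
      pose proof (pos_INR d). repeat apply Rmult_le_pos; lra. }
    replace (INR d * (cw * (cg / c * powerRZ (Cmod gam) n) / b * (INR
      (fact l) / delta ^ S l)) * cprime f n0 a c n)
      with (Y * INR (fact l)) by (unfold Y; field; repeat split; lra).
    replace (2 * INR d / (b * c * sqrt (PI *
      (1 + 2 * INR l))) * cprime f n0 a c n * cw * cg * powerRZ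
        (Cmod gam) n * / delta ^ S l * INR (fact (S l)))
      with (Y * (2 / sqrt (PI * (1 + 2 * INR l)) * INR (fact (S l)))) by (unfold Y; field;
        repeat split; lra).
    apply Rmult_le_compat_l; auto.
Qed.

Lemma partial_sum_tail (n0 : nat) (u : Z -> C) (n : Z) (p : nat) :
  (- Z.of_nat n0 - 1 <= n)%Z ->
  exists M, 0 <= M /\ forall gam : C, gam <> 0 -> Cmod gam <= 1 ->
    Cmod (partial_sum n0 (fun m => u m * Cpowz gam m)%C (n + Z.of_nat p) -
          partial_sum n0 (fun m => u m * Cpowz gam m)%C n) <= M * powerRZ (Cmod gam) (n + 1).
Proof.
  intros Hn. induction p as [|p [M [HM IH]]].
  - exists 0. split; [lra|]. intros gam _ _. rewrite Z.add_0_r, Cmod_diag. lra.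
  - exists (M + Cmod (u (n + Z.of_nat (S p))%Z)). pose proof (Cmod_ge_0 (u (n + Z.of_nat (S p))%Z)).
    split; [lra|]. intros gam Hg Hg1. specialize (IH gam Hg Hg1).
    assert (Hgm : 0 < Cmod gam) by (apply Cmod_gt_0; auto).
    replace (n + Z.of_nat (S p))%Z with (n + Z.of_nat p + 1)%Z in * by lia.
    rewrite partial_sum_succ by lia.
    set (x := partial_sum n0 (fun m => u m * Cpowz gam m)%C (n + Z.of_nat p)) in *.
    set (y := partial_sum n0 (fun m => u m * Cpowz gam m)%C n) in *.
    eapply Rle_trans; [apply (Cmod_sum _ (x - y) (u (n + Z.of_nat p + 1)%Z * Cpowz gam
      (n + Z.of_nat p + 1))); ring|].
    rewrite Cmod_mult, Cmod_Cpowz by auto.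
    assert (powerRZ (Cmod gam) (n + Z.of_nat p + 1) <= powerRZ (Cmod gam) (n + 1))
      by (apply powerRZ_anti; [lra|lia]).
    nra.
Qed.

(** The estimate at order n cannot beat |gam|^n by itself, and [cgam] may consume N more powers. It
    is applied at a higher order, and the additional terms of the sum are O(|gam|^(n+1)) by
    [partial_sum_tail]. *)
Lemma poincare_of_estimates (U : C -> Prop) (G : C -> C) (n0 : nat) (coef : Z -> C)
    (cgam : C -> R)
    (k : Z) (A : Z -> R) (N : nat) (M rho : R) :
  ~ U 0 -> 0 < rho -> (forall n, 0 <= A n) ->
  (forall gam, U gam -> Cmod gam < rho -> cgam gam * Cmod gam ^ N <= M) ->
  (forall n gam, (k <= n)%Z -> U gam ->
     Cmod (G gam - partial_sum n0 (fun m => coef m * Cpowz gam m)%C n) <=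
       A n * cgam gam * powerRZ (Cmod gam) n) ->
  poincare_expansion U G n0 coef.
Proof.
  intros HU Hrho HA HM Hest n Hn eps Heps.
  (* The first summand brings the order up to [k], where the estimate starts; [N] pays for the
     growth of [cgam]; the last power makes the error small relative to |gam|^n. *)
  set (p := (Z.to_nat (Z.max 0 (k - n)) + N + 1)%nat).
  set (n' := (n + Z.of_nat p)%Z).
  destruct (partial_sum_tail n0 coef n p ltac:(lia)) as [M' [HM' Htail]].
  set (B := A n' * Rabs M + M').
  assert (HB : 0 <= B).
  { unfold B. pose proof (Rabs_pos M). specialize (HA n'). nra. }
  exists (Rmin (Rmin rho 1) (eps / (B + 1))).
  split; [repeat apply Rmin_pos; try lra; apply Rdiv_lt_0_compat; lra|].
  intros gam Hgam Hsm.
  pose proof (Rmin_l (Rmin rho 1) (eps / (B + 1))).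
  pose proof (Rmin_r (Rmin rho 1) (eps / (B + 1))).
  pose proof (Rmin_l rho 1). pose proof (Rmin_r rho 1).
  assert (Hg : gam <> 0) by (intros E; apply HU; rewrite <- E; auto).
  assert (Hgm : 0 < Cmod gam) by (apply Cmod_gt_0; auto).
  specialize (Htail gam Hg ltac:(lra)). fold n' in Htail.
  assert (Hn' := Hest n' gam ltac:(unfold n', p; lia) Hgam).
  specialize (HM gam Hgam ltac:(lra)).
  assert (Hpn : 0 < powerRZ (Cmod gam) (n + 1)) by (apply powerRZ_pos; auto).
  assert (Hcg : cgam gam * powerRZ (Cmod gam) n' <= Rabs M * powerRZ (Cmod gam) (n + 1)).
  { replace n' with (Z.of_nat N + (n' - Z.of_nat N))%Z by lia.
    rewrite powerRZ_add, <- pow_powerRZ by lra.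
    rewrite <- Rmult_assoc.
    assert (Hpp : powerRZ (Cmod gam) (n' - Z.of_nat N) <= powerRZ (Cmod gam) (n + 1)).
    { apply powerRZ_anti; [lra|]. unfold n', p; lia. }
    assert (0 < powerRZ (Cmod gam) (n' - Z.of_nat N)) by (apply powerRZ_pos; auto).
    apply Rle_trans with (Rabs M * powerRZ (Cmod gam) (n' - Z.of_nat N)).
    - apply Rmult_le_compat_r; [lra|]. pose proof (Rle_abs M). lra.
    - apply Rmult_le_compat_l; auto. apply Rabs_pos. }
  assert (Hfin : Cmod (G gam - partial_sum n0 (fun m => coef m * Cpowz gam m)%C n) <=
    B * powerRZ (Cmod gam) (n + 1)).
  { eapply Rle_trans; [apply (Cmod_sum _ (G gam - partial_sum n0
      (fun m => coef m * Cpowz gam m)%C n')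
      (partial_sum n0 (fun m => coef m * Cpowz gam m)%C n' - partial_sum n0
        (fun m => coef m * Cpowz gam m)%C n)); ring|].
    assert (A n' * cgam gam * powerRZ (Cmod gam) n' <=
      A n' * (Rabs M * powerRZ (Cmod gam) (n + 1))).
    { rewrite Rmult_assoc. apply Rmult_le_compat_l; auto. }
    unfold B. lra. }
  apply Rle_trans with (1 := Hfin). rewrite powerRZ_add by lra. simpl (powerRZ (Cmod gam) 1).
  assert (Hp0 : 0 < powerRZ (Cmod gam) n) by (apply powerRZ_pos; auto).
  replace (B * (powerRZ (Cmod gam) n * (Cmod gam * 1)))
    with (B * Cmod gam * powerRZ (Cmod gam) n) by ring.
  apply Rmult_le_compat_r; [lra|].
  apply Rle_trans with ((B + 1) * (eps / (B + 1))); [apply Rmult_le_compat; lra|].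
  right; field; lra.
Qed.

Theorem theorem1 :
  forall (W U : C -> Prop) (K : C -> C -> C) (f : C -> C)
    (ct : curve_type) (Gam : C -> R -> C)
    (k0 n0 : nat) (a : Z -> C)
    (Gam' : C -> R -> C) (d : nat) (tau : C -> nat -> R)
    (b c delta1 delta2 : R) (cw cgam : C -> R),
  open W -> connected W ->
  open U -> connected U -> (exists gam, U gam) ->
  closure U 0 -> ~ U 0 ->
  meromorphic_kernel W K ->
  meromorphic f ->
  continuous_family W ct Gam ->
  (forall w gam t, W w -> U gam -> dom ct t ->
     ~ is_pole (K w) (Gam w t) /\ ~ is_pole (dilate f gam) (Gam w t)) ->
  (forall w gam, W w -> U gam ->
     ex_contour_int (transform_integrand (K w) f gam) (Gam w)) ->
  (forall w gam, W w -> U gam -> holo_at (transform K Gam f gam) w) ->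
  (forall w m, W w -> (- Z.of_nat n0 <= m)%Z ->
     ex_contour_int (moment_integrand (K w) m) (Gam w)) ->
  (forall w m, W w -> (- Z.of_nat n0 <= m)%Z -> holo_at (moment K Gam m) w) ->
  (forall w, W w -> pole_order (K w) 0 k0) ->
  pole_order f 0 n0 ->
  laurent_expansion f n0 a ->
  (forall w gam, W w -> U gam ->
     deformable ct
       (fun z => ~ ((is_pole (K w) z \/ is_pole (dilate f gam) z) /\ z <> 0))
       (integrands (K w) f n0 gam) (Gam w) (Gam' w)) ->
  (forall w, W w -> smooth_segments ct d (tau w) (Gam' w)) ->
  0 < b ->
  (forall w, W w -> angle_condition d b (tau w) (Gam' w)) ->
  0 < c -> 0 < delta1 -> 0 < delta2 -> 0 < delta1 - delta2 ->
  (forall w, W w -> 0 <= cw w) ->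
  (forall gam, U gam -> c <= cgam gam) ->
  (forall w t, W w -> dom ct t -> Gam' w t <> 0 ->
     Cmod (K w (Gam' w t))
     <= cw w * exp (- delta1 * Cmod (Gam' w t)) / Cmod (Gam' w t) ^ k0) ->
  (forall w gam t, W w -> U gam -> dom ct t -> Gam' w t <> 0 ->
     Cmod (dilate f gam (Gam' w t))
     <= cgam gam * exp (delta2 * Cmod (Gam' w t))
        / Cmod (gam * Gam' w t) ^ n0) ->
  ((exists (N : nat) (M rho : R), 0 < rho /\
      forall gam, U gam -> Cmod gam < rho -> cgam gam * Cmod gam ^ N <= M) ->
   forall w, W w ->
     poincare_expansion U (fun gam => transform K Gam f gam w) n0
       (formal_coef K Gam a w))
  /\
  (forall n : Z, (Z.of_nat k0 - 1 <= n)%Z ->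
   forall w gam, W w -> U gam ->
     Cmod (transform K Gam f gam w - formal_transform K Gam n0 a gam n w)
     <= Cconst f n0 a k0 d b c (delta1 - delta2) gam n
        * cw w * cgam gam * powerRZ (Cmod gam) n
        * powerRZ (delta1 - delta2) (- (n - Z.of_nat k0 + 1))
        * INR (fact (Z.to_nat (n - Z.of_nat k0 + 1)))).
Proof.
  intros W U K f ct Gam k0 n0 a Gam' d tau b c delta1 delta2 cw cgam.
  intros _ _ _ _ _ _ HU [_ [_ HK]] Hf [Hcurve _] Havoid HexT _ HexM _ HpK Hpf HL Hdef Hseg Hb Hang
    Hc Hd1 Hd2 Hd Hcw Hcg HKb Hfb.
  assert (HU0 : forall gam, U gam -> gam <> 0) by (intros gam Hg E; apply HU; rewrite <- E; auto).
  assert (Hest : forall w gam n k, W w -> U gam -> (Z.of_nat k0 - 1 <= n)%Z -> (Z.of_nat k0 <=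
    k)%Z ->
    (k = n \/ k = n + 1)%Z ->
    Cmod (transform K Gam f gam w - formal_transform K Gam n0 a gam n w) <=
    INR d * (cw w * (cgam gam / c * powerRZ (Cmod gam) k) / b *
      (INR (fact (Z.to_nat (k - Z.of_nat k0))) / (delta1 - delta2) ^ S (Z.to_nat
        (k - Z.of_nat k0))))
    * cprime f n0 a c k).
  { intros w gam n k Hw Hg Hn Hk Hkn.
    apply (transform_estimate K f ct Gam Gam' k0 n0 a d (tau w) b c delta1 delta2 (cw w)
      (cgam gam) w gam n k); auto. }
  split.
  - intros [N [M [rho [Hrho HM]]]] w Hw.
    (* Starting at order [k0] allows the exponent k = n throughout, so this coefficient is
       independent of gamma, unlike [Cconst] at k0 - 1. *)
    apply (poincare_of_estimates U _ n0 _ cgam (Z.of_nat k0)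
      (fun k => INR d * (cw w / c / b * (INR (fact (Z.to_nat (k - Z.of_nat k0))) /
        (delta1 - delta2) ^ S (Z.to_nat (k - Z.of_nat k0))))
        * cprime f n0 a c k) N M rho); auto.
    + intros k. apply Rmult_le_pos; [|apply cprime_ge_0; auto].
      apply Rmult_le_pos; [apply pos_INR|]. apply Rmult_le_pos.
      * repeat apply Rdiv_le_0_compat; auto.
      * apply Rdiv_le_0_compat; [apply pos_INR|apply pow_lt; auto].
    + intros n gam Hn Hg. eapply Rle_trans; [apply (Hest w gam n n); auto; lia|].
      right. field. repeat split; try lra. apply pow_nonzero; lra.
  - intros n Hn w gam Hw Hg.
    destruct (estimate_constant f n0 k0 d a b c (cw w) (cgam gam) (delta1 - delta2) gam n)
      as [k [Hk [Hkn Hle]]]; auto.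
    { specialize (Hcg gam Hg). lra. }
    eapply Rle_trans; [apply (Hest w gam n k); auto|exact Hle].
Qed.
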